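(* Let $k$ be a commutative ring with unity and let $q\in k$ be invertible. Then $\mathsf{PR}_q=\mathsf{MR}_q/J_q$ (with the structure induced from $\mathsf{MR}_q$) and $\mathsf{PR}'_q=J_q^{\perp}\subseteq\mathsf{MR}'_q$ (with the structure restricted from $\mathsf{MR}'_q$) are $q$-Hopf algebras that are graded dual to each other with respect to the canonical pairing $\langle\cdot,\cdot\rangle:\mathsf{PR}'_q\times\mathsf{PR}_q\to k$ induced by $\langle w,w'\rangle=\delta_{w,w'}$ ($w,w'\in\mathfrak{S}$).
   Context: **Graded $q$-Hopf algebras.** A graded $q$-Hopf algebra is a connected $\mathbb{N}$-graded unital associative $k$-algebra $H=\bigoplus_n H_n$ with a graded coassociative counital coproduct $\Delta$ such that $\Delta(xy)=\Delta(x)\Delta(y)$, where $H\otimes H$ carries the twisted product $(a\otimes b)(c\otimes d)=q^{|b||c|}ac\otimes bd$ for homogeneous elements (the antipode then exists automatically). Two such are graded dual with respect to a pairing if, in each degree, the pairing is perfect, different degrees are orthogonal, and the product of each is adjoint to the coproduct of the other (with $\langle a\otimes b,c\otimes d\rangle=\langle a,c\rangle\langle b,d\rangle$). **The algebras $\mathsf{MR}_q$ and $\mathsf{MR}'_q$.** $k\mathfrak{S}=\bigoplus_{n\ge0}k\mathfrak{S}_n$, with $w\in\mathfrak{S}_n$ viewed as a word $w_1\cdots w_n$ on $[n]$; $\ell(w)$ is its number of inversions. For a word $u$ of length $n$ on a totally ordered alphabet, $\mathrm{st}(u)\in\mathfrak{S}_n$ is the permutation with $\mathrm{st}(u)(i)<\mathrm{st}(u)(j)$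 iff $u_i<u_j$, or $u_i=u_j$ and $i<j$; $\mathrm{alph}(u)$ is its set of letters; $u|_I$ is the subword of letters in $I$. For $w\in\mathfrak{S}_n$, $w'\in\mathfrak{S}_m$: - $w*w'=\sum uv$ over words $u,v$ with $\mathrm{alph}(u)\cup\mathrm{alph}(v)=[n+m]$, $\mathrm{st}(u)=w$, $\mathrm{st}(v)=w'$; - $\Delta_q(w)=\sum_{i=0}^nq^{\mathrm{inv}(i,w)}\,w|_{\{1,\dots,i\}}\otimes\mathrm{st}(w|_{\{i+1,\dots,n\}})$, where $\mathrm{inv}(i,w)$ is the number of pairs $(a,b)$ with $a>b$, $w_a\in\{1,\dots,i\}$, $w_b\in\{i+1,\dots,n\}$; - $w*'_qw'$ is the $q$-shuffle of $w$ with the word obtained by adding $n$ to each letter of $w'$; the $q$-shuffle is defined by $\emptyset\sqcup_q u=u\sqcup_q\emptyset=u$ and $(au)\sqcup_q(bv)=a(u\sqcup_q bv)+q^{|au|}\,b(au\sqcup_q v)$ for letters $a,b$, words $u,v$; - $\Delta'(w)=\sum_{i=0}^n\mathrm{st}(w_1\cdots w_i)\otimes\mathrm{st}(w_{i+1}\cdots w_n)$. $\mathsf{MR}_q=(k\mathfrak{S},*,\Delta_q)$ and $\mathsf{MR}'_q=(k\mathfrak{S},*'_q,\Delta')$ are graded $q$-Hopf algebras, graded dual under $\langle w,w'\rangle=\delta_{w,w'}$. **Knuth equivalence.** $w\sim_Kw'$ for words means that $P(w)=P(w')$, where $P(w)$ is the Schensted row-insertion tableau of $w$; equivalently $\sim_K$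 is generated by $yxz\sim yzx$ ($x<y\le z$) and $xzy\sim zxy$ ($x\le y<z$). **$J_q$, $\mathsf{PR}_q$, $\mathsf{PR}'_q$.** $J_q$ is the $k$-submodule of $k\mathfrak{S}$ spanned by all $w'-q^{\ell(w')-\ell(w)}w$ with $w\sim_Kw'$. $\mathsf{PR}_q:=\mathsf{MR}_q/J_q$ and $\mathsf{PR}'_q$ is the orthogonal complement of $J_q$ in $\mathsf{MR}'_q$, i.e. $\mathsf{PR}'_q=\bigoplus_{T}k\cdot c_q(T)$, over all standard Young tableaux $T$, with $c_q(T)=\sum_{P(w)=T}q^{\ell(w)}w$. *)

(* Defs.v *)
From HB Require Import structures.
From mathcomp Require Import all_boot all_algebra.
From mathcomp Require Import finmap boolp.
From mathcomp Require Import monalg.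

Set Implicit Arguments.
Unset Strict Implicit.
Unset Printing Implicit Defensive.

Import GRing.Theory.
Local Open Scope ring_scope.

Section LinearAlgebra.
Variable k : comNzRingType.

Section Span.
Variables (M : lmodType k) (S : M -> Prop).

Definition span : {pred M} := fun x =>
  `[< exists s : seq (k * M),
        (forall p, p \in s -> S p.2) /\ x = \sum_(p <- s) p.1 *: p.2 >].

Lemma span_submod : submod_closed span.
Proof.
split; first by apply/asboolP; exists [::]; split=> //; rewrite big_nil.
move=> a _ _ /asboolP[s [Ss ->]] /asboolP[t [St ->]]; apply/asboolP.
exists ([seq (a * p.1, p.2) | p <- s] ++ t); split.
  move=> p; rewrite mem_cat => /orP[/mapP[p' /Ss Sp' ->] //|]; exact: St.
rewrite big_cat big_map scaler_sumr /=.
by congr (_ + _); apply: eq_bigr => p _; rewrite scalerA.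
Qed.

HB.instance Definition _ := GRing.isSubmodClosed.Build k M span span_submod.

Lemma mem_span x : S x -> x \in span.
Proof.
move=> Sx; apply/asboolP; exists [:: (1, x)]; split.
  by move=> p; rewrite inE => /eqP ->.
by rewrite big_seq1 scale1r.
Qed.

End Span.

Section SubModule.
Variables (M : lmodType k) (U : submodClosed M).

Record subm := Subm { subm_val :> M; _ : subm_val \in U }.

HB.instance Definition _ := [isSub for subm_val].
HB.instance Definition _ := [Choice of subm by <:].
HB.instance Definition _ := [SubChoice_isSubLmodule of subm by <:].

End SubModule.

Section QuotientModule.
Local Open Scope quotient_scope.
Variables (M : lmodType k) (J : submodClosed M).

(* [submodClosed] does not inherit [zmodClosed], which [ideal_quot] needs. *)
Definition submod_pred : {pred M} := J.

Fact submod_pred_zmod : zmod_closed submod_pred.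
Proof.
split=> [|x y xJ yJ]; first exact: (rpred0 J).
by rewrite -scaleN1r; apply: (@rpredD M J) => //; apply: (@rpredZ k M J).
Qed.

HB.instance Definition _ :=
  GRing.isZmodClosed.Build M submod_pred submod_pred_zmod.

Definition quotm := {ideal_quot submod_pred}.
HB.instance Definition _ := GRing.Zmodule.on quotm.

Definition qpi (x : M) : quotm := \pi_{ideal_quot submod_pred} x.
Definition qrepr (z : quotm) : M := repr z.

Lemma qreprK z : qpi (qrepr z) = z. Proof. exact: reprK. Qed.

Lemma qpi_eq x y : qpi x = qpi y <-> x - y \in J.
Proof.
split=> [/eqP|xy]; first by rewrite -Quotient.idealrBE.
by apply/eqP; rewrite -Quotient.idealrBE.
Qed.

Lemma qpiD x y : qpi (x + y) = qpi x + qpi y.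
Proof. exact: Quotient.pi_add. Qed.

Definition quotm_scale (a : k) (z : quotm) : quotm := qpi (a *: qrepr z).

Lemma qpiZ a x : qpi (a *: x) = quotm_scale a (qpi x).
Proof.
apply/qpi_eq; rewrite -scalerBr rpredZ //.
by apply/qpi_eq; rewrite qreprK.
Qed.

Fact quotm_scaleA a b z :
  quotm_scale a (quotm_scale b z) = quotm_scale (a * b) z.
Proof. by rewrite -[z]qreprK -!qpiZ scalerA. Qed.

Fact quotm_scale1 : left_id 1 quotm_scale.
Proof. by move=> z; rewrite -[z]qreprK -!qpiZ scale1r. Qed.

Fact quotm_scaleDr : right_distributive quotm_scale +%R.
Proof.
by move=> a y z; rewrite -[y]qreprK -[z]qreprK -qpiD -!qpiZ scalerDr qpiD.
Qed.

Fact quotm_scaleDl z : {morph quotm_scale^~ z : a b / a + b}.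
Proof. by move=> a b; rewrite -[z]qreprK -!qpiZ scalerDl qpiD. Qed.

HB.instance Definition _ := GRing.Zmodule_isLmodule.Build k quotm
  quotm_scaleA quotm_scale1 quotm_scaleDr quotm_scaleDl.

Lemma qpi_linear : linear qpi.
Proof. by move=> a x y; rewrite qpiD qpiZ. Qed.

HB.instance Definition _ := GRing.isLinear.Build k M quotm _ qpi qpi_linear.

End QuotientModule.

Section LinearExtension.
Variables (K : choiceType) (V : lmodType k) (f : K -> V).

Definition linext (x : {malg k[K]}) : V := \sum_(w <- msupp x) x@_w *: f w.

Lemma linextEw (d : {fset K}) x :
  {subset msupp x <= d} -> linext x = \sum_(w <- d) x@_w *: f w.
Proof.
move=> sxd; apply: big_fset_incl => [|w _ wx]; first exact/fsubsetP.
by rewrite mcoeff_outdom // scale0r.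
Qed.

Lemma linext_linear : linear linext.
Proof.
move=> a x y; pose d := (msupp x `|` msupp y `|` msupp (a *: x + y))%fset.
rewrite (@linextEw d) => [|w wx]; last by rewrite !in_fsetE wx !orbT.
rewrite (@linextEw d x) => [|w wx]; last by rewrite !in_fsetE wx.
rewrite (@linextEw d y) => [|w wx]; last by rewrite !in_fsetE wx !orbT.
rewrite scaler_sumr -big_split /=; apply: eq_bigr => w _.
by rewrite mcoeffD mcoeffZ scalerDl scalerA.
Qed.

HB.instance Definition _ :=
  GRing.isLinear.Build k {malg k[K]} V _ linext linext_linear.

Lemma linextU w : linext << w >> = f w.
Proof.
rewrite /linext msuppU (negbTE (oner_neq0 k)) big_seq_fset1.
by rewrite mcoeffUU scale1r.
Qed.

End LinearExtension.

Definition bilext (K L : choiceType) (V : lmodType k) (f : K -> L -> V)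
  (x : {malg k[K]}) (y : {malg k[L]}) : V :=
  linext (fun w => linext (f w) y) x.

Section Tensor.
Variables M N : lmodType k.

Variant tensor_rel : {malg k[(M * N)%type]} -> Prop :=
| TensorDl x x' y :
    tensor_rel (<< (x + x', y) >> - << (x, y) >> - << (x', y) >>)
| TensorDr x y y' :
    tensor_rel (<< (x, y + y') >> - << (x, y) >> - << (x, y') >>)
| TensorZl a x y : tensor_rel (<< (a *: x, y) >> - a *: << (x, y) >>)
| TensorZr a x y : tensor_rel (<< (x, a *: y) >> - a *: << (x, y) >>).

Definition tensor : lmodType k := quotm (span tensor_rel).

Definition tens (x : M) (y : N) : tensor := qpi _ << (x, y) >>.

(* The linear map out of the tensor product induced by a bilinear [f];
   for non-bilinear [f] the value depends on the chosen representative. *)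
Definition tensor_lift (V : lmodType k) (f : M -> N -> V) (t : tensor) : V :=
  linext (fun p => f p.1 p.2) (qrepr t).

Lemma tens_bilinear : bilinear_for *:%R *:%R tens.
Proof.
have eqr (u v : {malg k[(M * N)%type]}) : tensor_rel (u - v) ->
    qpi (span tensor_rel) u = qpi (span tensor_rel) v.
  by move=> uv; apply/qpi_eq; apply: mem_span.
have eqrD (u v w : {malg k[(M * N)%type]}) : tensor_rel (u - v - w) ->
    qpi (span tensor_rel) u = qpi (span tensor_rel) v + qpi (span tensor_rel) w.
  by move=> uvw; rewrite -raddfD; apply: eqr; rewrite opprD addrA.
split=> [y a x x'|x a y y'] /=; rewrite /tens.
  rewrite (eqrD _ _ _ (TensorDl _ _ _)) (eqr _ _ (TensorZl a x y)).
  by rewrite linearZ.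
rewrite (eqrD _ _ _ (TensorDr _ _ _)) (eqr _ _ (TensorZr a x y)).
by rewrite linearZ.
Qed.

Lemma tens_gen (t : tensor) :
  exists s : seq (k * (M * N)), t = \sum_(p <- s) p.1 *: tens p.2.1 p.2.2.
Proof.
exists [seq ((qrepr t)@_w, w) | w <- msupp (qrepr t)].
rewrite big_map -{1}[t]qreprK {1}[qrepr t]monalgE raddf_sum /=.
apply: eq_bigr => -[x y] _ /=; rewrite /tens -linearZ /=; congr qpi.
by apply/malgP => w; rewrite mcoeffZ !mcoeffU mulrnAr mulr1.
Qed.

Section Lift.
Variables (V : lmodType k) (f : M -> N -> V).
Hypothesis f_bilin : bilinear_for *:%R *:%R f.

Let flin : {malg k[(M * N)%type]} -> V := linext (fun p => f p.1 p.2).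

Lemma tensor_lift_qpi u : tensor_lift f (qpi _ u) = flin u.
Proof.
have: qrepr (qpi (span tensor_rel) u) - u \in span tensor_rel.
  by apply/qpi_eq; rewrite qreprK.
move=> /asboolP[s [Ss Es]]; apply/eqP; rewrite -subr_eq0 /tensor_lift /flin.
rewrite -linearB Es linear_sum big_seq big1 // => -[a r] /Ss /= Sr.
rewrite linearZ /=; suff : flin r = 0 by rewrite /flin => ->; rewrite scaler0.
case: f_bilin => fl fr; rewrite /flin.
have fDl x x' y : f (x + x') y = f x y + f x' y.
  by have /= := fl y 1 x x'; rewrite !scale1r.
have fDr x y y' : f x (y + y') = f x y + f x y'.
  by have /= := fr x 1 y y'; rewrite !scale1r.
have fZl b x y : f (b *: x) y = b *: f x y.
  have f00 : f 0 y = 0 by have := fDl 0 0 y; rewrite addr0 => /eqP;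
    rewrite addrC -subr_eq subrr eq_sym => /eqP.
  by have /= := fl y b x 0; rewrite /= addr0 f00 addr0.
have fZr b x y : f x (b *: y) = b *: f x y.
  have f00 : f x 0 = 0 by have := fDr x 0 0; rewrite addr0 => /eqP;
    rewrite addrC -subr_eq subrr eq_sym => /eqP.
  by have /= := fr x b y 0; rewrite /= addr0 f00 addr0.
case: Sr => [x x' y|x y y'|b x y|b x y]; rewrite !(linearB, linearZ) /=
  !linextU /= ?fDl ?fDr ?fZl ?fZr ?subrr //.
- by rewrite -addrA -opprD subrr.
- by rewrite -addrA -opprD subrr.
- by rewrite scalerN subrr.
- by rewrite scalerN subrr.
Qed.

Lemma tensor_lift_linear : linear (tensor_lift f).
Proof.
move=> a s t; rewrite -[s]qreprK -[t]qreprK -linearP /= !tensor_lift_qpi.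
by rewrite /flin linearP.
Qed.

Lemma tensor_liftE x y : tensor_lift f (tens x y) = f x y.
Proof. by rewrite tensor_lift_qpi /flin linextU. Qed.

Lemma tensor_lift_uniq (g : {linear tensor -> V}) :
  (forall x y, g (tens x y) = f x y) -> g =1 tensor_lift f.
Proof.
move=> gE t; have [s ->] := tens_gen t.
pose h : {linear tensor -> V} :=
  HB.pack (tensor_lift f) (GRing.isLinear.Build _ _ _ _ _ tensor_lift_linear).
rewrite -[RHS]/(h _) !linear_sum; apply: eq_bigr => p _.
by rewrite !linearZ /= gE tensor_liftE.
Qed.

End Lift.

End Tensor.


Definition tensor_map (M N M' N' : lmodType k) (f : M -> M') (g : N -> N')
    : tensor M N -> tensor M' N' :=
  tensor_lift (fun x y => tens (f x) (g y)).

Definition tensor_assoc (M N P : lmodType k)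
    : tensor (tensor M N) P -> tensor M (tensor N P) :=
  tensor_lift (fun t z => tensor_lift (fun x y => tens x (tens y z)) t).

Definition tensor_pair (M N : lmodType k) (b : M -> N -> k^o)
    (s : tensor M M) (t : tensor N N) : k^o :=
  tensor_lift (fun x x' => tensor_lift (fun y y' => b x y * b x' y' : k^o) t) s.

End LinearAlgebra.

Notation "x ⊗ y" := (tens x y) (at level 40, left associativity) : ring_scope.

Section GradedQHopf.
Variable k : comNzRingType.

(* [hdeg n] is the homogeneous component of degree [n]. *)
Record hopf_data (H : lmodType k) := HopfData {
  hmul : H -> H -> H;
  hone : H;
  hcomul : H -> tensor H H;
  hcounit : H -> k^o;
  hdeg : nat -> H -> Prop
}.

Record is_grading (H : lmodType k) (G : nat -> H -> Prop) : Prop := {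
  grading_submod : forall n, G n 0 /\
    (forall a x y, G n x -> G n y -> G n (a *: x + y));
  grading_span : forall x, exists n (c : nat -> H),
    (forall i, G i (c i)) /\ x = \sum_(i < n) c i;
  grading_direct : forall n (c : nat -> H),
    (forall i, G i (c i)) -> \sum_(i < n) c i = 0 ->
    forall i, (i < n)%N -> c i = 0
}.

(* [mu] is the product (a ⊗ b)(c ⊗ d) = q^(|b||c|) ac ⊗ bd on H ⊗ H;
   it is determined by its values on homogeneous tensors. *)
Definition is_twisted_mul (q : k) (H : lmodType k) (D : hopf_data H)
    (mu : tensor H H -> tensor H H -> tensor H H) : Prop :=
  bilinear_for *:%R *:%R mu /\
  forall (i m n j : nat) (a b c d : H),
    hdeg D i a -> hdeg D m b -> hdeg D n c -> hdeg D j d ->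
    mu (a ⊗ b) (c ⊗ d) = q ^+ (m * n) *: (hmul D a c ⊗ hmul D b d).

Record is_graded_qHopf (q : k) (H : lmodType k) (D : hopf_data H) : Prop := {
  qh_grading : is_grading (hdeg D);
  qh_mul_bilinear : bilinear_for *:%R *:%R (hmul D);
  qh_mulA : associative (hmul D);
  qh_mul1l : left_id (hone D) (hmul D);
  qh_mul1r : right_id (hone D) (hmul D);
  qh_mul_graded : forall m n x y,
    hdeg D m x -> hdeg D n y -> hdeg D (m + n)%N (hmul D x y);
  qh_one_graded : hdeg D 0%N (hone D);
  qh_connected : forall x, hdeg D 0%N x -> exists! a : k, x = a *: hone D;
  qh_comul_linear : linear (hcomul D);
  qh_counit_linear : linear (hcounit D);
  qh_coassoc : forall x,
    tensor_assoc (tensor_map (hcomul D) id (hcomul D x)) =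
    tensor_map id (hcomul D) (hcomul D x);
  qh_counitl : forall x,
    tensor_lift (fun a b => hcounit D a *: b) (hcomul D x) = x;
  qh_counitr : forall x,
    tensor_lift (fun a b => hcounit D b *: a) (hcomul D x) = x;
  qh_comul_graded : forall n x, hdeg D n x ->
    hcomul D x \in span (fun t => exists i j a b,
      [/\ (i + j = n)%N, hdeg D i a, hdeg D j b & t = a ⊗ b]);
  qh_counit_graded : forall n x,
    (0 < n)%N -> hdeg D n x -> hcounit D x = 0;
  qh_comul_mul : exists2 mu, is_twisted_mul q D mu &
    forall x y, hcomul D (hmul D x y) = mu (hcomul D x) (hcomul D y)
}.

Record hopf_morphism (H H' : lmodType k) (D : hopf_data H) (D' : hopf_data H')
    (f : H -> H') : Prop := {
  hm_linear : linear f;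
  hm_mul : forall x y, f (hmul D x y) = hmul D' (f x) (f y);
  hm_one : f (hone D) = hone D';
  hm_comul : forall x, hcomul D' (f x) = tensor_map f f (hcomul D x);
  hm_counit : forall x, hcounit D' (f x) = hcounit D x
}.

Definition linear_on (M : lmodType k) (P : M -> Prop) (f : M -> k) : Prop :=
  forall a x y, P x -> P y -> f (a *: x + y) = a * f x + f y.

Record graded_dual (H H' : lmodType k) (D : hopf_data H) (D' : hopf_data H')
    (b : H -> H' -> k^o) : Prop := {
  gd_bilinear : bilinear_for *%R *%R b;
  gd_orthogonal : forall m n x y,
    hdeg D m x -> hdeg D' n y -> m <> n -> b x y = 0;
  gd_perfectl : forall n (f : H' -> k), linear_on (hdeg D' n) f ->
    exists! x, hdeg D n x /\ forall y, hdeg D' n y -> b x y = f y;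
  gd_perfectr : forall n (f : H -> k), linear_on (hdeg D n) f ->
    exists! y, hdeg D' n y /\ forall x, hdeg D n x -> b x y = f x;
  gd_mul_comul : forall x x' y,
    b (hmul D x x') y = tensor_pair b (x ⊗ x') (hcomul D' y);
  gd_comul_mul : forall x y y',
    b x (hmul D' y y') = tensor_pair b (hcomul D x) (y ⊗ y')
}.

(* The structure of [D'] on M/J is induced from that of [D] on M. *)
Record is_quotient_hopf (M : lmodType k) (J : submodClosed M)
    (D : hopf_data M) (D' : hopf_data (quotm J)) : Prop := {
  quo_morphism : hopf_morphism D D' (qpi J);
  quo_deg : forall n z, hdeg D' n z <-> exists2 x, hdeg D n x & qpi J x = z
}.

(* The structure of [D'] on U is restricted from that of [D] on M; for the
   coproduct this says that [D] maps U to the image of U ⊗ U in M ⊗ M. *)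
Record is_sub_hopf (M : lmodType k) (U : submodClosed M)
    (D : hopf_data M) (D' : hopf_data (subm U)) : Prop := {
  sub_morphism : hopf_morphism D' D (@subm_val k M U);
  sub_deg : forall n x, hdeg D' n x <-> hdeg D n (subm_val x)
}.

End GradedQHopf.

(* Permutations are handled through their words w_1 ... w_n, with letters in
   {1, ..., n}; the size of the word is the degree n. *)
Definition perm_word : pred (seq nat) := fun w => perm_eq w (iota 1 (size w)).

Record sperm := SPerm { sword :> seq nat; _ : perm_word sword }.

HB.instance Definition _ := [isSub for sword].
HB.instance Definition _ := [Countable of sperm by <:].

Section Words.
Local Open Scope nat_scope.
Implicit Types u v w : seq nat.

(* The order on positions of u used by standardization: by letter, and from
   left to right among equal letters. *)
Definition st_lt u (i j : nat) : bool :=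
  (nth 0 u i < nth 0 u j) || ((nth 0 u i == nth 0 u j) && (i < j)).

Definition st_word u : seq nat :=
  [seq (count (fun j => st_lt u j i) (iota 0 (size u))).+1
     | i <- iota 0 (size u)].

Lemma size_st_word u : size (st_word u) = size u.
Proof. by rewrite size_map size_iota. Qed.

Lemma st_lt_trans u : transitive (st_lt u).
Proof.
move=> j i l; rewrite /st_lt => /orP[ij|/andP[/eqP -> ij]].
  by case/orP=> [jl|/andP[/eqP <- _]]; rewrite ?ij // (ltn_trans ij jl).
by case/orP=> [->//|/andP[-> jl]]; rewrite (ltn_trans ij jl) orbT.
Qed.

Lemma st_lt_irr u : irreflexive (st_lt u).
Proof. by move=> i; rewrite /st_lt !ltnn andbF. Qed.

Lemma st_lt_total u i j : i != j -> st_lt u i j || st_lt u j i.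
Proof.
by rewrite /st_lt neq_ltn => ij; case: (ltngtP (nth 0 u i) (nth 0 u j)).
Qed.

Lemma nth_st_word u i : i < size u ->
  nth 0 (st_word u) i = (count (fun j => st_lt u j i) (iota 0 (size u))).+1.
Proof. by move=> ltiu; rewrite (nth_map 0) ?size_iota // nth_iota. Qed.

Lemma st_word_mono u i j : i < size u -> j < size u -> st_lt u i j ->
  nth 0 (st_word u) i < nth 0 (st_word u) j.
Proof.
move=> ltiu ltju ij; rewrite !nth_st_word // ltnS.
have <- : count (predU (st_lt u ^~ i) (pred1 i)) (iota 0 (size u))
          = (count (st_lt u ^~ i) (iota 0 (size u))).+1.
  have := count_predUI (st_lt u ^~ i) (pred1 i) (iota 0 (size u)).
  rewrite (@eq_count _ (predI _ _) pred0) => [|l /=]; last first.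
    by case: eqP => [->|]; rewrite ?st_lt_irr ?andbF.
  by rewrite count_pred0 addn0 count_uniq_mem ?iota_uniq // mem_iota ltiu addn1.
apply: sub_count => l /= /orP[li|/eqP -> //]; exact: st_lt_trans li ij.
Qed.

Lemma st_wordP u i j : i < size u -> j < size u ->
  (nth 0 (st_word u) i < nth 0 (st_word u) j) = st_lt u i j.
Proof.
move=> ltiu ltju; apply/idP/idP => [ltw|]; last exact: st_word_mono.
have [eqij|/(st_lt_total u)/orP[//|ji]] := eqVneq i j.
  by rewrite eqij ltnn in ltw.
by have := st_word_mono ltju ltiu ji; rewrite ltnNge (ltnW ltw).
Qed.

Lemma st_word_perm u : perm_word (st_word u).
Proof.
rewrite /perm_word size_st_word.
have uniqw : uniq (st_word u).
  apply/(uniqP 0) => i j; rewrite !inE size_st_word => ltiu ltju eqw.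
  apply/eqP; apply: contraT => /(st_lt_total u)/orP[] lt_st.
    by have := st_word_mono ltiu ltju lt_st; rewrite eqw ltnn.
  by have := st_word_mono ltju ltiu lt_st; rewrite eqw ltnn.
apply: uniq_perm; rewrite ?iota_uniq //.
have subw : {subset st_word u <= iota 1 (size u)}.
  move=> x /(nthP 0)[i]; rewrite size_st_word => ltiu <-.
  rewrite mem_iota add1n nth_st_word // !ltnS /=.
  have := count_predC (st_lt u ^~ i) (iota 0 (size u)).
  rewrite size_iota => {2}<-; rewrite -[X in X < _]addn0 ltn_add2l -has_count.
  by apply/hasP; exists i; rewrite ?mem_iota //= st_lt_irr.
by have [] := uniq_min_size uniqw subw; rewrite // size_iota size_st_word.
Qed.

Definition st u : sperm := SPerm (st_word_perm u).

Definition ninv w : nat :=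
  #|[set p : 'I_(size w) * 'I_(size w) |
      (p.1 < p.2) && (nth 0 w p.2 < nth 0 w p.1)]|.

Definition invi (i : nat) w : nat :=
  #|[set p : 'I_(size w) * 'I_(size w) |
      [&& p.2 < p.1, nth 0 w p.1 <= i & i < nth 0 w p.2]]|.

(* Schensted insertion of x in a row: x replaces the leftmost letter > x,
   which is bumped into the next row, or is appended if there is none. *)
Fixpoint row_insert (x : nat) (r : seq nat) : seq nat * option nat :=
  if r is y :: r' then
    if x < y then (x :: r', Some y)
    else let: (r'', b) := row_insert x r' in (y :: r'', b)
  else ([:: x], None).

Fixpoint tab_insert (x : nat) (T : seq (seq nat)) : seq (seq nat) :=
  if T is r :: T' then
    let: (r', b) := row_insert x r in
    if b is Some y then r' :: tab_insert y T' else r' :: T'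
  else [:: [:: x]].

Definition Ptab w : seq (seq nat) :=
  foldl (fun T x => tab_insert x T) [::] w.

Definition knuth w w' : bool := Ptab w == Ptab w'.

End Words.

Section MalvenutoReutenauer.
Variable k : comNzRingType.

Definition kS : lmodType k := {malg k[sperm]}.

(* The basis element given by a word; all the words to which this is applied
   below are words of permutations. *)
Definition bas (u : seq nat) : kS :=
  if insub u is Some w then << (w : sperm) >> else 0.

Definition kS_deg (n : nat) (x : kS) : Prop :=
  forall w, w \in msupp x -> size (sword w) = n.

Definition kS_counit (x : kS) : k^o :=
  linext (fun w => (size (sword w) == 0%N)%:R : k^o) x.

Definition kS_pair (x y : kS) : k^o :=
  bilext (fun w w' => (w == w')%:R : k^o) x y.

(* A word on the alphabet {1, ..., N}. *)
Definition letters (N : nat) (t : seq 'I_N) : seq nat :=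
  [seq (nat_of_ord i).+1 | i <- t].

Definition mr_mul (w w' : sperm) : kS :=
  \sum_(u : (size w).-tuple 'I_(size w + size w'))
  \sum_(v : (size w').-tuple 'I_(size w + size w') |
         [&& st (letters u) == w, st (letters v) == w'
           & [forall i, (i \in u) || (i \in v)]])
    bas (letters u ++ letters v).

Definition mr_comul (q : k) (w : sperm) : tensor kS kS :=
  \sum_(0 <= i < (size w).+1) q ^+ invi i w *:
    (bas [seq x <- w | (x <= i)%N] ⊗ << st [seq x <- w | (i < x)%N] >>).

Definition MR (q : k) : hopf_data kS := {|
  hmul := bilext mr_mul;
  hone := bas [::];
  hcomul := linext (mr_comul q);
  hcounit := kS_counit;
  hdeg := kS_deg
|}.

Definition prep (a : nat) : {malg k[seq nat]} -> {malg k[seq nat]} :=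
  linext (fun u => << a :: u >>).

Fixpoint qshuffle (q : k) (u : seq nat) : seq nat -> {malg k[seq nat]} :=
  match u with
  | [::] => fun v => << v >>
  | a :: u' =>
    fix qshuffle_u (v : seq nat) : {malg k[seq nat]} :=
      match v with
      | [::] => << a :: u' >>
      | b :: v' => prep a (qshuffle q u' v)
                   + q ^+ size (a :: u') *: prep b (qshuffle_u v')
      end
  end.

Definition mr'_mul (q : k) (w w' : sperm) : kS :=
  linext bas (qshuffle q w [seq (x + size w)%N | x <- w']).

Definition mr'_comul (w : sperm) : tensor kS kS :=
  \sum_(0 <= i < (size w).+1) << st (take i w) >> ⊗ << st (drop i w) >>.

Definition MR' (q : k) : hopf_data kS := {|
  hmul := bilext (mr'_mul q);
  hone := bas [::];
  hcomul := linext mr'_comul;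
  hcounit := kS_counit;
  hdeg := kS_deg
|}.

Section Orthogonal.
Variable J : {pred kS}.

Definition orth : {pred kS} := fun x => `[< forall y, y \in J -> kS_pair x y = 0 >].

Lemma orth_submod : submod_closed orth.
Proof.
split; first by apply/asboolP => y _; rewrite /kS_pair /bilext linear0.
move=> a x y /asboolP xJ /asboolP yJ; apply/asboolP => z zJ.
have -> : kS_pair (a *: x + y) z = a *: kS_pair x z + kS_pair y z.
  by rewrite /kS_pair /bilext linearP.
by rewrite xJ // yJ // scaler0 addr0.
Qed.

HB.instance Definition _ := GRing.isSubmodClosed.Build k kS orth orth_submod.

End Orthogonal.

End MalvenutoReutenauer.

Definition Jq (k : comUnitRingType) (q : k) : submodClosed (kS k) := span (fun x : kS k =>
  exists w w' : sperm, knuth w w' /\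
    x = << w' >> - q ^ ((ninv w')%:Z - (ninv w)%:Z) *: << w >>).

(* Main.v *)
Require Import Defs.
From HB Require Import structures.
From mathcomp Require Import all_boot all_algebra.
From mathcomp Require Import finmap boolp.
From mathcomp Require Import monalg.
From mathcomp Require Import zify ring.

Set Implicit Arguments.
Unset Strict Implicit.
Unset Printing Implicit Defensive.

Import GRing.Theory.
Local Open Scope ring_scope.

(** The idea is to trade the algebraic axioms for identities between structure
    constants, and to prove these on the combinatorial side once.

    Rescaling.  Since [q] is invertible, the algebra MR has the basis
    [tilde w = q^(-l(w)) w], in which [Jq] is spanned by the differences
    [tilde w' - tilde w] of Knuth equivalent permutations.  The length of a word
    is the sum of the lengths of the two halves of any cut of the word, in
    positions or in values, and of the number of inversions across the cut; hence
    in the basis [tilde] the product of MR acquires the power of [q] counting the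
    inversions across the cut in positions ([mr_mu]), and the powers of [q] of
    the coproduct disappear ([mr_de]).  The algebra MR', in the dual basis
    [hat w = q^(l(w)) w], has the transposed constants ([MR_presents],
    [MR'_presents]).

    The axioms for the constants.  Given the result [x], the two factors of a
    term of a product, or the two halves of a term of a coproduct, are determined
    by the place of the cut.  So both sides of associativity and of
    coassociativity have at most one nonzero term ([mr_mu_assoc],
    [mr_de_assoc]).  For the compatibility of product and coproduct
    ([mr_compat]), a permutation [x] cut both in positions and in values falls
    into four blocks, and conversely it is reconstructed from its four margins
    and the numbers of small letters in its two halves ([split_inj],
    [split_exists]); the twist [q^(|b||c|)] counts the inversions between the
    large letters of the first half and the small letters of the second.

    Passage to Knuth classes.  Schensted insertion characterizes the plactic
    congruence ([knuthP]): insertion respects the Knuth relations row by row, and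
    every word is congruent to the reading of its tableau.  The congruence is
    stable under concatenation, under restriction to intervals of letters, and
    under increasing relabelling.  Therefore the sum of the constants of MR over
    the classes of the outputs depends only on the classes of the inputs
    ([knuth_lump_mu], [knuth_lump_de]): the constants can be lumped along the
    classes, and the lumped constants satisfy the same axioms
    ([lumped_constants]).

    Conclusion.  The classes of the [tilde w] form a basis of the quotient by
    [Jq], on which the lumped constants define the quotient structure
    ([lumped_quotient]); the sums of the [hat w] over the classes form a basis of
    the orthogonal complement of [Jq], on which the transposed lumped constants
    define the restricted structure ([lumped_sub]).  The axioms for the constants
    are invariant under transposition ([qhopf_constants_dual]), so both structures
    are graded q-Hopf algebras ([constant_hopf_qHopf]), and they are graded dual
    since the two bases are dual to each other ([constant_hopf_dual]). *)

(** * Modules with a basis, and bilinear maps *)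

Section Linear.
Variable k : comNzRingType.
Implicit Types M N P V W : lmodType k.

Notation bilinear f := (bilinear_for *:%R *:%R f).

Definition lin_pack M V (f : M -> V) (fl : linear f) : {linear M -> V} :=
  HB.pack f (GRing.isLinear.Build _ _ _ _ f fl).

Lemma lin_sum M V (f : M -> V) I (s : seq I) (p : pred I) (c : I -> k) (x : I -> M) :
  linear f -> f (\sum_(i <- s | p i) c i *: x i) = \sum_(i <- s | p i) c i *: f (x i).
Proof.
move=> fl; rewrite -[f]/(lin_pack fl : _ -> _) linear_sum.
by apply: eq_bigr => i _; rewrite linearZ.
Qed.

Lemma lin_comp M V W (f : V -> W) (g : M -> V) : linear f -> linear g -> linear (f \o g).
Proof. by move=> fl gl a x y /=; rewrite gl fl. Qed.

Lemma bil_suml M N V (f : M -> N -> V) I (s : seq I) (p : pred I)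
    (c : I -> k) (x : I -> M) y : bilinear f ->
  f (\sum_(i <- s | p i) c i *: x i) y = \sum_(i <- s | p i) c i *: f (x i) y.
Proof. by case=> fl _; apply: (lin_sum (f := f^~ y)). Qed.

Lemma bil_sumr M N V (f : M -> N -> V) I (s : seq I) (p : pred I)
    (c : I -> k) (x : I -> N) y : bilinear f ->
  f y (\sum_(i <- s | p i) c i *: x i) = \sum_(i <- s | p i) c i *: f y (x i).
Proof. by case=> _ fr; apply: lin_sum. Qed.

Lemma bil_comp M N M' N' V (f : M' -> N' -> V) (g : M -> M') (h : N -> N') :
  bilinear f -> linear g -> linear h -> bilinear (fun x y => f (g x) (h y)).
Proof.
case=> fl fr gl hl; split=> [y|x] a u v /=; first by rewrite gl fl.
by rewrite hl fr.
Qed.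

Lemma bil_lin M N V W (f : V -> W) (g : M -> N -> V) :
  linear f -> bilinear g -> bilinear (fun x y => f (g x y)).
Proof. by move=> fl [gl gr]; split=> [y|x] a u v /=; rewrite ?gl ?gr fl. Qed.

Section LinextFun.
Variables (K : choiceType) (V : lmodType k).

Lemma linext_fun a (f g : K -> V) x :
  linext (fun w => a *: f w + g w) x = a *: linext f x + linext g x.
Proof.
rewrite /linext scaler_sumr -big_split; apply: eq_bigr => w _ /=.
by rewrite scalerDr !scalerA mulrC.
Qed.

Lemma bilext_bilinear (L : choiceType) (f : K -> L -> V) : bilinear (bilext f).
Proof.
split=> [y|x] a u v; rewrite /bilext /=; first by rewrite linearP.
rewrite -linext_fun; congr linext; apply/funext => w; exact: linearP.
Qed.

Lemma bilextE (L : choiceType) (f : K -> L -> V) w w' :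
  bilext f << w >> << w' >> = f w w'.
Proof. by rewrite /bilext !linextU. Qed.

End LinextFun.

Lemma tensor_lift_fun M N V a (f g : M -> N -> V) t :
  tensor_lift (fun x y => a *: f x y + g x y) t
  = a *: tensor_lift f t + tensor_lift g t.
Proof. exact: linext_fun. Qed.

Lemma tensor_map_bilinear M N M' N' (f : M -> M') (g : N -> N') :
  linear f -> linear g -> bilinear (fun x y => f x ⊗ g y).
Proof. by move=> fl gl; apply: bil_comp fl gl; apply: tens_bilinear. Qed.

Lemma tensor_map_linear M N M' N' (f : M -> M') (g : N -> N') :
  linear f -> linear g -> linear (tensor_map f g).
Proof.
by move=> fl gl; apply: tensor_lift_linear; apply: tensor_map_bilinear.
Qed.

Lemma tensor_mapE M N M' N' (f : M -> M') (g : N -> N') x y :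
  linear f -> linear g -> tensor_map f g (x ⊗ y) = f x ⊗ g y.
Proof.
by move=> fl gl; apply: (tensor_liftE (f := fun x y => f x ⊗ g y));
  apply: tensor_map_bilinear.
Qed.

Lemma id_linear M : linear (@id M). Proof. by []. Qed.

Section TensorAssoc.
Variables M N P : lmodType k.

Lemma tensor_assoc_bilinear z :
  bilinear (fun (x : M) (y : N) => x ⊗ (y ⊗ z) : tensor M (tensor N P)).
Proof.
have [tl tr] := tens_bilinear M (tensor N P); have [tl' _] := tens_bilinear N P.
by split=> [y|x] a u v /=; [apply: tl | rewrite tl' tr].
Qed.

Lemma tensor_assoc_bilinear2 : bilinear (fun (t : tensor M N) (z : P) =>
  tensor_lift (fun x y => x ⊗ (y ⊗ z) : tensor M (tensor N P)) t).
Proof.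
split=> [z|t] a u v; first exact: tensor_lift_linear (tensor_assoc_bilinear z) _ _ _.
rewrite -tensor_lift_fun; congr (tensor_lift _ t); apply/funext => x; apply/funext => y.
have [_ tr] := tens_bilinear M (tensor N P); have [_ tr'] := tens_bilinear N P.
by rewrite tr' tr.
Qed.

Lemma tensor_assoc_linear : linear (@tensor_assoc k M N P).
Proof. exact: tensor_lift_linear tensor_assoc_bilinear2. Qed.

Lemma tensor_assocE (x : M) (y : N) (z : P) :
  tensor_assoc (x ⊗ y ⊗ z) = x ⊗ (y ⊗ z).
Proof.
rewrite /tensor_assoc (tensor_liftE tensor_assoc_bilinear2).
exact: (tensor_liftE (tensor_assoc_bilinear z)).
Qed.

End TensorAssoc.

(** Both the twisted product on a tensor square and the pairing of two tensor
    squares arise in this way. *)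
Section Quadrilinear.
Variables (M N P Q V : lmodType k) (f : M -> N -> P -> Q -> V).
Hypothesis f12 : forall z w, bilinear (fun x y => f x y z w).
Hypothesis f34 : forall x y, bilinear (f x y).

Lemma tensor_lift2_bilinear :
  bilinear (fun s t => tensor_lift (fun x y => tensor_lift (f x y) t) s).
Proof.
split=> [t|s] a u v; last first.
  rewrite -tensor_lift_fun; congr (tensor_lift _ s); apply/funext => x; apply/funext => y.
  exact: (tensor_lift_linear (f34 x y)).
apply: tensor_lift_linear; split=> [y|x] b x1 x2; rewrite -tensor_lift_fun;
  congr (tensor_lift _ t); apply/funext => z; apply/funext => w.
  exact: (f12 z w).1.
exact: (f12 z w).2.
Qed.

Lemma tensor_lift2E x y z w :
  tensor_lift (fun x y => tensor_lift (f x y) (z ⊗ w)) (x ⊗ y) = f x y z w.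
Proof.
rewrite (tensor_liftE (f := fun x y => tensor_lift (f x y) (z ⊗ w))).
  exact: tensor_liftE (f34 x y) _ _.
split=> [y'|x'] a u v; rewrite -tensor_lift_fun;
  congr (tensor_lift _ _); apply/funext => z'; apply/funext => w'.
  exact: (f12 z' w').1.
exact: (f12 z' w').2.
Qed.

End Quadrilinear.

Lemma sum_tens (I J : Type) (s : seq I) (t : seq J) M1 M2
    (x : I -> M1) (y : J -> M2) (f : I -> J -> k) V
    (g : tensor M1 M2 -> V) : linear g ->
  g (\sum_(i <- s) \sum_(j <- t) f i j *: (x i ⊗ y j))
  = \sum_(i <- s) \sum_(j <- t) f i j *: g (x i ⊗ y j).
Proof.
move=> gl; rewrite -[g]/(lin_pack gl : _ -> _) linear_sum; apply: eq_bigr => i _.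
by rewrite linear_sum; apply: eq_bigr => j _; rewrite linearZ.
Qed.

Lemma sum_tens2 (I J : Type) (s : seq I) (t : seq J) M1 M2
    (x : I -> M1) (y : J -> M2) (f : I -> J -> k) V W
    (g : V -> W) (h : tensor M1 M2 -> V) : linear g -> linear h ->
  g (h (\sum_(i <- s) \sum_(j <- t) f i j *: (x i ⊗ y j)))
  = \sum_(i <- s) \sum_(j <- t) f i j *: g (h (x i ⊗ y j)).
Proof. by move=> gl hl; apply: (sum_tens _ _ _ _ _ (lin_comp gl hl)). Qed.

Definition tens_by M1 M2 (z : M2) (t : M1) := t ⊗ z.

Lemma tens_linear M1 M2 (z : M2) : linear (@tens_by M1 M2 z).
Proof. by case: (tens_bilinear M1 M2) => tl _; apply: tl. Qed.

Lemma bilext_fun (K L : choiceType) V r (f g : K -> L -> V) x y :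
  bilext (fun w w' => r *: f w w' + g w w') x y = r *: bilext f x y + bilext g x y.
Proof.
rewrite /bilext -linext_fun; congr linext; apply/funext => w; exact: linext_fun.
Qed.

Lemma bilext_eq (K L : choiceType) V (f g : K -> L -> V) x y :
  f =2 g -> bilext f x y = bilext g x y.
Proof. by move=> fg; congr bilext; apply/funext => w; apply/funext => w'. Qed.

Lemma bil_scale M N V (f : M -> N -> V) c d x y :
  bilinear f -> f (c *: x) (d *: y) = (c * d) *: f x y.
Proof.
move=> [fl fr]; rewrite -[f _ _]/((lin_pack (fl (d *: y)) : _ -> _) (c *: x)) linearZ /=.
by rewrite -[f x _]/((lin_pack (fr x) : _ -> _) (d *: y)) linearZ /= scalerA.
Qed.

(** The coordinates are part of the data, as elements of the free module, so that
    finiteness of the support needs no further mention. *)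
Record is_basis M (B : choiceType) (e : B -> M) (co : M -> {malg k[B]}) : Prop := {
  co_linear : linear co;
  coE : forall a, co (e a) = << a >>;
  coK : cancel co (linext e)
}.

Section Basis.
Variables (M : lmodType k) (B : choiceType) (e : B -> M) (co : M -> {malg k[B]}).
Hypothesis eB : is_basis e co.

Lemma basis_ext V (f g : M -> V) : linear f -> linear g ->
  (forall a, f (e a) = g (e a)) -> f =1 g.
Proof.
move=> fl gl fg x; rewrite -(coK eB x) /linext !lin_sum //.
by apply: eq_bigr => a _; rewrite fg.
Qed.

Lemma basis_bil_ext N B' e' co' V (f g : M -> N -> V) :
    @is_basis N B' e' co' -> bilinear f -> bilinear g ->
  (forall a b, f (e a) (e' b) = g (e a) (e' b)) -> forall x y, f x y = g x y.
Proof.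
move=> eB' fb gb fg x y; rewrite -(coK eB x) /linext !bil_suml //.
apply: eq_bigr => a _; congr (_ *: _).
rewrite -(coK eB' y) /linext !bil_sumr //.
by apply: eq_bigr => b _; rewrite fg.
Qed.

End Basis.

End Linear.

(** * Graded Hopf algebras given by structure constants *)

(** [E n] lists the indices of degree at most [n].  Finiteness in each degree is
    what makes the transpose of a family of structure constants meaningful. *)
Record graded_index (B : choiceType) (deg : B -> nat) (E : nat -> seq B)
    (one : B) : Prop := {
  upto_uniq : forall n, uniq (E n);
  mem_upto : forall n a, (a \in E n) = (deg a <= n)%N;
  index_deg0 : forall a, (deg a == 0%N) = (a == one)
}.

(** [mu a b x] is the coefficient of [x] in the product of [a] and [b], and
    [de a b x] that of [a ⊗ b] in the coproduct of [x].  With this order of the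
    arguments the axioms are invariant under exchanging [mu] and [de], which is
    the passage to the graded dual.  The bounds on [n] ensure that the sums over
    [E n] contain all the nonzero terms. *)
Record qhopf_constants (k : comNzRingType) (q : k) (B : choiceType)
    (deg : B -> nat) (E : nat -> seq B) (one : B) (mu de : B -> B -> B -> k) : Prop := {
  mu_deg : forall a b x, deg x != (deg a + deg b)%N -> mu a b x = 0;
  de_deg : forall a b x, deg x != (deg a + deg b)%N -> de a b x = 0;
  mu_onel : forall a x, mu one a x = (a == x)%:R;
  mu_oner : forall a x, mu a one x = (a == x)%:R;
  de_onel : forall a x, de one a x = (a == x)%:R;
  de_oner : forall a x, de a one x = (a == x)%:R;
  mu_assoc : forall n a b c x, (deg x <= n)%N ->
    \sum_(y <- E n) mu a b y * mu y c x = \sum_(y <- E n) mu b c y * mu a y x;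
  de_assoc : forall n a b c x, (deg x <= n)%N ->
    \sum_(y <- E n) de a b y * de y c x = \sum_(y <- E n) de b c y * de a y x;
  mu_de_compat : forall n a b c d, (deg a + deg b <= n)%N || (deg c + deg d <= n)%N ->
    \sum_(x <- E n) mu a b x * de c d x =
    \sum_(a1 <- E n) \sum_(a2 <- E n) \sum_(b1 <- E n) \sum_(b2 <- E n)
      q ^+ (deg a2 * deg b1) * (de a1 a2 a * de b1 b2 b * (mu a1 b1 c * mu a2 b2 d))
}.

Lemma qhopf_constants_dual (k : comNzRingType) (q : k) (B : choiceType)
    (deg : B -> nat) (E : nat -> seq B) (one : B) (mu de : B -> B -> B -> k) :
  qhopf_constants q deg E one mu de -> qhopf_constants q deg E one de mu.
Proof.
case=> md dd ml mr dl dr ma da mdc; split=> // n a b c d.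
rewrite orbC => /mdc mdcE; under eq_bigr do rewrite mulrC; rewrite mdcE.
apply: eq_bigr => a1 _; rewrite exchange_big; apply: eq_bigr => b1 _.
apply: eq_bigr => a2 _; apply: eq_bigr => b2 _.
by rewrite mulnC [X in _ * X]mulrC.
Qed.

Section SumDelta.
Variables (R : nzRingType) (B : eqType).

Lemma sum_deltal (s : seq B) a (F : B -> R) : uniq s ->
  \sum_(x <- s) (a == x)%:R * F x = if a \in s then F a else 0.
Proof.
elim: s => [|b s IH] /=; first by rewrite big_nil.
move=> /andP[bs Us]; rewrite big_cons IH // inE; case: (eqVneq a b) => [->|] /=.
  by rewrite (negbTE bs) mul1r addr0.
by rewrite mul0r add0r.
Qed.

Lemma sumZ_deltal (M : lmodType R) (s : seq B) a (F : B -> M) : uniq s ->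
  \sum_(x <- s) (a == x)%:R *: F x = if a \in s then F a else 0.
Proof.
elim: s => [|b s IH] /=; first by rewrite big_nil.
move=> /andP[bs Us]; rewrite big_cons IH // inE; case: (eqVneq a b) => [->|] /=.
  by rewrite (negbTE bs) scale1r addr0.
by rewrite scale0r add0r.
Qed.

End SumDelta.

Lemma reindex_seq (V : nmodType) (I J : eqType) (s : seq I) (t : seq J) (h : I -> J) (g : J -> I)
    (F : I -> V) (G : J -> V) : uniq s -> uniq t ->
    (forall i, i \in s -> [/\ h i \in t, g (h i) = i & F i = G (h i)]) ->
    (forall j, j \in t -> g j \in s /\ h (g j) = j) ->
  \sum_(i <- s) F i = \sum_(j <- t) G j.
Proof.
move=> Us Ut hP gP; have -> : \sum_(i <- s) F i = \sum_(i <- s) G (h i).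
  by rewrite big_seq [RHS]big_seq; apply: eq_bigr => i /hP[].
rewrite -(big_map h xpredT G); apply/perm_big/uniq_perm => //.
  rewrite map_inj_in_uniq // => i j /hP[_ gi _] /hP[_ gj _] hij.
  by rewrite -gi hij gj.
move=> j; apply/mapP/idP => [[i /hP[hi _ _] -> //]|/gP[gj gK]].
by exists (g j).
Qed.

Lemma sum_rotate (V : nmodType) (I1 I2 I3 I4 : Type) (s1 : seq I1) (s2 : seq I2)
    (s3 : seq I3) (s4 : seq I4) (F : I1 -> I2 -> I3 -> I4 -> V) :
  \sum_(a <- s1) \sum_(b <- s2) \sum_(c <- s3) \sum_(d <- s4) F a b c d
  = \sum_(c <- s3) \sum_(d <- s4) \sum_(b <- s2) \sum_(a <- s1) F a b c d.
Proof.
transitivity (\sum_(a <- s1) \sum_(c <- s3) \sum_(b <- s2) \sum_(d <- s4) F a b c d).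
  by apply: eq_bigr => a _; rewrite exchange_big.
rewrite exchange_big; apply: eq_bigr => c _.
transitivity (\sum_(a <- s1) \sum_(d <- s4) \sum_(b <- s2) F a b c d).
  by apply: eq_bigr => a _; rewrite exchange_big.
by rewrite exchange_big; apply: eq_bigr => d _; rewrite exchange_big.
Qed.

Lemma sum_exchange4 (V : nmodType) (I J K : Type) (si : seq I) (sj : seq J)
    (s : seq K) (F : K -> K -> K -> K -> I -> J -> V) :
  \sum_(i <- si) \sum_(j <- sj)
    \sum_(a <- s) \sum_(b <- s) \sum_(c <- s) \sum_(d <- s) F a b c d i j
  = \sum_(a <- s) \sum_(b <- s) \sum_(c <- s) \sum_(d <- s)
      \sum_(i <- si) \sum_(j <- sj) F a b c d i j.
Proof.
have step (G : K -> I -> J -> V) :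
    \sum_(i <- si) \sum_(j <- sj) \sum_(a <- s) G a i j
    = \sum_(a <- s) \sum_(i <- si) \sum_(j <- sj) G a i j.
  rewrite [RHS]exchange_big; apply: eq_bigr => i _.
  by rewrite [RHS]exchange_big.
by do 4! (rewrite step; apply: eq_bigr => ? _).
Qed.

Section ConstantHopf.
Variables (k : comNzRingType) (B : choiceType) (deg : B -> nat) (E : nat -> seq B)
  (one : B).
Hypothesis EB : graded_index deg E one.

Notation bilinear f := (bilinear_for *:%R *:%R f).

Section Presentation.
Variables (M : lmodType k) (e : B -> M) (mu de : B -> B -> B -> k).

(** The values on a basis determine the whole structure; the range [n] is left
    free so that several products can be expanded over a common range. *)
Record presents (D : hopf_data M) : Prop := {
  pr_bilinear : bilinear (hmul D);
  pr_mul : forall n a b, (deg a + deg b <= n)%N ->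
    hmul D (e a) (e b) = \sum_(x <- E n) mu a b x *: e x;
  pr_one : hone D = e one;
  pr_comul_linear : linear (hcomul D);
  pr_comul : forall n x, (deg x <= n)%N -> hcomul D (e x) =
    \sum_(a <- E n) \sum_(b <- E n) de a b x *: (e a ⊗ e b);
  pr_counit_linear : linear (hcounit D);
  pr_counit : forall a, hcounit D (e a) = (a == one)%:R
}.

Variable co : M -> {malg k[B]}.

Definition constant_hopf : hopf_data M := {|
  hmul := fun x y =>
    bilext (fun a b => \sum_(c <- E (deg a + deg b)) mu a b c *: e c) (co x) (co y);
  hone := e one;
  hcomul := fun x => linext (fun c =>
    \sum_(a <- E (deg c)) \sum_(b <- E (deg c)) de a b c *: (e a ⊗ e b)) (co x);
  hcounit := fun x => linext (fun a => (a == one)%:R : k^o) (co x);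
  hdeg := fun n x => forall a, deg a != n -> (co x)@_a = 0
|}.

End Presentation.

(** This allows all the sums of a computation to have the same range, taken
    large enough. *)
Lemma upto_widen (V : nmodType) m n (F : B -> V) : (m <= n)%N ->
  (forall a, (m < deg a)%N -> F a = 0) -> \sum_(a <- E n) F a = \sum_(a <- E m) F a.
Proof.
move=> mn F0; rewrite (bigID (fun a => a \in E m)) /= addrC big1 ?add0r; last first.
  by move=> a; rewrite (mem_upto EB) -ltnNge => /F0.
rewrite -big_filter; apply: perm_big; apply: uniq_perm.
- exact/filter_uniq/(upto_uniq EB).
- exact: upto_uniq EB m.
move=> a; rewrite mem_filter !(mem_upto EB).
by apply: andb_idr => am; apply: leq_trans mn.
Qed.

Section Structure.
Variables (q : k) (mu de : B -> B -> B -> k).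
Hypothesis cst : qhopf_constants q deg E one mu de.
Variables (M : lmodType k) (e : B -> M) (co : M -> {malg k[B]}).
Hypothesis eB : is_basis e co.
Let D := constant_hopf e mu de co.

Lemma constant_hopf_presents : presents e mu de D.
Proof.
have [col coe _] := eB.
split=> [|n a b abn|//||n x xn||a] /=.
- by apply: bil_comp => //; apply: bilext_bilinear.
- rewrite !coe bilextE (upto_widen abn) // => c c_gt.
  by rewrite (mu_deg cst) ?scale0r // gtn_eqF.
- apply: (lin_comp (f := linext _)) => //; exact: linext_linear.
- rewrite coe linextU; rewrite (upto_widen xn); last first.
    move=> a a_gt; apply: big1 => b _; rewrite (de_deg cst) ?scale0r //.
    by rewrite neq_ltn (leq_trans a_gt) // leq_addr.
  apply: eq_bigr => a _; rewrite (upto_widen xn) // => b b_gt.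
  by rewrite (de_deg cst) ?scale0r // neq_ltn (leq_trans b_gt) // leq_addl.
- apply: (lin_comp (f := linext _)) => //; exact: linext_linear.
- by rewrite coe linextU.
Qed.

Let prD := constant_hopf_presents.

Lemma hdeg_basis a : hdeg D (deg a) (e a).
Proof.
by move=> b ba; rewrite (coE eB) mcoeffU; case: (eqVneq a b) ba => // ->; rewrite eqxx.
Qed.

Lemma hdeg_submod n : hdeg D n 0 /\
  (forall a x y, hdeg D n x -> hdeg D n y -> hdeg D n (a *: x + y)).
Proof.
have [col _ _] := eB; split=> [a _|a x y xn yn b bn] /=.
  by rewrite -[co]/(lin_pack col : _ -> _) linear0 mcoeff0.
by rewrite col mcoeffD mcoeffZ xn // yn // mulr0 addr0.
Qed.

Lemma hdeg_sum n I (s : seq I) (p : pred I) (c : I -> k) (x : I -> M) :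
    (forall i, p i -> hdeg D n (x i) \/ c i = 0) ->
  hdeg D n (\sum_(i <- s | p i) c i *: x i).
Proof.
have [n0 nD] := hdeg_submod n; move=> xn; elim/big_ind: _ => //.
  by move=> u v un vn; rewrite -[u]scale1r; apply: nD.
move=> i /xn[xin|->]; last by rewrite scale0r.
by rewrite -[_ *: _]addr0; apply: nD.
Qed.

Lemma basis_sum n x : (forall a, (n < deg a)%N -> (co x)@_a = 0) ->
  x = \sum_(a <- E n) (co x)@_a *: e a.
Proof.
move=> xn; rewrite -{1}(coK eB x) /linext [RHS](bigID (mem (msupp (co x)))) /=.
rewrite [X in _ + X]big1 ?addr0; last first.
  by move=> a ax; rewrite mcoeff_outdom // scale0r.
rewrite -[RHS]big_filter; apply: perm_big; apply: uniq_perm.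
- exact: fset_uniq.
- exact/filter_uniq/(upto_uniq EB).
move=> a; rewrite mem_filter (mem_upto EB) andb_idr // -mcoeff_neq0 => ax.
by rewrite leqNgt; apply: contra ax => /xn ->.
Qed.

Lemma coef_bounded x : exists n, forall a, (n < deg a)%N -> (co x)@_a = 0.
Proof.
exists (\max_(a <- msupp (co x)) deg a)%N => a a_gt; apply: mcoeff_outdom.
by apply: contraL a_gt => ax; rewrite -leqNgt; apply: leq_bigmax_seq.
Qed.

Lemma hdeg_basis_sum n x : hdeg D n x ->
  x = \sum_(a <- E n | deg a == n) (co x)@_a *: e a.
Proof.
move=> xn; rewrite {1}(@basis_sum n x) => [|a an]; last by apply: xn; rewrite gtn_eqF.
rewrite [RHS]big_mkcond; apply: eq_bigr => a _; case: eqP => // /eqP an.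
by rewrite xn ?scale0r.
Qed.

Lemma constant_hopf_grading : is_grading (hdeg D).
Proof.
split=> [|x|n c cD c0 i i_n]; first exact: hdeg_submod.
  have [n xn] := coef_bounded x; exists n.+1.
  exists (fun i => \sum_(a <- E n | deg a == i) (co x)@_a *: e a); split.
    by move=> i; apply: hdeg_sum => a /eqP <-; left; apply: hdeg_basis.
  rewrite {1}(basis_sum xn) (exchange_big_dep xpredT) //= big_seq [RHS]big_seq.
  apply: eq_bigr => a; rewrite (mem_upto EB) -ltnS => an.
  rewrite (bigD1 (Ordinal an)) //= big1 ?addr0 // => j /andP[/eqP aj].
  by case/eqP; apply: val_inj.
have [col _ _] := eB; pose col' := lin_pack col.
suff ci0 : col' (c i) = 0 by rewrite -(coK eB (c i)) (ci0 : co (c i) = 0); apply: (linear0 (linext e)).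
apply/malgP => a; rewrite mcoeff0; have [ai|/cD->//] := eqVneq (deg a) i.
have : (col' (\sum_(j < n) c j))@_a = 0 by rewrite c0 linear0 mcoeff0.
rewrite linear_sum raddf_sum.
rewrite (bigD1 (Ordinal i_n)) //= big1 ?addr0 // => j ji; apply: cD.
by rewrite ai; apply: contra ji => /eqP ij; apply/eqP/val_inj.
Qed.

Lemma constant_hopf_mulA : associative (hmul D).
Proof.
have bm := pr_bilinear prD; have [ml mr] := bm; move=> x y z; move: x.
apply: (basis_ext eB); [exact: ml|by apply: (lin_comp (f := hmul D ^~ z)); [exact: ml|exact: ml]|].
move=> a; move: y; apply: (basis_ext eB).
- by apply: (lin_comp (f := hmul D (e a))); [exact: mr|exact: ml].
- by apply: (lin_comp (f := hmul D ^~ z)); [exact: ml|exact: mr].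
move=> b; move: z; apply: (basis_ext eB); [apply: (lin_comp (f := hmul D (e a))); exact: mr|exact: mr|].
move=> c; pose n := (deg a + deg b + deg c)%N.
rewrite (pr_mul prD (n := n)); last by rewrite /n; lia.
rewrite bil_sumr // (pr_mul prD (n := n) (a := a)); last by rewrite /n; lia.
rewrite bil_suml //.
have left_le y : mu a b y != 0 -> (deg y + deg c <= n)%N.
  by move=> aby; rewrite leq_add2r leqNgt; apply: contraNN aby => /gtn_eqF/negbT/(mu_deg cst) ->.
have right_le y : mu b c y != 0 -> (deg a + deg y <= n)%N.
  by move=> bcy; rewrite /n -addnA leq_add2l leqNgt;
    apply: contraNN bcy => /gtn_eqF/negbT/(mu_deg cst) ->.
transitivity (\sum_(x <- E n) (\sum_(y <- E n) mu b c y * mu a y x) *: e x).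
  rewrite (eq_bigr (fun y => \sum_(x <- E n) (mu b c y * mu a y x) *: e x)).
    by rewrite exchange_big; apply: eq_bigr => x _; rewrite scaler_suml.
  move=> y _; have [->|/right_le yn] := eqVneq (mu b c y) 0.
    by rewrite scale0r big1 // => x _; rewrite mul0r scale0r.
  by rewrite (pr_mul prD yn) scaler_sumr; apply: eq_bigr => x _; rewrite scalerA.
rewrite [RHS](eq_bigr (fun y => \sum_(x <- E n) (mu a b y * mu y c x) *: e x)); last first.
  move=> y _; have [->|/left_le yn] := eqVneq (mu a b y) 0.
    by rewrite scale0r big1 // => x _; rewrite mul0r scale0r.
  by rewrite (pr_mul prD yn) scaler_sumr; apply: eq_bigr => x _; rewrite scalerA.
rewrite [RHS]exchange_big /= big_seq [RHS]big_seq; apply: eq_bigr => x.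
by rewrite (mem_upto EB) => xn; rewrite -scaler_suml (mu_assoc cst).
Qed.

Lemma constant_hopf_mul1l : left_id (hone D) (hmul D).
Proof.
have [ml mr] := pr_bilinear prD; apply: (basis_ext eB); [exact: mr|exact: id_linear|].
move=> a; rewrite (pr_one prD) (pr_mul prD (leqnn _)).
under eq_bigr do rewrite (mu_onel cst).
by rewrite sumZ_deltal ?(upto_uniq EB) // (mem_upto EB) leq_addl.
Qed.

Lemma constant_hopf_mul1r : right_id (hone D) (hmul D).
Proof.
have [ml mr] := pr_bilinear prD; apply: (basis_ext eB); [exact: ml|exact: id_linear|].
move=> a; rewrite (pr_one prD) (pr_mul prD (leqnn _)).
under eq_bigr do rewrite (mu_oner cst).
by rewrite sumZ_deltal ?(upto_uniq EB) // (mem_upto EB) leq_addr.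
Qed.

Lemma constant_hopf_mul_graded m n x y :
  hdeg D m x -> hdeg D n y -> hdeg D (m + n)%N (hmul D x y).
Proof.
move=> /hdeg_basis_sum -> /hdeg_basis_sum ->; rewrite bil_suml; last exact: pr_bilinear prD.
apply: hdeg_sum => a /eqP am; left; rewrite bil_sumr; last exact: pr_bilinear prD.
apply: hdeg_sum => b /eqP bn; left; rewrite (pr_mul prD (leqnn _)).
apply: hdeg_sum => c _; have [<-|cmn] := eqVneq (deg c) (m + n)%N.
  by left; apply: hdeg_basis.
by right; rewrite (mu_deg cst) // am bn.
Qed.

Lemma constant_hopf_connected x : hdeg D 0%N x -> exists! a : k, x = a *: hone D.
Proof.
move=> x0; exists (co x)@_one; split.
  rewrite {1}(hdeg_basis_sum x0); under eq_bigl do rewrite (index_deg0 EB) eq_sym.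
  rewrite big_mkcond (eq_bigr (fun a => (one == a)%:R *: ((co x)@_a *: e a))); last first.
    by move=> a _; case: eqP; rewrite ?scale1r ?scale0r.
  rewrite sumZ_deltal ?(upto_uniq EB) // (mem_upto EB).
  by have -> : deg one = 0%N by apply/eqP; rewrite (index_deg0 EB).
move=> a ->; have [col coe _] := eB.
rewrite -[co]/(lin_pack col : _ -> _) linearZ mcoeffZ /= coe.
by rewrite mcoeffUU mulr1.
Qed.

(** ** The coalgebra axioms *)

(** The coefficient of [a ⊗ (b ⊗ c)] on either side is a side of the
    associativity axiom for the constants [de]. *)
Lemma constant_hopf_coassoc x :
  tensor_assoc (tensor_map (hcomul D) id (hcomul D x)) =
  tensor_map id (hcomul D) (hcomul D x).
Proof.
have cl := pr_comul_linear prD; move: x.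
have l1 : linear (tensor_map (hcomul D) (@id M)) by apply: tensor_map_linear.
have l2 : linear (tensor_map (@id M) (hcomul D)) by apply: tensor_map_linear.
have l3 := @tensor_assoc_linear k M M M.
apply: (basis_ext eB).
- exact: lin_comp l3 (lin_comp l1 cl).
- exact: lin_comp l2 cl.
move=> x; set n := deg x.
pose T (c : B -> B -> B -> k) := \sum_(a <- E n) \sum_(b <- E n) \sum_(d <- E n)
  c a b d *: (e a ⊗ (e b ⊗ e d) : tensor M (tensor M M)).
transitivity (T (fun a b d => \sum_(y <- E n) de a b y * de y d x)).
  rewrite (pr_comul prD (leqnn _)) -/n.
  rewrite (sum_tens2 _ _ _ _ _ l3 l1).
  transitivity (\sum_(y <- E n) \sum_(d <- E n) \sum_(a <- E n) \sum_(b <- E n)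
      (de a b y * de y d x) *: (e a ⊗ (e b ⊗ e d) : tensor M (tensor M M))).
    rewrite big_seq [RHS]big_seq; apply: eq_bigr => y; rewrite (mem_upto EB) => yn.
    apply: eq_bigr => d _; rewrite tensor_mapE // (pr_comul prD yn).
    rewrite -/(tens_by _ _) (sum_tens2 _ _ _ _ _ l3 (tens_linear (e d))).
    rewrite scaler_sumr; apply: eq_bigr => a _.
    rewrite scaler_sumr; apply: eq_bigr => b _.
    by rewrite /tens_by tensor_assocE scalerA mulrC.
  rewrite sum_rotate; apply: eq_bigr => a _; apply: eq_bigr => b _.
  by apply: eq_bigr => d _; rewrite scaler_suml.
transitivity (T (fun a b d => \sum_(y <- E n) de b d y * de a y x)).
  by do 3! (apply: eq_bigr => ? _); rewrite (de_assoc cst).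
rewrite (pr_comul prD (leqnn _)) -/n (sum_tens _ _ _ _ _ l2).
apply: eq_bigr => a _.
transitivity (\sum_(y <- E n) \sum_(b <- E n) \sum_(d <- E n)
      (de b d y * de a y x) *: (e a ⊗ (e b ⊗ e d) : tensor M (tensor M M))).
  rewrite [RHS]exchange_big; apply: eq_bigr => b _.
  by rewrite [RHS]exchange_big; apply: eq_bigr => d _; rewrite scaler_suml.
rewrite big_seq [RHS]big_seq; apply: eq_bigr => y; rewrite (mem_upto EB) => yn.
rewrite tensor_mapE // (pr_comul prD yn).
have [_ tr] := tens_bilinear M (tensor M M).
rewrite (sum_tens _ _ _ _ _ (tr (e a))) scaler_sumr; apply: eq_bigr => b _.
by rewrite scaler_sumr; apply: eq_bigr => d _; rewrite scalerA mulrC.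
Qed.

Lemma constant_hopf_counitl x :
  tensor_lift (fun a b => hcounit D a *: b) (hcomul D x) = x.
Proof.
have eps := pr_counit_linear prD; move: x.
have bl : bilinear (fun a b : M => hcounit D a *: b).
  split=> [b|a] c u v; cbv beta; first by rewrite eps scalerDl -scalerA.
  by rewrite scalerDr scalerA mulrC -scalerA.
apply: (basis_ext eB); last 1 first.
- move=> x; rewrite (pr_comul prD (leqnn _)) (sum_tens _ _ _ _ _ (tensor_lift_linear bl)).
  rewrite (eq_bigr (fun a => (one == a)%:R *: \sum_(b <- E (deg x)) de a b x *: e b)).
    rewrite sumZ_deltal ?(upto_uniq EB) // (mem_upto EB).
    have -> : deg one = 0%N by apply/eqP; rewrite (index_deg0 EB).
    rewrite leq0n; under eq_bigr do rewrite (de_onel cst).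
    rewrite (eq_bigr (fun b => (x == b)%:R *: e b)) => [|b _]; last by rewrite eq_sym.
    by rewrite sumZ_deltal ?(upto_uniq EB) // (mem_upto EB) leqnn.
  move=> a _; rewrite scaler_sumr; apply: eq_bigr => b _.
  by rewrite (tensor_liftE bl) (pr_counit prD) scalerA mulrC -scalerA eq_sym.
- exact: lin_comp (tensor_lift_linear bl) (pr_comul_linear prD).
- exact: id_linear.
Qed.

Lemma constant_hopf_counitr x :
  tensor_lift (fun a b => hcounit D b *: a) (hcomul D x) = x.
Proof.
have eps := pr_counit_linear prD; move: x.
have bl : bilinear (fun a b : M => hcounit D b *: a).
  split=> [b|a] c u v; cbv beta; last by rewrite eps scalerDl -scalerA.
  by rewrite scalerDr scalerA mulrC -scalerA.
apply: (basis_ext eB); last 1 first.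
- move=> x; rewrite (pr_comul prD (leqnn _)) (sum_tens _ _ _ _ _ (tensor_lift_linear bl)).
  rewrite exchange_big /=.
  rewrite (eq_bigr (fun b => (one == b)%:R *: \sum_(a <- E (deg x)) de a b x *: e a)).
    rewrite sumZ_deltal ?(upto_uniq EB) // (mem_upto EB).
    have -> : deg one = 0%N by apply/eqP; rewrite (index_deg0 EB).
    rewrite leq0n; under eq_bigr do rewrite (de_oner cst).
    rewrite (eq_bigr (fun b => (x == b)%:R *: e b)) => [|b _]; last by rewrite eq_sym.
    by rewrite sumZ_deltal ?(upto_uniq EB) // (mem_upto EB) leqnn.
  move=> b _; rewrite scaler_sumr; apply: eq_bigr => a _.
  by rewrite (tensor_liftE bl) (pr_counit prD) scalerA mulrC -scalerA eq_sym.
- exact: lin_comp (tensor_lift_linear bl) (pr_comul_linear prD).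
- exact: id_linear.
Qed.

Lemma constant_hopf_comul_graded n x : hdeg D n x ->
  hcomul D x \in Defs.span (fun t => exists i j a b,
    [/\ (i + j = n)%N, hdeg D i a, hdeg D j b & t = a ⊗ b]).
Proof.
move=> /hdeg_basis_sum ->; rewrite lin_sum; last exact: pr_comul_linear prD.
apply: rpred_sum => c /eqP cn; apply: rpredZ; rewrite (pr_comul prD (leqnn _)).
apply: rpred_sum => a _; apply: rpred_sum => b _.
have [abc|abc] := eqVneq (deg c) (deg a + deg b)%N; last first.
  by rewrite (de_deg cst) // scale0r rpred0.
apply: rpredZ; apply: mem_span; exists (deg a), (deg b), (e a), (e b).
by split; rewrite -?cn //; apply: hdeg_basis.
Qed.

Lemma constant_hopf_counit_graded n x : (0 < n)%N -> hdeg D n x -> hcounit D x = 0.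
Proof.
move=> n0 /hdeg_basis_sum ->; rewrite lin_sum; last exact: pr_counit_linear prD.
apply: big1 => a /eqP an; rewrite (pr_counit prD) -(index_deg0 EB) an.
by rewrite gtn_eqF // scaler0.
Qed.

(** ** The twisted product on the tensor square *)

(** The middle factors are exchanged with the power of [q] given by their degrees,
    which is only defined on homogeneous elements; the expansion of [b] and [c] in
    the basis extends it to all elements. *)
Definition twisted4 (a b c d : M) : tensor M M :=
  bilext (fun b' c' => q ^+ (deg b' * deg c') *: (hmul D a (e c') ⊗ hmul D (e b') d))
    (co b) (co c).

Definition twisted_mul (s t : tensor M M) : tensor M M :=
  tensor_lift (fun a b => tensor_lift (twisted4 a b) t) s.

Lemma twisted4_bil12 c d : bilinear (fun a b => twisted4 a b c d).
Proof.
have [ml mr] := pr_bilinear prD; have [tl tr] := tens_bilinear M M.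
split=> [b|a] r u v /=; last first.
  by rewrite /twisted4 (co_linear eB) (bilext_bilinear _).1.
rewrite /twisted4 -[RHS]bilext_fun; apply: bilext_eq => b' c'.
by rewrite ml tl scalerDr !scalerA mulrC.
Qed.

Lemma twisted4_bil34 a b : bilinear (twisted4 a b).
Proof.
have [ml mr] := pr_bilinear prD; have [tl tr] := tens_bilinear M M.
split=> [d|c] r u v /=.
  by rewrite /twisted4 (co_linear eB) (bilext_bilinear _).2.
rewrite /twisted4 -[RHS]bilext_fun; apply: bilext_eq => b' c'.
by rewrite mr tr scalerDr !scalerA mulrC.
Qed.

Lemma twisted4E a b c d :
  twisted4 a (e b) (e c) d = q ^+ (deg b * deg c) *: (hmul D a (e c) ⊗ hmul D (e b) d).
Proof. by rewrite /twisted4 !(coE eB) bilextE. Qed.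

Lemma twisted_mulP : is_twisted_mul q D twisted_mul.
Proof.
split; first exact: tensor_lift2_bilinear twisted4_bil12 twisted4_bil34.
move=> i m n j a b c d _ bm cn _.
rewrite /twisted_mul (tensor_lift2E twisted4_bil12 twisted4_bil34).
have [ml mr] := pr_bilinear prD; have tb := tens_bilinear M M.
rewrite (hdeg_basis_sum bm) (hdeg_basis_sum cn).
rewrite (bil_suml _ _ _ _ _ (f := fun b c => twisted4 a b c d)); last first.
  by split=> [c'|b'] r u v /=; [apply: (twisted4_bil12 _ _).2|apply: (twisted4_bil34 _ _).1].
rewrite (bil_suml _ _ _ _ d (pr_bilinear prD)) (bil_sumr _ _ _ _ _ tb) scaler_sumr.
apply: eq_bigr => b' /eqP bm'.
rewrite (lin_sum _ _ _ _ (f := fun c => twisted4 a (e b') c d)); last first.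
  by move=> r u v /=; apply: (twisted4_bil34 _ _).1.
rewrite (bil_sumr _ _ _ _ a (pr_bilinear prD)) (bil_suml _ _ _ _ _ tb).
rewrite !scaler_sumr; apply: eq_bigr => c' /eqP cn'.
by rewrite twisted4E bm' cn' !scalerA; congr (_ *: _); ring.
Qed.

Lemma constant_hopf_comul_mul x y :
  hcomul D (hmul D x y) = twisted_mul (hcomul D x) (hcomul D y).
Proof.
have [tb _] := twisted_mulP; have cl := pr_comul_linear prD.
have mb := pr_bilinear prD; move: x y.
apply: (basis_bil_ext eB eB); [exact: (bil_lin cl mb)|exact: (bil_comp tb cl cl)|].
move=> a b; pose n := (deg a + deg b)%N.
have an : (deg a <= n)%N := leq_addr _ _; have bn : (deg b <= n)%N := leq_addl _ _.
rewrite (pr_mul prD (leqnn _)) -/n lin_sum //.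
transitivity (\sum_(c <- E n) \sum_(d <- E n)
    (\sum_(x <- E n) mu a b x * de c d x) *: (e c ⊗ e d)).
  rewrite big_seq (eq_bigr (fun x => \sum_(c <- E n) \sum_(d <- E n)
    (mu a b x * de c d x) *: (e c ⊗ e d))) => [|x]; last first.
    rewrite (mem_upto EB) => xn; rewrite (pr_comul prD xn) scaler_sumr.
    apply: eq_bigr => c _; rewrite scaler_sumr; apply: eq_bigr => d _.
    by rewrite scalerA.
  rewrite -big_seq exchange_big; apply: eq_bigr => c _.
  by rewrite exchange_big; apply: eq_bigr => d _; rewrite scaler_suml.
rewrite (pr_comul prD an) (pr_comul prD bn).
pose T a1 a2 b1 b2 := q ^+ (deg a2 * deg b1) * (de a1 a2 a * de b1 b2 b).
transitivity (\sum_(a1 <- E n) \sum_(a2 <- E n) \sum_(b1 <- E n) \sum_(b2 <- E n)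
   \sum_(c <- E n) \sum_(d <- E n)
     (T a1 a2 b1 b2 * (mu a1 b1 c * mu a2 b2 d)) *: (e c ⊗ e d)); last first.
  rewrite (sum_tens _ _ _ _ _ (g := fun s => twisted_mul s _)); last first.
    by move=> r u v; apply: tb.1.
  rewrite big_seq [RHS]big_seq; apply: eq_bigr => a1.
  rewrite (mem_upto EB) => a1n.
  rewrite big_seq [RHS]big_seq; apply: eq_bigr => a2.
  rewrite (mem_upto EB) => a2n.
  rewrite (sum_tens _ _ _ _ _ (tb.2 _)) scaler_sumr; apply: eq_bigr => b1 _.
  rewrite scaler_sumr; apply: eq_bigr => b2 _.
  rewrite /twisted_mul (tensor_lift2E twisted4_bil12 twisted4_bil34) twisted4E.
  have [a12|a12] := eqVneq (deg a) (deg a1 + deg a2)%N; last first.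
    rewrite (de_deg cst a12) scale0r; apply: big1 => c _; apply: big1 => d _.
    by rewrite /T (de_deg cst a12) mul0r mulr0 mul0r scale0r.
  have [b12|b12] := eqVneq (deg b) (deg b1 + deg b2)%N; last first.
    rewrite (de_deg cst b12) scale0r scaler0; apply: big1 => c _; apply: big1 => d _.
    by rewrite /T (de_deg cst b12) !mulr0 mul0r scale0r.
  have n1 : (deg a1 + deg b1 <= n)%N by rewrite /n; lia.
  have n2 : (deg a2 + deg b2 <= n)%N by rewrite /n; lia.
  rewrite (pr_mul prD n1) (pr_mul prD n2) bil_suml; last exact: tens_bilinear.
  rewrite !scaler_sumr; apply: eq_bigr => c _.
  rewrite bil_sumr; last exact: tens_bilinear.
  rewrite !scaler_sumr; apply: eq_bigr => d _.
  by rewrite !scalerA; congr (_ *: _); rewrite /T; ring.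
transitivity (\sum_(c <- E n) \sum_(d <- E n)
   (\sum_(a1 <- E n) \sum_(a2 <- E n) \sum_(b1 <- E n) \sum_(b2 <- E n)
     (T a1 a2 b1 b2 * (mu a1 b1 c * mu a2 b2 d))) *: (e c ⊗ e d)).
  apply: eq_bigr => c _; apply: eq_bigr => d _; congr (_ *: _).
  rewrite (mu_de_compat cst) ?leqnn //.
  by do 4! (apply: eq_bigr => ? _); rewrite /T; ring.
rewrite -sum_exchange4; apply: eq_bigr => c _; apply: eq_bigr => d _.
by do 4! (rewrite scaler_suml; apply: eq_bigr => ? _).
Qed.

Lemma constant_hopf_qHopf : is_graded_qHopf q D.
Proof.
split.
- exact: constant_hopf_grading.
- exact: pr_bilinear prD.
- exact: constant_hopf_mulA.
- exact: constant_hopf_mul1l.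
- exact: constant_hopf_mul1r.
- exact: constant_hopf_mul_graded.
- have <- : deg one = 0%N by apply/eqP; rewrite (index_deg0 EB).
  exact: hdeg_basis.
- exact: constant_hopf_connected.
- exact: pr_comul_linear prD.
- exact: pr_counit_linear prD.
- exact: constant_hopf_coassoc.
- exact: constant_hopf_counitl.
- exact: constant_hopf_counitr.
- exact: constant_hopf_comul_graded.
- exact: constant_hopf_counit_graded.
- exists twisted_mul; [exact: twisted_mulP|exact: constant_hopf_comul_mul].
Qed.

End Structure.
End ConstantHopf.

(** ** Graded duality *)

Section GradedDual.
Variables (k : comNzRingType) (B : choiceType) (deg : B -> nat) (E : nat -> seq B)
  (one : B).
Hypothesis EB : graded_index deg E one.
Notation bilinear f := (bilinear_for *:%R *:%R f).

(** The functionals in the definition of a perfect pairing are linear only on a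
    homogeneous component, not on the whole module. *)
Lemma linear_on_sum (M : lmodType k) (P : M -> Prop) (f : M -> k) I (s : seq I)
    (p : pred I) (c : I -> k) (x : I -> M) :
    P 0 -> (forall a u v, P u -> P v -> P (a *: u + v)) -> linear_on P f ->
    (forall i, p i -> P (x i)) ->
  f (\sum_(i <- s | p i) c i *: x i) = \sum_(i <- s | p i) c i * f (x i).
Proof.
move=> P0 PD fl Px; have f0 : f 0 = 0.
  have := fl 1 _ _ P0 P0; rewrite scaler0 addr0 mul1r => f00.
  by apply: (addrI (f 0)); rewrite -f00 addr0.
suff [] : P (\sum_(i <- s | p i) c i *: x i) /\
    f (\sum_(i <- s | p i) c i *: x i) = \sum_(i <- s | p i) c i * f (x i) by [].
elim: s => [|i s [IHP IHf]]; first by rewrite !big_nil.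
rewrite !big_cons; case: ifP => // /Px Pi; split; first exact: PD.
by rewrite fl // IHf.
Qed.

Section OneSide.
Variables (M M' : lmodType k) (e : B -> M) (co : M -> {malg k[B]})
  (e' : B -> M') (co' : M' -> {malg k[B]}) (b : M -> M' -> k^o).
Hypotheses (eB : is_basis e co) (eB' : is_basis e' co') (bb : bilinear b).
Hypothesis be : forall a c, b (e a) (e' c) = (a == c)%:R.
Variables mu de mu' de' : B -> B -> B -> k.
Let D := constant_hopf deg E one e mu de co.
Let D' := constant_hopf deg E one e' mu' de' co'.

(** Dual bases: pairing with a basis element extracts a coordinate.  This is why
    the pairing is perfect in each degree. *)
Lemma pair_coef x a : b x (e' a) = (co x)@_a.
Proof.
move: x; apply: (basis_ext eB (V := k^o)); first exact: bb.1.
  by move=> c x y; rewrite (co_linear eB) mcoeffD mcoeffZ.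
by move=> c; rewrite be (coE eB) mcoeffU; case: eqP.
Qed.

Lemma constant_hopf_perfect n (f : M' -> k) : linear_on (hdeg D' n) f ->
  exists! x, hdeg D n x /\ forall y, hdeg D' n y -> b x y = f y.
Proof.
move=> fl; have homE : forall a, deg a == n -> hdeg D' n (e' a).
  by move=> a /eqP <-; apply: hdeg_basis.
pose x := \sum_(a <- E n | deg a == n) f (e' a) *: e a.
have xn : hdeg D n x by apply: hdeg_sum => // a /eqP <-; left; apply: hdeg_basis.
have bx c : deg c == n -> b x (e' c) = f (e' c).
  move=> /eqP cn; rewrite bil_suml // big_mkcond.
  rewrite (eq_bigr (fun a => (c == a)%:R * f (e' a))) => [|a _].
    by rewrite (sum_deltal _ _ (upto_uniq EB n)) (mem_upto EB) cn leqnn.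
  rewrite be (eq_sym a); case: (eqVneq c a) => [<-|_].
    by rewrite cn eqxx; apply: mulrC.
  by rewrite scaler0 mul0r if_same.
exists x; split.
  split=> // y yn; have [h0 hD] := hdeg_submod deg E one mu' de' eB' n.
  rewrite {2}(hdeg_basis_sum EB eB' yn) (linear_on_sum _ _ h0 hD fl) //.
  rewrite {1}(hdeg_basis_sum EB eB' yn) bil_sumr //.
  by apply: eq_bigr => a an; rewrite bx.
move=> x' [x'n bx']; rewrite (hdeg_basis_sum EB eB x'n); apply: eq_bigr => a an.
by rewrite -pair_coef bx' //; apply: homE.
Qed.

End OneSide.

Section TwoSides.
Variables (q : k) (mu de : B -> B -> B -> k).
Hypothesis cst : qhopf_constants q deg E one mu de.
Variables (M M' : lmodType k) (e : B -> M) (co : M -> {malg k[B]})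
  (e' : B -> M') (co' : M' -> {malg k[B]}) (b : M -> M' -> k^o).
Hypotheses (eB : is_basis e co) (eB' : is_basis e' co') (bb : bilinear b).
Hypothesis be : forall a c, b (e a) (e' c) = (a == c)%:R.
Let D := constant_hopf deg E one e de mu co.
Let D' := constant_hopf deg E one e' mu de co'.
Let cst' := qhopf_constants_dual cst.
Let prD : presents deg E one e de mu D := constant_hopf_presents EB cst' eB.
Let prD' : presents deg E one e' mu de D' := constant_hopf_presents EB cst eB'.

Lemma tensor_pair_bil :
  bilinear (fun s t => tensor_pair b s t : k^o) /\
  forall x x' y y', tensor_pair b (x ⊗ x') (y ⊗ y') = b x y * b x' y'.
Proof.
have [bl br] := bb.
pose F x x' y y' : k^o := b x y * b x' y'.
have F12 y y' : bilinear (fun x x' => F x x' y y').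
  split=> [x'|x] a u v; rewrite /F /= bl; first by rewrite mulrDl -scalerAl.
  by rewrite mulrDr -scalerAr.
have F34 x x' : bilinear (F x x').
  split=> [y'|y] a u v; rewrite /F /= br; first by rewrite mulrDl -scalerAl.
  by rewrite mulrDr -scalerAr.
split=> [|x x' y y']; first exact: tensor_lift2_bilinear F12 F34.
exact: (tensor_lift2E F12 F34).
Qed.

Lemma constant_hopf_mul_comul x x' y :
  b (hmul D x x') y = tensor_pair b (x ⊗ x') (hcomul D' y).
Proof.
have [pb pE] := tensor_pair_bil; have mb := pr_bilinear prD.
have tb := tens_bilinear M M; have cl := pr_comul_linear prD'.
move: y; apply: (basis_ext eB' (V := k^o)); first exact: bb.2.
  exact: (lin_comp (pb.2 _) cl).
move=> c; move: x x'; apply: (basis_bil_ext eB eB).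
- exact: (bil_lin (bb.1 _) mb).
- exact: (bil_lin (pb.1 _) tb).
move=> a a'; pose n := (deg a + deg a' + deg c)%N.
rewrite (pr_mul prD (n := n)); last by rewrite /n; lia.
rewrite (pr_comul prD' (n := n)); last by rewrite /n; lia.
rewrite bil_suml //.
transitivity (de a a' c).
  rewrite (eq_bigr (fun x => (c == x)%:R * de a a' x)) => [|x _]; last first.
    by rewrite be (eq_sym x); apply: mulrC.
  by rewrite (sum_deltal _ _ (upto_uniq EB n)) (mem_upto EB) leq_addl.
rewrite (sum_tens _ _ _ _ _ (V := k^o) (pb.2 _)).
rewrite (eq_bigr (fun u => (a == u)%:R * \sum_(v <- E n) (a' == v)%:R * de u v c)).
  rewrite !(sum_deltal _ _ (upto_uniq EB n)) !(mem_upto EB) /n -addnA leq_addr.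
  by rewrite addnCA leq_addr.
move=> u _; rewrite mulr_sumr; apply: eq_bigr => v _.
by rewrite pE !be /GRing.scale /=; ring.
Qed.

Lemma constant_hopf_comul_mul_pair x y y' :
  b x (hmul D' y y') = tensor_pair b (hcomul D x) (y ⊗ y').
Proof.
have [pb pE] := tensor_pair_bil; have mb := pr_bilinear prD'.
have tb := tens_bilinear M' M'; have cl := pr_comul_linear prD.
move: x; apply: (basis_ext eB (V := k^o)); first exact: bb.1.
  exact: (lin_comp (f := fun s => tensor_pair b s (y ⊗ y') : k^o) (pb.1 _) cl).
move=> c; move: y y'; apply: (basis_bil_ext eB' eB').
- exact: (bil_lin (bb.2 _) mb).
- exact: (bil_lin (pb.2 _) tb).
move=> a a'; pose n := (deg a + deg a' + deg c)%N.
rewrite (pr_mul prD' (n := n)); last by rewrite /n; lia.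
rewrite (pr_comul prD (n := n)); last by rewrite /n; lia.
rewrite bil_sumr //.
transitivity (mu a a' c).
  rewrite (eq_bigr (fun x => (c == x)%:R * mu a a' x)) => [|x _]; last first.
    by rewrite be; apply: mulrC.
  by rewrite (sum_deltal _ _ (upto_uniq EB n)) (mem_upto EB) leq_addl.
rewrite (sum_tens _ _ _ _ _ (V := k^o) (pb.1 _)).
rewrite (eq_bigr (fun u => (a == u)%:R * \sum_(v <- E n) (a' == v)%:R * mu u v c)).
  rewrite !(sum_deltal _ _ (upto_uniq EB n)) !(mem_upto EB) /n -addnA leq_addr.
  by rewrite addnCA leq_addr.
move=> u _; rewrite mulr_sumr; apply: eq_bigr => v _.
by rewrite pE !be /GRing.scale /= (eq_sym u) (eq_sym v); ring.
Qed.

Lemma constant_hopf_dual : graded_dual D D' b.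
Proof.
split.
- exact: bb.
- move=> m n x y xm yn mn; rewrite (hdeg_basis_sum EB eB xm) (hdeg_basis_sum EB eB' yn).
  rewrite bil_suml //; apply: big1 => a /eqP am; rewrite bil_sumr // big1 ?scaler0 //.
  move=> c /eqP cn; rewrite be; case: eqP => [ac|_]; last by rewrite scaler0.
  by case: mn; rewrite -am -cn ac.
- exact: constant_hopf_perfect eB eB' bb be _ _ _ _.
- apply: (constant_hopf_perfect (b := fun y x => b x y)) => //.
    by split=> [x|y]; [exact: bb.2|exact: bb.1].
  by move=> a c; rewrite be eq_sym.
- exact: constant_hopf_mul_comul.
- exact: constant_hopf_comul_mul_pair.
Qed.

End TwoSides.

End GradedDual.

(** * Lumping structure constants along an equivalence relation *)

Section Lumping.
Variables (k : comNzRingType) (S C : choiceType).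
Variables (degS : S -> nat) (ES : nat -> seq S) (oneS : S).
Variables (degC : C -> nat) (EC : nat -> seq C) (oneC : C).
Hypotheses (SI : graded_index degS ES oneS) (CI : graded_index degC EC oneC).
Variables (cl : S -> C) (r : C -> S).
Hypotheses (rK : cancel r cl) (deg_cl : forall x, degC (cl x) = degS x).
Notation bilinear f := (bilinear_for *:%R *:%R f).

(** An equivalence class, listed inside the enumeration of the elements of its
    degree. *)
Definition fiber (X : C) : seq S := [seq x <- ES (degC X) | cl x == X].

Lemma mem_fiber x X : (x \in fiber X) = (cl x == X).
Proof.
rewrite mem_filter (mem_upto SI) andb_idr // => /eqP <-.
by rewrite deg_cl.
Qed.

Lemma fiber_uniq X : uniq (fiber X).
Proof. exact/filter_uniq/(upto_uniq SI). Qed.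

Lemma eq_fiber (V : nmodType) X (F G : S -> V) :
  (forall x, cl x = X -> F x = G x) -> \sum_(x <- fiber X) F x = \sum_(x <- fiber X) G x.
Proof.
move=> FG; rewrite big_seq [RHS]big_seq; apply: eq_bigr => x.
by rewrite mem_fiber => /eqP /FG.
Qed.

Lemma sum_fibers (V : nmodType) n (F : S -> V) :
  \sum_(X <- EC n) \sum_(x <- fiber X) F x = \sum_(x <- ES n) F x.
Proof.
rewrite big_seq (eq_bigr (fun X => \sum_(x <- ES n | cl x == X) F x)).
  rewrite -big_seq (exchange_big_dep xpredT) //= big_seq [RHS]big_seq.
  apply: eq_bigr => x; rewrite (mem_upto SI) => xn.
  under eq_bigl do rewrite eq_sym.
  rewrite (big_rem (cl x)) /= ?eqxx; last by rewrite (mem_upto CI) deg_cl.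
  rewrite big_seq_cond big1 ?addr0 // => X.
  by rewrite (rem_filter _ (upto_uniq CI n)) mem_filter /= => /andP[/andP[/negPf ->]].
move=> X; rewrite (mem_upto CI) => Xn.
rewrite -[RHS]big_filter; apply/perm_big/uniq_perm.
- exact: fiber_uniq.
- exact/filter_uniq/(upto_uniq SI).
move=> x; rewrite mem_fiber mem_filter (mem_upto SI); apply/esym/andb_idr => /eqP xX.
by rewrite -deg_cl xX.
Qed.

Lemma sum_fibers2 (V : nmodType) n (F : S -> S -> V) :
  \sum_(A <- EC n) \sum_(B <- EC n) \sum_(a <- fiber A) \sum_(b <- fiber B) F a b
  = \sum_(a <- ES n) \sum_(b <- ES n) F a b.
Proof.
rewrite -sum_fibers; apply: eq_bigr => A _; rewrite exchange_big.
by apply: eq_bigr => a _; rewrite sum_fibers.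
Qed.

Lemma sum_fibers4 (V : nmodType) n (F : S -> S -> S -> S -> V) :
  \sum_(A <- EC n) \sum_(B <- EC n) \sum_(G <- EC n) \sum_(H <- EC n)
    \sum_(a <- fiber A) \sum_(b <- fiber B) \sum_(c <- fiber G) \sum_(d <- fiber H) F a b c d
  = \sum_(a <- ES n) \sum_(b <- ES n) \sum_(c <- ES n) \sum_(d <- ES n) F a b c d.
Proof.
rewrite -sum_fibers2; apply: eq_bigr => A _; apply: eq_bigr => B _.
rewrite sum_rotate; apply: eq_bigr => a _; apply: eq_bigr => b _.
by rewrite exchange_big sum_fibers2.
Qed.

Variables (q : k) (mu de : S -> S -> S -> k).
Hypothesis cst : qhopf_constants q degS ES oneS mu de.
Hypothesis lump_mu : forall a b a' b' X, cl a = cl a' -> cl b = cl b' ->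
  \sum_(x <- fiber X) mu a b x = \sum_(x <- fiber X) mu a' b' x.
Hypothesis lump_de : forall x x' A B, cl x = cl x' ->
  \sum_(a <- fiber A) \sum_(b <- fiber B) de a b x
  = \sum_(a <- fiber A) \sum_(b <- fiber B) de a b x'.

Definition lumped_mu A B X := \sum_(x <- fiber X) mu (r A) (r B) x.
Definition lumped_de A B X := \sum_(a <- fiber A) \sum_(b <- fiber B) de a b (r X).

Lemma lumped_muE a b X : lumped_mu (cl a) (cl b) X = \sum_(x <- fiber X) mu a b x.
Proof. by apply: lump_mu; rewrite rK. Qed.

Lemma lumped_deE A B x :
  lumped_de A B (cl x) = \sum_(a <- fiber A) \sum_(b <- fiber B) de a b x.
Proof. by apply: lump_de; rewrite rK. Qed.

Lemma cl_one : cl oneS = oneC.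
Proof. by apply/eqP; rewrite -(index_deg0 CI) deg_cl (index_deg0 SI). Qed.

Lemma deg_r X : degS (r X) = degC X. Proof. by rewrite -deg_cl rK. Qed.

Lemma fiber_one (V : nmodType) (F : S -> V) : \sum_(x <- fiber oneC) F x = F oneS.
Proof.
transitivity (\sum_(x <- [:: oneS]) F x); last by rewrite big_seq1.
apply/perm_big/uniq_perm; rewrite ?fiber_uniq // => x.
by rewrite mem_fiber inE -(index_deg0 CI) deg_cl (index_deg0 SI).
Qed.

Lemma fiber_delta (R : nzRingType) A X :
  \sum_(x <- fiber X) (r A == x)%:R = (A == X)%:R :> R.
Proof.
under eq_bigr do rewrite -[_%:R]mulr1.
by rewrite (sum_deltal _ _ (fiber_uniq X)) mem_fiber rK; case: eqP.
Qed.

Lemma sum_lumped_mu n A B (H : C -> k) :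
  \sum_(Y <- EC n) lumped_mu A B Y * H Y = \sum_(y <- ES n) mu (r A) (r B) y * H (cl y).
Proof.
rewrite -sum_fibers; apply: eq_bigr => Y _; rewrite mulr_suml.
by apply: eq_fiber => y ->.
Qed.

(** In a product of two lumped constants, the representative of the class over
    which one sums may be replaced by each element of the class in turn; the sum
    over classes then becomes a sum over [S], where the axiom is known. *)
Lemma lumped_constants : qhopf_constants q degC EC oneC lumped_mu lumped_de.
Proof.
split.
- move=> A B X ABX; rewrite /lumped_mu (eq_fiber (G := fun _ => 0)) ?big1 // => x xX.
  by rewrite (mu_deg cst) // !deg_r -deg_cl xX.
- move=> A B X ABX; rewrite /lumped_de (eq_fiber (G := fun _ => 0)) ?big1 // => a aA.
  rewrite (eq_fiber (G := fun _ => 0)) ?big1 // => b bB.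
  by rewrite (de_deg cst) // deg_r -!deg_cl aA bB.
- move=> A X; rewrite -cl_one -{1}(rK A) lumped_muE -fiber_delta.
  by apply: eq_bigr => x _; rewrite (mu_onel cst).
- move=> A X; rewrite -cl_one -{1}(rK A) lumped_muE -fiber_delta.
  by apply: eq_bigr => x _; rewrite (mu_oner cst).
- move=> A X; rewrite /lumped_de fiber_one eq_sym -fiber_delta.
  by apply: eq_bigr => x _; rewrite (de_onel cst) eq_sym.
- move=> A X; rewrite /lumped_de eq_sym -fiber_delta.
  by apply: eq_bigr => x _; rewrite fiber_one (de_oner cst) eq_sym.
- move=> n A B G X Xn; rewrite !sum_lumped_mu.
  transitivity (\sum_(x <- fiber X) \sum_(y <- ES n) mu (r A) (r B) y * mu y (r G) x).
    rewrite exchange_big; apply: eq_bigr => y _.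
    by rewrite -mulr_sumr -lumped_muE rK.
  transitivity (\sum_(x <- fiber X) \sum_(y <- ES n) mu (r B) (r G) y * mu (r A) y x).
    by apply: eq_fiber => x xX; rewrite (mu_assoc cst) // -deg_cl xX.
  rewrite exchange_big; apply: eq_bigr => y _.
  by rewrite -mulr_sumr -lumped_muE rK.
- move=> n A B G X Xn.
  transitivity (\sum_(a <- fiber A) \sum_(b <- fiber B) \sum_(c <- fiber G)
      \sum_(y <- ES n) de a b y * de y c (r X)).
    rewrite [RHS](eq_bigr (fun a => \sum_(y <- ES n) \sum_(b <- fiber B)
       \sum_(c <- fiber G) de a b y * de y c (r X))); last first.
      move=> a _; rewrite [RHS]exchange_big; apply: eq_bigr => b _.
      by rewrite [RHS]exchange_big.
    rewrite [RHS]exchange_big -[RHS]sum_fibers; apply: eq_bigr => Y _.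
    rewrite mulr_sumr; apply: eq_fiber => y <-; rewrite lumped_deE mulr_suml.
    apply: eq_bigr => a _; rewrite mulr_suml; apply: eq_bigr => b _.
    by rewrite mulr_sumr.
  transitivity (\sum_(a <- fiber A) \sum_(b <- fiber B) \sum_(c <- fiber G)
      \sum_(y <- ES n) de b c y * de a y (r X)).
    by do 3! (apply: eq_bigr => ? _); rewrite (de_assoc cst) // deg_r.
  rewrite (eq_bigr (fun a => \sum_(y <- ES n) \sum_(b <- fiber B)
     \sum_(c <- fiber G) de b c y * de a y (r X))); last first.
    move=> a _; rewrite [RHS]exchange_big; apply: eq_bigr => b _.
    by rewrite [RHS]exchange_big.
  rewrite exchange_big -[LHS]sum_fibers; apply: eq_bigr => Y _.
  rewrite mulr_sumr exchange_big; apply: eq_bigr => a _.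
  rewrite mulr_sumr; apply: eq_fiber => y <-; rewrite lumped_deE mulr_suml.
  by apply: eq_bigr => b _; rewrite mulr_suml.
- move=> n A B G H ABn; rewrite sum_lumped_mu.
  transitivity (\sum_(c <- fiber G) \sum_(d <- fiber H)
      \sum_(x <- ES n) mu (r A) (r B) x * de c d x).
    rewrite [RHS](eq_bigr (fun c => \sum_(x <- ES n) \sum_(d <- fiber H)
       mu (r A) (r B) x * de c d x)); last by move=> c _; rewrite [RHS]exchange_big.
    rewrite [RHS]exchange_big; apply: eq_bigr => x _; rewrite lumped_deE mulr_sumr.
    by apply: eq_bigr => c _; rewrite mulr_sumr.
  transitivity (\sum_(c <- fiber G) \sum_(d <- fiber H)
      \sum_(a1 <- ES n) \sum_(a2 <- ES n) \sum_(b1 <- ES n) \sum_(b2 <- ES n)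
      q ^+ (degS a2 * degS b1) *
      (de a1 a2 (r A) * de b1 b2 (r B) * (mu a1 b1 c * mu a2 b2 d))).
    apply: eq_fiber => c cG; apply: eq_fiber => d dH.
    by rewrite (mu_de_compat cst) // !deg_r -!deg_cl cG dH.
  transitivity (\sum_(a1 <- ES n) \sum_(a2 <- ES n) \sum_(b1 <- ES n) \sum_(b2 <- ES n)
      \sum_(c <- fiber G) \sum_(d <- fiber H)
      q ^+ (degS a2 * degS b1) *
      (de a1 a2 (r A) * de b1 b2 (r B) * (mu a1 b1 c * mu a2 b2 d))).
    exact: sum_exchange4.
  rewrite -sum_fibers4.
  apply: eq_bigr => A1 _; apply: eq_bigr => A2 _.
  apply: eq_bigr => B1 _; apply: eq_bigr => B2 _.
  rewrite /lumped_de mulr_suml mulr_suml mulr_sumr; apply: eq_fiber => a1 a1A.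
  rewrite mulr_suml mulr_suml mulr_sumr; apply: eq_fiber => a2 a2A.
  rewrite mulr_sumr mulr_suml mulr_sumr; apply: eq_fiber => b1 b1B.
  rewrite mulr_sumr mulr_suml mulr_sumr; apply: eq_fiber => b2 b2B.
  rewrite -a1A -a2A -b1B -b2B !lumped_muE !deg_cl mulr_suml !mulr_sumr.
  apply: eq_bigr => c _; rewrite !mulr_sumr.
  by apply: eq_bigr => d _; ring.
Qed.

Section Morphisms.
Variables (M M' : lmodType k) (e : S -> M) (co : M -> {malg k[S]})
  (e' : C -> M') (co' : M' -> {malg k[C]}).
Hypotheses (eB : is_basis e co) (eB' : is_basis e' co').

Lemma lumped_quotient (D : hopf_data M) (D' : hopf_data M') (pi : M -> M') :
    presents degS ES oneS e mu de D ->
    presents degC EC oneC e' lumped_mu lumped_de D' ->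
    linear pi -> (forall x, pi (e x) = e' (cl x)) ->
  hopf_morphism D D' pi.
Proof.
move=> prD prD' pil pie; split=> //.
- apply: (basis_bil_ext eB eB).
  + exact: (bil_lin pil (pr_bilinear prD)).
  + exact: (bil_comp (pr_bilinear prD') pil pil).
  move=> a b; rewrite !pie (pr_mul prD (leqnn _)) (lin_sum _ _ _ _ pil).
  rewrite (pr_mul prD' (n := (degS a + degS b)%N)) ?deg_cl //.
  rewrite -sum_fibers; apply: eq_bigr => X _; rewrite lumped_muE scaler_suml.
  by apply: eq_fiber => x <-; rewrite pie.
- by rewrite (pr_one prD) pie cl_one (pr_one prD').
- have pl := tensor_map_linear pil pil; apply: (basis_ext eB).
  + exact: (lin_comp (pr_comul_linear prD') pil).
  + exact: (lin_comp pl (pr_comul_linear prD)).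
  move=> x; rewrite pie (pr_comul prD' (leqnn _)) deg_cl (pr_comul prD (leqnn _)).
  rewrite (sum_tens _ _ _ _ _ pl) -sum_fibers2.
  apply: eq_bigr => A _; apply: eq_bigr => B _; rewrite lumped_deE scaler_suml.
  apply: eq_fiber => a <-; rewrite scaler_suml; apply: eq_fiber => b <-.
  by rewrite tensor_mapE // !pie.
- apply: (basis_ext eB (V := k^o)).
  + exact: (lin_comp (pr_counit_linear prD') pil).
  + exact: pr_counit_linear prD.
  move=> x; rewrite pie (pr_counit prD) (pr_counit prD').
  by rewrite -(index_deg0 CI) -(index_deg0 SI) deg_cl.
Qed.

(** This is the transpose of the previous statement: the map that sends a class to
    the sum of its elements is adjoint to the projection [cl]. *)
Lemma lumped_sub (D : hopf_data M) (D' : hopf_data M') (iota : M' -> M) :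
    presents degS ES oneS e de mu D ->
    presents degC EC oneC e' lumped_de lumped_mu D' ->
    linear iota -> (forall X, iota (e' X) = \sum_(x <- fiber X) e x) ->
  hopf_morphism D' D iota.
Proof.
move=> prD prD' il ie.
have fib_sum X : \sum_(x <- fiber X) e x = \sum_(x <- fiber X) 1 *: e x.
  by apply: eq_bigr => x _; rewrite scale1r.
split=> //.
- apply: (basis_bil_ext eB' eB').
  + exact: (bil_lin il (pr_bilinear prD')).
  + exact: (bil_comp (pr_bilinear prD) il il).
  move=> A B; rewrite !ie (pr_mul prD' (leqnn _)) (lin_sum _ _ _ _ il).
  set n := (degC A + degC B)%N.
  transitivity (\sum_(x <- ES n) lumped_de A B (cl x) *: e x).
    rewrite -sum_fibers; apply: eq_bigr => X _; rewrite ie scaler_sumr.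
    by apply: eq_fiber => x ->.
  rewrite (fib_sum A) bil_suml; last exact: pr_bilinear prD.
  transitivity (\sum_(a <- fiber A) \sum_(b <- fiber B) \sum_(x <- ES n) de a b x *: e x).
    rewrite [RHS](eq_bigr (fun a => \sum_(x <- ES n) \sum_(b <- fiber B) de a b x *: e x)).
      rewrite [RHS]exchange_big; apply: eq_bigr => x _; rewrite lumped_deE scaler_suml.
      by apply: eq_bigr => a _; rewrite scaler_suml.
    by move=> a _; rewrite [RHS]exchange_big.
  apply: eq_fiber => a aA; rewrite scale1r fib_sum bil_sumr; last exact: pr_bilinear prD.
  apply: eq_fiber => b bB; rewrite scale1r (pr_mul prD (n := n)) //.
  by rewrite /n -aA -bB !deg_cl.
- by rewrite (pr_one prD') ie fiber_one (pr_one prD).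
- have pl := tensor_map_linear il il; apply: (basis_ext eB').
  + exact: (lin_comp (pr_comul_linear prD) il).
  + exact: (lin_comp pl (pr_comul_linear prD')).
  move=> X; rewrite ie (pr_comul prD' (leqnn _)) (sum_tens _ _ _ _ _ pl).
  set n := degC X; rewrite fib_sum (lin_sum _ _ _ _ (pr_comul_linear prD)).
  transitivity (\sum_(x <- fiber X) \sum_(a <- ES n) \sum_(b <- ES n) mu a b x *: (e a ⊗ e b)).
    by apply: eq_fiber => x xX; rewrite scale1r (pr_comul prD (n := n)) // /n -xX deg_cl.
  transitivity (\sum_(a <- ES n) \sum_(b <- ES n) lumped_mu (cl a) (cl b) X *: (e a ⊗ e b)).
    rewrite exchange_big; apply: eq_bigr => a _; rewrite exchange_big.
    by apply: eq_bigr => b _; rewrite lumped_muE scaler_suml.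
  rewrite -sum_fibers2; apply: eq_bigr => A _; apply: eq_bigr => B _.
  rewrite tensor_mapE // !ie (fib_sum A) bil_suml; last exact: tens_bilinear.
  rewrite scaler_sumr; apply: eq_fiber => a <-.
  rewrite scale1r (fib_sum B) bil_sumr; last exact: tens_bilinear.
  by rewrite scaler_sumr; apply: eq_fiber => b <-; rewrite scale1r.
- apply: (basis_ext eB' (V := k^o)).
  + exact: (lin_comp (pr_counit_linear prD) il).
  + exact: pr_counit_linear prD'.
  move=> X; rewrite ie (pr_counit prD').
  rewrite fib_sum (lin_sum _ _ _ _ (pr_counit_linear prD)).
  rewrite (eq_fiber (G := fun x => (oneS == x)%:R * 1)) => [|x _]; last first.
    by rewrite (pr_counit prD) eq_sym; apply: mulrC.
  by rewrite (sum_deltal _ _ (fiber_uniq X)) mem_fiber cl_one eq_sym; case: eqP.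
Qed.

End Morphisms.

End Lumping.

(** * The plactic congruence *)

Section Plactic.
Local Open Scope nat_scope.
Implicit Types (x y z : nat) (r u v w t : seq nat) (T : seq (seq nat)).

Variant knuth3 : seq nat -> seq nat -> Prop :=
| Knuth_yxz x y z : x < y -> y <= z -> knuth3 [:: y; x; z] [:: y; z; x]
| Knuth_xzy x y z : x <= y -> y < z -> knuth3 [:: x; z; y] [:: z; x; y].

Inductive plactic : seq nat -> seq nat -> Prop :=
| plactic_refl w : plactic w w
| plactic_sym w w' : plactic w w' -> plactic w' w
| plactic_trans w w' w'' : plactic w w' -> plactic w' w'' -> plactic w w''
| plactic_knuth u t t' v : knuth3 t t' -> plactic (u ++ t ++ v) (u ++ t' ++ v).

Lemma plactic_cat u u' v v' :
  plactic u u' -> plactic v v' -> plactic (u ++ v) (u' ++ v').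
Proof.
move=> uu' vv'; apply: (@plactic_trans _ (u' ++ v)).
  elim: uu' => {u u'} [w|w w' _|w w' w'' _ IH1 _ IH2|u t t' w tt'].
  - exact: plactic_refl.
  - exact: plactic_sym.
  - exact: plactic_trans IH1 IH2.
  - by rewrite -!catA; apply: plactic_knuth.
elim: vv' => {v v'} [w|w w' _|w w' w'' _ IH1 _ IH2|v t t' w tt'].
- exact: plactic_refl.
- exact: plactic_sym.
- exact: plactic_trans IH1 IH2.
- by rewrite !(catA u'); apply: plactic_knuth.
Qed.

Lemma plactic_cons x v v' : plactic v v' -> plactic (x :: v) (x :: v').
Proof. by move=> vv'; apply: (@plactic_cat [:: x] [:: x]) => //; exact: plactic_refl. Qed.

Lemma plactic_perm w w' : plactic w w' -> perm_eq w w'.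
Proof.
elim=> {w w'} [w|w w' _|w w' w'' _ IH1 _ IH2|u t t' v tt'].
- exact: perm_refl.
- by rewrite perm_sym.
- exact: perm_trans IH1 IH2.
- rewrite perm_cat2l perm_cat2r; case: tt' => x y z _ _; apply/permP => p /=; lia.
Qed.

(** In both Knuth relations the two letters that are exchanged enclose the
    third one, so a convex set of letters that keeps both keeps the third. *)
Lemma plactic_filter (p : pred nat) w w' :
    (forall x y z, x <= y <= z -> p x -> p z -> p y) ->
  plactic w w' -> plactic (filter p w) (filter p w').
Proof.
move=> pconv; elim=> {w w'} [w|w w' _|w w' w'' _ IH1 _ IH2|u t t' v tt'].
- exact: plactic_refl.
- exact: plactic_sym.
- exact: plactic_trans IH1 IH2.
rewrite !filter_cat; case: tt' => x y z xy yz /=.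
  have := pconv x y z; rewrite (ltnW xy) yz => /(_ isT).
  case: (p x); case: (p y); case: (p z) => //= py; try exact: plactic_refl.
    exact: (plactic_knuth _ _ (Knuth_yxz xy yz)).
  by have := py isT isT.
have := pconv x y z; rewrite (ltnW yz) xy => /(_ isT).
case: (p x); case: (p y); case: (p z) => //= py; try exact: plactic_refl.
  exact: (plactic_knuth _ _ (Knuth_xzy xy yz)).
by have := py isT isT.
Qed.

Lemma plactic_map (f : nat -> nat) w w' :
    {in w &, {mono f : x y / x < y}} -> plactic w w' ->
  plactic (map f w) (map f w').
Proof.
move=> fmono ww'; elim: ww' fmono => {w w'}
  [w|w w' ww' IH|w w' w'' ww' IH1 _ IH2|u t t' v tt'] fmono.
- exact: plactic_refl.
- apply: plactic_sym; apply: IH => x y; rewrite !(perm_mem (plactic_perm ww')).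
  exact: fmono.
- apply: plactic_trans (IH1 fmono) (IH2 _) => x y.
  by rewrite -!(perm_mem (plactic_perm ww')); apply: fmono.
rewrite !map_cat; apply: plactic_knuth.
have fm : {in t &, {mono f : x y / x < y}}.
  by move=> x y xt yt; apply: fmono; rewrite !mem_cat ?xt ?yt orbT.
case: tt' fm => x y z xy yz fm /=; constructor.
- by rewrite fm ?inE ?eqxx ?orbT.
- by rewrite leqNgt fm ?inE ?eqxx ?orbT // -leqNgt.
- by rewrite leqNgt fm ?inE ?eqxx ?orbT // -leqNgt.
- by rewrite fm ?inE ?eqxx ?orbT.
Qed.

(** ** Row insertion *)

Lemma row_insert_bump x r r' y :
  row_insert x r = (r', Some y) -> x < y /\ y \in r.
Proof.
elim: r r' => [|h r IH] r' //=; case: ltnP => [xh [_ <-]|hx].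
  by rewrite mem_head.
case E: (row_insert x r) => [r1 b] [_ Eb]; rewrite Eb in E.
by have [xy yr] := IH _ E; rewrite inE yr orbT.
Qed.

Lemma row_insert_mem x r r' b : row_insert x r = (r', b) ->
  {subset r' <= x :: r}.
Proof.
elim: r r' => [|h r IH] r' /=; first by case=> <- _.
case: ltnP => [xh [<- _]|hx].
  by move=> u; rewrite !inE => /orP[->//|->]; rewrite !orbT.
case E: (row_insert x r) => [r1 b1] [<- Eb]; rewrite Eb in E => u.
rewrite !inE => /orP[->|/(IH _ E)]; rewrite ?orbT // inE => /orP[->//|->].
by rewrite !orbT.
Qed.

Lemma row_insert_sorted x r r' b : row_insert x r = (r', b) ->
  sorted leq r -> sorted leq r'.
Proof.
elim: r r' => [|h r IH] r' /=; first by case=> <-.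
case: ltnP => [xh [<- _]|hx].
  by case: r {IH} => //= s r /andP[hs ->]; rewrite (leq_trans (ltnW xh) hs).
case E: (row_insert x r) => [r1 b1] [<- Eb]; rewrite Eb in E => hr /=.
rewrite path_sortedE; last exact: leq_trans.
move: hr; rewrite path_sortedE; last exact: leq_trans.
move=> /andP[/allP hr sr]; rewrite (IH _ E sr) andbT.
apply/allP => u /(row_insert_mem E); rewrite inE => /orP[/eqP -> //|].
exact: hr.
Qed.

Lemma row_insert_head x r r' b : row_insert x r = (r', b) ->
  exists s r1, r' = s :: r1 /\ s <= x.
Proof.
case: r => [|h r] /=; first by case=> <- _; exists x, [::].
case: ltnP => [xh [<- _]|hx]; first by exists x, r.
by case: (row_insert x r) => [r1 b1] [<- _]; exists h, r1.
Qed.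

(** The inserted letter moves to the left through the letters larger than the one
    it bumps, and then the bumped letter moves to the left through the smaller
    ones; each step is a Knuth relation. *)
Lemma row_insert_plactic x r r' b : sorted leq r -> row_insert x r = (r', b) ->
  plactic (rcons r x) (seq_of_opt b ++ r').
Proof.
elim: r r' b => [|h r IH] r' b /=; first by move=> _ [<- <-]; exact: plactic_refl.
case: ltnP => [xh|hx] hr.
  case=> <- <- /=; elim: r h xh hr {IH} => [|s r IH] h xh /= +;
    first by move=> _; exact: plactic_refl.
  move=> /andP[hs sr]; apply: (@plactic_trans _ (h :: s :: x :: r)).
    by apply/plactic_cons/IH => //; apply: leq_trans hs.
  apply: plactic_sym.
  by apply: (@plactic_knuth [::] [:: h; x; s] [:: h; s; x] r); constructor.
case E: (row_insert x r) => [r1 b1] [<- <-].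
move: hr; rewrite path_sortedE; last exact: leq_trans.
move=> /andP[/allP hr sr]; have := plactic_cons h (IH _ _ sr E).
case: b1 E => [y|] E //= hP; apply: plactic_trans hP _.
have [xy yr] := row_insert_bump E.
have [s [r2 [Er1 sx]]] := row_insert_head E.
rewrite Er1; apply: (@plactic_knuth [::] [:: h; y; s] [:: y; h; s] r2).
constructor; last exact: leq_ltn_trans xy.
have /(row_insert_mem E) : s \in r1 by rewrite Er1 mem_head.
by rewrite inE => /orP[/eqP ->|/hr].
Qed.

(** The second letter passes the place taken by the first one, so it can only bump
    further to the right. *)
Lemma row_insert_le y z r r1 r2 b1 z' : sorted leq r -> y <= z ->
    row_insert y r = (r1, b1) -> row_insert z r1 = (r2, Some z') ->
  exists2 y', b1 = Some y' & y' <= z'.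
Proof.
move=> + yz; elim: r r1 r2 b1 => [|h r IH] r1 r2 b1 /= hr.
  by case=> <- <- /=; case: ltnP => // zy; lia.
case: ltnP => [yh [<- <-] /=|hy].
  case: ltnP => [zy|_]; first by lia.
  case E: (row_insert z r) => [r3 b3] [_ Eb]; rewrite Eb in E.
  have [_ z'r] := row_insert_bump E; exists h => //.
  by move: hr; rewrite path_sortedE => [/andP[/allP/(_ _ z'r)]|]; last exact: leq_trans.
case E: (row_insert y r) => [r3 b3] [<- <-] /=.
case: ltnP => [zh|_]; first by lia.
case E': (row_insert z r3) => [r4 b4] [_ Eb]; rewrite Eb in E'.
exact: (IH _ _ _ (path_sorted hr) E E').
Qed.

(** The larger letter [z], now in the row, can be bumped by [y]. *)
Lemma row_insert_gt y z r r1 r2 b1 b2 : y < z ->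
    row_insert z r = (r1, b1) -> row_insert y r1 = (r2, b2) ->
  exists2 y', b2 = Some y' & y' <= z.
Proof.
move=> yz; elim: r r1 r2 b1 b2 => [|h r IH] r1 r2 b1 b2 /=.
  by case=> <- _ /=; rewrite yz => -[_ <-]; exists z.
case: ltnP => [zh [<- _] /=|hz].
  by rewrite yz => -[_ <-]; exists z.
case E: (row_insert z r) => [r3 b3] [<- _] /=.
case: ltnP => [yh [_ <-]|hy]; first by exists h.
case E': (row_insert y r3) => [r4 b4] [_ <-]; exact: IH E E'.
Qed.

(** Successive insertions in one row: the resulting row, and the word of the
    bumped letters, which is inserted in the rows below. *)
Fixpoint row_bump r w : seq nat * seq nat :=
  if w is x :: w' then
    let: (r1, b) := row_insert x r in
    let: (r2, v) := row_bump r1 w' in (r2, seq_of_opt b ++ v)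
  else (r, [::]).

Lemma row_bump_tab r T w r' w' : row_bump r w = (r', w') ->
  foldl (fun T x => tab_insert x T) (r :: T) w
  = r' :: foldl (fun T x => tab_insert x T) T w'.
Proof.
elim: w r T w' => [|x w IH] r T w' /=; first by case=> <- <-.
case: (row_insert x r) => [r1 b]; case E: (row_bump r1 w) => [r2 v] [Er <-].
by rewrite Er in E; case: b => [y|]; rewrite (IH _ _ _ E).
Qed.

(** That the bumped words are again equal or related is what makes an induction
    on the rows of a tableau possible.  A first letter [h] of the row that is at
    most all the inserted letters is passed by all of them; otherwise the smallest
    letter bumps [h], or bumps a letter that has replaced [h], and the bumped words
    can be compared explicitly. *)
Lemma row_bump_knuth r t t' : sorted leq r -> knuth3 t t' ->
  exists r' w w', [/\ row_bump r t = (r', w), row_bump r t' = (r', w')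
    & [\/ w = w', knuth3 w w' | knuth3 w' w]].
Proof.
move=> + tt'; elim: r => [|h r IH] hr.
  case: tt' => x y z xy yz; rewrite /row_bump /=.
    rewrite xy (ltnNge z) yz /= xy (ltnNge z).
    rewrite (leq_trans (ltnW xy) yz) /=.
    by do 3 eexists; split; [reflexivity|reflexivity|constructor].
  rewrite (ltnNge z) (leq_trans xy (ltnW yz)) /= (ltnNge y) xy /= yz.
  rewrite (leq_ltn_trans xy yz) /= ltnNge xy /=.
  by do 3 eexists; split; [reflexivity|reflexivity|constructor].
have {}IH := IH (path_sorted hr).
have {}hr : {in r, forall s, h <= s} /\ sorted leq r.
  by move: hr; rewrite /= path_sortedE => [/andP[/allP]|]; last exact: leq_trans.
case: hr => hr sr.
case: tt' IH => x y z xy yz /=.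
  have [hx|xh] := leqP h x.
    have hy := leq_trans hx (ltnW xy); have hz := leq_trans hy yz.
    rewrite (ltnNge y) hy /=; case: (row_insert y r) => r1 b1 /=.
    rewrite (ltnNge x h) hx (ltnNge z h) hz /=.
    case: (row_insert x r1) => r2 b2; case: (row_insert z r1) => r3 b3 /=.
    rewrite (ltnNge x h) hx (ltnNge z h) hz /=.
    case: (row_insert z r2) => r4 b4; case: (row_insert x r3) => r5 b5 /=.
    case=> r' [w [w' [[<- <-] [-> <-] ?]]].
    by do 3 eexists; split; [reflexivity|reflexivity|].
  move=> _; have [hy|yh] := leqP h y.
    have hz := leq_trans hy yz.
    case E1: (row_insert y r) => [r1 b1] /=.
    rewrite xh (ltnNge z h) hz /= (ltnNge z x) (leq_trans (ltnW xy) yz) /=.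
    case E2: (row_insert z r1) => [r2 b2] /=; rewrite xh.
    do 3 eexists; split; [reflexivity|reflexivity|].
    case: b2 E2 => [z'|] E2 /=; last by constructor.
    have [y' Ey y'z'] := row_insert_le sr yz E1 E2; rewrite Ey in E1 *.
    have [yy' _] := row_insert_bump E1.
    by constructor 2; constructor => //; apply: leq_ltn_trans yy'.
  rewrite /= xy /= (ltnNge z y) yz (ltnNge z x) (leq_trans (ltnW xy) yz) /=.
  case E2: (row_insert z r) => [r2 b2] /=; rewrite xy.
  do 3 eexists; split; [reflexivity|reflexivity|].
  case: b2 E2 => [z'|] E2 /=; last by constructor.
  have [_ /hr hz'] := row_insert_bump E2.
  by constructor 2; constructor.
have xz := leq_ltn_trans xy yz.
have [hx|xh] := leqP h x.
  have hy := leq_trans hx xy; have hz := leq_trans hy (ltnW yz).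
  rewrite (ltnNge z h) hz /=.
  case: (row_insert x r) => r1 b1; case: (row_insert z r) => r2 b2 /=.
  rewrite (ltnNge x h) hx (ltnNge z h) hz /=.
  case: (row_insert z r1) => r3 b3; case: (row_insert x r2) => r4 b4 /=.
  rewrite (ltnNge y h) hy /=.
  case: (row_insert y r3) => r5 b5; case: (row_insert y r4) => r6 b6 /=.
  case=> r' [w [w' [[<- <-] [-> <-] ?]]].
  by do 3 eexists; split; [reflexivity|reflexivity|].
move=> _; have [hz|zh] := leqP h z.
  rewrite /= (ltnNge z x) (ltnW xz) /=.
  case E1: (row_insert z r) => [r1 b1] /=.
  rewrite xh (ltnNge y x) xy /=.
  case E2: (row_insert y r1) => [r2 b2] /=.
  rewrite (ltnNge y x) xy /=.
  do 3 eexists; split; [reflexivity|reflexivity|].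
  have [y' Ey y'z] := row_insert_gt yz E1 E2; rewrite Ey in E2 *.
  case: b1 E1 => [z'|] E1 /=; last by constructor.
  have [zz' _] := row_insert_bump E1.
  have [_ /(row_insert_mem E1)] := row_insert_bump E2.
  rewrite inE => hy'; constructor 2; constructor.
    by case/orP: hy' => [/eqP ->|/hr].
  exact: leq_ltn_trans zz'.
rewrite /= (ltnNge z x) (ltnW xz) xz /= (ltnNge y x) xy.
case: r hr sr => [|s r] hr sr /=.
  rewrite (ltnNge y x) xy /= yz.
  by do 3 eexists; split; [reflexivity|reflexivity|constructor].
have hs : h <= s by apply: hr; rewrite mem_head.
rewrite (leq_trans zh hs) /= (ltnNge y x) xy yz (ltn_trans yz (leq_trans zh hs)) /=.
do 3 eexists; split; [reflexivity|reflexivity|].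
by constructor 3; constructor.
Qed.

(** ** Knuth's theorem *)

Lemma tab_insert_sorted x T : all (sorted leq) T -> all (sorted leq) (tab_insert x T).
Proof.
elim: T x => [|r T IH] x //= /andP[sr sT].
case E: (row_insert x r) => [r' [y|]] /=.
  by rewrite (row_insert_sorted E sr) IH.
by rewrite (row_insert_sorted E sr).
Qed.

Lemma Ptab_sorted w : all (sorted leq) (Ptab w).
Proof.
rewrite /Ptab -[w]revK foldl_rev; elim: (rev w) => //= x v.
exact: tab_insert_sorted.
Qed.

Lemma Ptab_cat u v : Ptab (u ++ v) = foldl (fun T x => tab_insert x T) (Ptab u) v.
Proof. by rewrite /Ptab foldl_cat. Qed.

Lemma foldl_knuth T t t' : all (sorted leq) T -> knuth3 t t' ->
  foldl (fun T x => tab_insert x T) T t = foldl (fun T x => tab_insert x T) T t'.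
Proof.
elim: T t t' => [|r T IH] t t' /= sT tt'.
  case: tt' => x y z xy yz /=.
    have xz := leq_trans xy yz.
    by rewrite xy (ltnNge z y) yz /= (ltnNge z x) (ltnW xz) /= xy.
  have xz := leq_ltn_trans xy yz.
  by rewrite (ltnNge z x) (ltnW xz) xz /= !(ltnNge y x) xy /= yz.
have [sr {}sT] := andP sT.
have [r' [w [w' [E E' ww']]]] := row_bump_knuth sr tt'.
rewrite (row_bump_tab _ E) (row_bump_tab _ E'); congr cons.
by case: ww' => [->//|?|?]; [|symmetry]; apply: IH.
Qed.

(** The tableau of a prefix is the same on both sides, and equal tableaux stay
    equal under further insertions; only the middle factor matters. *)
Lemma plactic_Ptab w w' : plactic w w' -> Ptab w = Ptab w'.
Proof.
elim=> {w w'} [//|//|w w' w'' _ -> _ -> //|u t t' v tt'].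
by rewrite !Ptab_cat !foldl_cat (foldl_knuth _ tt') ?Ptab_sorted.
Qed.

(** Inserting a letter in the top row sends the bumped letter to the left of this
    row, that is, to the end of the reading of the rows below. *)
Lemma plactic_reading w : plactic w (flatten (rev (Ptab w))).
Proof.
elim/last_ind: w => [|w x IH]; first exact: plactic_refl.
rewrite -cats1 Ptab_cat /=.
apply: plactic_trans (plactic_cat IH (plactic_refl [:: x])) _.
elim: (Ptab w) (Ptab_sorted w) x {IH} => [|r T IH] /= sT x; first exact: plactic_refl.
have [sr {}sT] := andP sT.
rewrite rev_cons flatten_rcons -catA cats1.
case E: (row_insert x r) => [r' b]; have := row_insert_plactic sr E.
case: b E => [y|] E /= hP; last first.
  rewrite rev_cons flatten_rcons; apply: plactic_cat => //; exact: plactic_refl.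
rewrite rev_cons flatten_rcons.
apply: plactic_trans (plactic_cat (plactic_refl _) hP) _.
rewrite -cat1s catA; apply: plactic_cat (IH sT y) (plactic_refl _).
Qed.

(** Equality of insertion tableaux is hereby a congruence, which is not apparent
    from insertion: the tableau of a word [u ++ v] is not defined in terms of that
    of [v]. *)
Lemma knuthP w w' : reflect (plactic w w') (knuth w w').
Proof.
apply: (iffP eqP) => [Pww'|]; last exact: plactic_Ptab.
apply: plactic_trans (plactic_reading w) _; rewrite Pww'.
exact: plactic_sym (plactic_reading w').
Qed.

End Plactic.

(** * Words, standardization and inversions *)

Section WordCombinatorics.
Local Open Scope nat_scope.
Implicit Types (x y i j : nat) (u v w : seq nat) (m : bitseq).

(** The number of pairs of positions [i < j] with letters related by [R]: the
    common form of the two inversion counts, convenient for inductions. *)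
Fixpoint count_pairs (R : rel nat) w : nat :=
  if w is x :: w' then count (R x) w' + count_pairs R w' else 0.

Lemma card_count_pairs (R : rel nat) w :
  #|[set p : 'I_(size w) * 'I_(size w) |
      (p.1 < p.2) && R (nth 0 w p.1) (nth 0 w p.2)]| = count_pairs R w.
Proof.
have cardE n (S : nat -> nat -> bool) :
    #|[set p : 'I_n * 'I_n | S p.1 p.2]| = \sum_(i < n) \sum_(j < n) S i j.
  rewrite -sum1_card pair_big /= big_mkcond /=.
  by apply: eq_bigr => -[i j] _; rewrite inE /=; case: (S i j).
rewrite (cardE _ (fun i j => (i < j) && R (nth 0 w i) (nth 0 w j))).
elim: w {cardE} => [|x w IH] /=; first by rewrite big_ord0.
rewrite big_ord_recl /= -IH; congr (_ + _).
  rewrite big_ord_recl /= add0n -sum1_count (big_nth 0) big_mkord [RHS]big_mkcond.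
  by apply: eq_bigr => i _; rewrite add0n; case: (R _ _).
by apply: eq_bigr => i _; rewrite big_ord_recl /= add0n; apply: eq_bigr.
Qed.

Lemma ninvE w : ninv w = count_pairs (fun x y => y < x) w.
Proof. by rewrite -card_count_pairs. Qed.

Lemma inviE i w : invi i w = count_pairs (fun x y => (y <= i) && (i < x)) w.
Proof.
rewrite -card_count_pairs /invi.
pose sw (p : 'I_(size w) * 'I_(size w)) := (p.2, p.1).
have swK : involutive sw by case.
rewrite -(card_imset _ (inv_inj swK)); apply: eq_card => p.
by rewrite -[p]swK mem_imset ?inE //; apply: inv_inj.
Qed.

Definition cross u v : nat := \sum_(x <- u) count (fun y => y < x) v.

Lemma cross_catl u u' v : cross (u ++ u') v = cross u v + cross u' v.
Proof. exact: big_cat. Qed.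

Lemma cross_catr u v v' : cross u (v ++ v') = cross u v + cross u v'.
Proof. by rewrite /cross -big_split; apply: eq_bigr => x _; rewrite count_cat. Qed.

Lemma cross_perm u u' v v' : perm_eq u u' -> perm_eq v v' -> cross u v = cross u' v'.
Proof.
move=> uu' vv'; rewrite /cross (perm_big _ uu').
by apply: eq_bigr => x _; apply/permP.
Qed.

Lemma cross_map f u v : {in u & v, forall x y, (f y < f x) = (y < x)} ->
  cross (map f u) (map f v) = cross u v.
Proof.
move=> fmono; rewrite /cross big_map big_seq [RHS]big_seq.
apply: eq_bigr => x xu; rewrite count_map; apply: eq_in_count => y yv.
exact: fmono.
Qed.

Lemma ninv_cat u v : ninv (u ++ v) = ninv u + ninv v + cross u v.
Proof.
rewrite !ninvE; elim: u => [|x u IH] /=; first by rewrite /cross big_nil addn0.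
by rewrite IH count_cat /cross big_cons; lia.
Qed.

Lemma ninv_map f w : {in w &, {mono f : x y / x < y}} -> ninv (map f w) = ninv w.
Proof.
rewrite !ninvE; elim: w => [//|x w IH] /= fmono; rewrite IH.
  rewrite count_map; congr (_ + _); apply: eq_in_count => y yw /=.
  by apply: fmono; rewrite ?inE ?eqxx ?yw ?orbT.
by move=> y z yw zw; apply: fmono; rewrite inE (yw, zw) orbT.
Qed.

(** A small letter preceding a large one is not an inversion, so the inversions
    across the cut are those counted by [invi]. *)
Lemma ninv_filter i w :
  ninv w = ninv [seq x <- w | x <= i] + ninv [seq x <- w | i < x] + invi i w.
Proof.
rewrite !ninvE inviE; elim: w => [//|x w IH] /=.
have -> : count (fun y => y < x) w = count (fun y => y < x) [seq y <- w | y <= i]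
                                   + count (fun y => y < x) [seq y <- w | i < y].
  rewrite !count_filter -count_predUI addnC (@eq_count _ (predI _ _) pred0).
    by rewrite count_pred0 add0n; apply: eq_count => y /=; lia.
  by move=> y /=; lia.
rewrite IH; case: (leqP x i) => xi /=.
  rewrite (@eq_in_count _ _ pred0 [seq y <- w | i < y]).
    rewrite (@eq_count _ (fun y => (y <= i) && false) pred0) ?count_pred0.
      by lia.
    by move=> y; rewrite andbF.
  by move=> y; rewrite mem_filter => /andP[iy _] /=; lia.
rewrite (@eq_in_count _ _ predT [seq y <- w | y <= i]); last first.
  by move=> y; rewrite mem_filter => /andP[iy _] /=; lia.
rewrite count_predT size_filter.
rewrite (@eq_count _ (fun y => (y <= i) && true) (fun y => y <= i)).
  have addE a b c d e : a + b + (c + d + e) = c + (b + d) + (a + e) by lia.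
  exact: addE.
by move=> y; rewrite andbT.
Qed.

(** Inverse to the decomposition of a word [w] into the mask [map p w] and the
    subwords [filter p w] and [filter (predC p) w]; the default letter [0] is
    reached only when the sizes do not match. *)
Fixpoint fill m u v : seq nat :=
  match m with
  | [::] => [::]
  | true :: m' => head 0 u :: fill m' (behead u) v
  | false :: m' => head 0 v :: fill m' u (behead v)
  end.

Lemma fillE (p : pred nat) w :
  fill (map p w) (filter p w) (filter (predC p) w) = w.
Proof. by elim: w => //= x w IH; case: (p x) => /=; rewrite IH. Qed.

Lemma fill_inj (p : pred nat) w w' : map p w = map p w' ->
  filter p w = filter p w' -> filter (predC p) w = filter (predC p) w' -> w = w'.
Proof. by move=> Em E1 E2; rewrite -(fillE p w) Em E1 E2 fillE. Qed.

Section Fill.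
Variables (p : pred nat) (m : bitseq) (u v : seq nat).
Hypotheses (Eu : count id m = size u) (Ev : count negb m = size v).
Hypotheses (pu : all p u) (pv : all (predC p) v).

Lemma fill_spec : [/\ map p (fill m u v) = m, filter p (fill m u v) = u &
                      filter (predC p) (fill m u v) = v].
Proof.
elim: m u v Eu Ev pu pv => [|[] m' IH] u' v' /=.
- by move=> /esym/size0nil -> /esym/size0nil ->.
- case: u' => //= x u' [Em] Ev' /andP[-> pu'] pv' /=.
  by have [-> -> ->] := IH _ _ Em Ev' pu' pv'.
- case: v' => //= x v' Em [Ev'] pu' /andP[px pv'] /=.
  by rewrite (negbTE px) /=; have [-> -> ->] := IH _ _ Em Ev' pu' pv'.
Qed.

Lemma fill_perm : perm_eq (fill m u v) (u ++ v).
Proof.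
have [_ E1 E2] := fill_spec.
rewrite -[X in perm_eq _ (X ++ _)]E1 -[X in perm_eq _ (_ ++ X)]E2 perm_sym.
by apply/permPl/perm_filterC.
Qed.

End Fill.

(** ** Standardization *)

Lemma nth_st_lt_uniq u i j : uniq u -> i < size u -> j < size u ->
  st_lt u i j = (nth 0 u i < nth 0 u j).
Proof.
move=> Uu iu ju; rewrite /st_lt nth_uniq //.
by case: (ltngtP i j) => [ij|//|->]; rewrite ?ltnn ?andbF ?orbF //
   (ltn_eqF ij) orbF.
Qed.

Definition rank u x : nat := (count (fun y => y < x) u).+1.

Lemma st_wordE u : uniq u -> st_word u = map (rank u) u.
Proof.
move=> Uu; apply: (@eq_from_nth _ 0); first by rewrite size_st_word size_map.
move=> i; rewrite size_st_word => iu; rewrite nth_st_word // (nth_map 0) //.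
rewrite /rank; congr _.+1.
rewrite -[in X in _ = count _ X](mkseq_nth 0 u) /mkseq count_map.
apply: eq_in_count => j; rewrite mem_iota /= add0n => ju.
by rewrite nth_st_lt_uniq.
Qed.

Lemma rank_mono u : {in u &, {mono rank u : x y / x < y}}.
Proof.
have mono x y : x \in u -> x < y -> rank u x < rank u y.
  move=> xu xy; rewrite /rank ltnS.
  have -> : count (fun z => z < x) u = count (fun z => z < x) [seq z <- u | z < y].
    by rewrite count_filter; apply: eq_count => z /=; lia.
  rewrite -(size_filter (fun z => z < y)) -(count_predC (fun z => z < x) (filter _ _)).
  rewrite -[X in X < _]addn0 ltn_add2l -has_count; apply/hasP; exists x.
    by rewrite mem_filter xy.
  by rewrite /= ltnn.
move=> x y xu yu; case: (ltngtP x y) => [xy|yx|->]; first exact: mono.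
  by apply/negbTE; rewrite -leqNgt ltnW ?mono.
by rewrite ltnn.
Qed.

Lemma ltn_mono_inj (D : {pred nat}) f :
  {in D &, {mono f : x y / x < y}} -> {in D &, injective f}.
Proof.
move=> fmono x y xD yD fxy; case: (ltngtP x y) => // xy.
  by have := fmono x y xD yD; rewrite xy fxy ltnn.
by have := fmono y x yD xD; rewrite xy fxy ltnn.
Qed.

Lemma perm_word_mem w x : perm_word w -> (x \in w) = (0 < x <= size w).
Proof. by move=> /perm_mem ->; rewrite mem_iota add1n ltnS. Qed.

Lemma perm_word_uniq w : perm_word w -> uniq w.
Proof. by move=> /perm_uniq ->; apply: iota_uniq. Qed.

Lemma count_lt_iota x n : count (fun y => y < x) (iota 1 n) = minn x.-1 n.
Proof. by elim: n => [|n IH]; rewrite ?minn0 // -[n.+1]addn1 iotaD count_cat IH /=; lia. Qed.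

Lemma rank_perm w x : perm_word w -> x \in w -> rank w x = x.
Proof.
move=> pw; rewrite perm_word_mem // /rank (permP pw) count_lt_iota; lia.
Qed.

Lemma st_word_id w : perm_word w -> st_word w = w.
Proof.
move=> pw; rewrite st_wordE ?perm_word_uniq // -[RHS]map_id.
by apply/eq_in_map => x /(rank_perm pw).
Qed.

Lemma st_map f u : uniq u -> {in u &, {mono f : x y / x < y}} -> st (map f u) = st u.
Proof.
move=> Uu fmono; have Uf : uniq (map f u).
  by rewrite map_inj_in_uniq //; apply: ltn_mono_inj.
apply: val_inj; rewrite /= !st_wordE // -map_comp; apply/eq_in_map => x xu /=.
rewrite /rank count_map; congr _.+1; apply: eq_in_count => y yu /=.
exact: fmono.
Qed.

Lemma st_id (w : sperm) : st w = w.
Proof. by apply: val_inj; rewrite /= st_word_id //; apply: valP. Qed.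

Lemma st_take i u : uniq u -> st (take i (st u)) = st (take i u).
Proof.
move=> Uu; rewrite /= st_wordE // -map_take st_map ?take_uniq //.
by move=> x y /mem_take xu /mem_take yu; apply: rank_mono.
Qed.

Lemma st_drop i u : uniq u -> st (drop i (st u)) = st (drop i u).
Proof.
move=> Uu; rewrite /= st_wordE // -map_drop st_map ?drop_uniq //.
by move=> x y /mem_drop xu /mem_drop yu; apply: rank_mono.
Qed.

Lemma cross_st i u : uniq u ->
  cross (take i (st u)) (drop i (st u)) = cross (take i u) (drop i u).
Proof.
move=> Uu; rewrite /= st_wordE // -map_take -map_drop cross_map //.
by move=> x y /mem_take xu /mem_drop yu; apply: rank_mono.
Qed.

Lemma ninv_st u : uniq u -> ninv (st u) = ninv u.
Proof. by move=> Uu; rewrite /= st_wordE // ninv_map //; apply: rank_mono. Qed.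

(** The rank of a letter depends only on the set of letters, and is injective on
    it. *)
Lemma st_inj u v : uniq u -> perm_eq u v -> st u = st v -> u = v.
Proof.
move=> Uu uv /(congr1 val) /=; rewrite !st_wordE -?(perm_uniq uv) //.
have -> : map (rank v) v = map (rank u) v.
  by apply: eq_map => x; rewrite /rank; congr _.+1; apply/esym/permP.
apply: (inj_in_map (ltn_mono_inj (@rank_mono u))); first exact/allP.
by apply/allP => x; rewrite /= -(perm_mem uv).
Qed.

(** Inverse to standardization, for a given set of letters; the letters of [a]
    are counted from 1, hence the predecessor. *)
Definition relabel (a u : seq nat) : seq nat :=
  [seq nth 0 (sort leq u) x.-1 | x <- a].

Lemma relabel_perm (a : sperm) u : size u = size a -> perm_eq (relabel a u) u.
Proof.
move=> ua; have pa : perm_eq a (iota 1 (size a)) by apply: (valP a).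
rewrite (perm_trans (perm_map _ pa)) // (iotaDl 1 0) -map_comp /=.
have -> : size a = size (sort leq u) by rewrite size_sort.
by rewrite -/(mkseq _ _) mkseq_nth perm_sort.
Qed.

Lemma relabel_mono (a : sperm) u : uniq u -> size u = size a ->
  {in sword a &, {mono (fun x => nth 0 (sort leq u) x.-1) : x y / x < y}}.
Proof.
move=> Uu ua x y; rewrite !perm_word_mem; try exact: (valP a).
move=> /andP[x0 xa] /andP[y0 ya].
have sU : sorted ltn (sort leq u).
  by rewrite ltn_sorted_uniq_leq sort_uniq Uu sort_sorted //; apply: leq_total.
have mono i j : i < j < size a -> nth 0 (sort leq u) i < nth 0 (sort leq u) j.
  move=> /andP[ij ja].
  by apply: (sorted_ltn_nth ltn_trans 0 sU) => //; rewrite inE size_sort ua //;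
    apply: ltn_trans ja.
case: (ltngtP x y) => [xy|yx|->]; last by rewrite ltnn.
  by apply: mono; lia.
by apply/negbTE; rewrite -leqNgt ltnW // mono; lia.
Qed.

Lemma st_relabel (a : sperm) u : uniq u -> size u = size a ->
  st (relabel a u) = a.
Proof.
move=> Uu ua; rewrite st_map ?st_id //; first exact: perm_word_uniq (valP a).
exact: relabel_mono.
Qed.

End WordCombinatorics.

(** ** Small and large letters *)

Section SmallLarge.
Local Open Scope nat_scope.
Implicit Types (x y i j : nat) (u v w : seq nat).

Definition small i u : seq nat := [seq x <- u | x <= i].
Definition large i u : seq nat := [seq x - i | x <- u & i < x].

Lemma small_cat i u v : small i (u ++ v) = small i u ++ small i v.
Proof. exact: filter_cat. Qed.

Lemma large_cat i u v : large i (u ++ v) = large i u ++ large i v.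
Proof. by rewrite /large filter_cat map_cat. Qed.

Lemma size_small_large i u : size (small i u) + size (large i u) = size u.
Proof.
rewrite size_map !size_filter -(count_predC (fun x => x <= i) u); congr (_ + _).
by apply: eq_count => x /=; rewrite ltnNge.
Qed.

Lemma subn_mono i u : {in [seq x <- u | i < x] &, {mono subn^~ i : x y / x < y}}.
Proof. by move=> x y; rewrite !mem_filter => /andP[xi _] /andP[yi _]; lia. Qed.

Lemma st_large i u : uniq u -> st (large i u) = st [seq x <- u | i < x].
Proof. by move=> Uu; rewrite st_map ?filter_uniq //; apply: subn_mono. Qed.

Lemma addn_large i u : [seq x + i | x <- large i u] = [seq x <- u | i < x].
Proof.
rewrite -map_comp -[RHS]map_id; apply/eq_in_map => x.
by rewrite mem_filter /= => /andP[ix _]; lia.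
Qed.

Lemma filter_iota_le i n : [seq x <- iota 1 n | x <= i] = iota 1 (minn i n).
Proof.
elim: n => [|n IH]; first by rewrite minn0.
rewrite -[n.+1]addn1 iotaD filter_cat IH /= add1n; case: ifP => ni /=.
  have -> : minn i (n + 1) = minn i n + 1 by lia.
  by rewrite iotaD /= add1n; congr (_ ++ [:: _]); lia.
by rewrite cats0; congr iota; lia.
Qed.

Lemma perm_iota_word u n : perm_eq u (iota 1 n) -> perm_word u.
Proof. by move=> un; rewrite /perm_word (perm_size un) size_iota. Qed.

Section PermWord.
Variables (w : seq nat) (i : nat).
Hypotheses (pw : perm_word w) (iw : i <= size w).

Lemma small_perm : perm_eq (small i w) (iota 1 i).
Proof.
by rewrite (perm_trans (perm_filter _ pw)) // filter_iota_le (minn_idPl iw).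
Qed.

Lemma size_small : size (small i w) = i.
Proof. by rewrite (perm_size small_perm) size_iota. Qed.

Lemma size_large : size (large i w) = size w - i.
Proof. by rewrite -(size_small_large i w) size_small addKn. Qed.

Lemma large_perm : perm_eq (large i w) (iota 1 (size w - i)).
Proof.
rewrite (perm_trans (perm_map _ (perm_filter _ pw))) //.
rewrite -[in iota 1 (size w)](subnKC iw) iotaD filter_cat.
rewrite (_ : filter _ (iota 1 i) = [::]) => [|]; last first.
  by apply/eqP; rewrite -(negbK (_ == _)) -has_filter; apply/hasPn => x;
    rewrite mem_iota; lia.
rewrite (_ : filter _ _ = iota (1 + i) (size w - i)); last first.
  by apply/all_filterP/allP => x; rewrite mem_iota; lia.
by rewrite /= addnC iotaDl -map_comp (@eq_map _ _ _ id) ?map_id // => x /=; lia.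
Qed.

Lemma small_perm_word : perm_word (small i w).
Proof. exact: perm_iota_word small_perm. Qed.

Lemma large_perm_word : perm_word (large i w).
Proof. exact: perm_iota_word large_perm. Qed.

End PermWord.

(** The letters of [u] that are at most [i] have the smallest ranks, up to their
    number; hence standardization commutes with the restriction to small or to
    large letters. *)
Section RestrictStandardization.
Variables (u : seq nat) (i : nat).
Hypothesis Uu : uniq u.
Let j := count (fun x => x <= i) u.

Lemma rank_le x : x \in u -> (rank u x <= j) = (x <= i).
Proof.
move=> xu; case: (leqP x i) => xi; last first.
  apply/negbTE; rewrite -ltnNge ltnS; apply: sub_count => y /= yi.
  exact: leq_ltn_trans xi.
have -> : j = count (fun y => y <= i) (filter (fun y => y < x) u)
            + count (fun y => y <= i) (filter (fun y => x <= y) u).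
  rewrite /j !count_filter -count_predUI (@eq_count _ (predI _ _) pred0).
    by rewrite count_pred0 addn0; apply: eq_count => y /=; lia.
  by move=> y /=; lia.
rewrite /rank -addn1 leq_add //.
  by rewrite count_filter; apply: sub_count => y /=; lia.
by rewrite -has_count; apply/hasP; exists x; rewrite ?mem_filter ?leqnn.
Qed.

Lemma map_small_st : [seq x <= j | x <- st u] = [seq x <= i | x <- u].
Proof.
rewrite /= st_wordE // -map_comp; apply/eq_in_map => x xu /=; exact: rank_le.
Qed.

Lemma small_st : small j (st u) = st (small i u) :> seq nat.
Proof.
rewrite /small /= !st_wordE ?filter_uniq // filter_map; rewrite (eq_in_filter rank_le); apply/eq_in_map => x.
rewrite mem_filter => /andP[xi xu]; rewrite /rank count_filter; congr _.+1.
by apply: eq_count => y /=; lia.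
Qed.

Lemma large_st : large j (st u) = st [seq x <- u | i < x] :> seq nat.
Proof.
rewrite /large /= !st_wordE ?filter_uniq // filter_map -map_comp.
rewrite (@eq_in_filter _ _ (fun x => i < x)) => [|x xu]; last first.
  by rewrite /= ltnNge rank_le // -ltnNge.
apply/eq_in_map => x; rewrite mem_filter => /andP[ix xu] /=.
rewrite /rank subSn; last by apply: sub_count => y /= yi; apply: leq_ltn_trans ix.
congr _.+1; apply/eqP; rewrite -(eqn_add2l j) subnKC; last first.
  by apply: sub_count => y /= yi; apply: leq_ltn_trans ix.
rewrite /j count_filter -count_predUI (@eq_count _ (predI _ _) pred0).
  by rewrite count_pred0 addn0; apply/eqP/eq_count => y /=; lia.
by move=> y /=; lia.
Qed.

End RestrictStandardization.

End SmallLarge.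

(** * The structure constants of the Malvenuto-Reutenauer algebra *)

Section SpermIndex.
Local Open Scope nat_scope.

Definition sdeg (a : sperm) : nat := size a.

Definition sone : sperm := SPerm (isT : perm_word [::]).

Definition sperms (n : nat) : seq sperm :=
  undup (flatten [seq pmap insub (permutations (iota 1 m)) | m <- iota 0 n.+1]).

Lemma sperm_index : graded_index sdeg sperms sone.
Proof.
split=> [n|n a|a]; first exact: undup_uniq.
  rewrite mem_undup; apply/flatten_mapP/idP => [[m]|an].
    rewrite mem_iota ltnS => mn; rewrite mem_pmap => /mapP[w].
    rewrite mem_permutations => wm; case: insubP => // u _ Eu [->].
    by rewrite /sdeg -[sword u]/(val u) Eu (perm_size wm) size_iota.
  exists (size a); first by rewrite mem_iota ltnS.
  rewrite mem_pmap; apply/mapP; exists (sword a); last by rewrite valK.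
  by rewrite mem_permutations; apply: (valP a).
by rewrite /sdeg size_eq0; apply/eqP/eqP => [a0|->//]; apply: val_inj.
Qed.

End SpermIndex.

Section Constants.
Variables (k : comNzRingType) (q : k).
Implicit Types a b c d x y : sperm.

(** These are the structure constants of MR in the basis [tilde] below.  The
    permutations in the product of [a] and [b] are those whose two halves
    standardize to [a] and [b]; the terms of the coproduct of [x] are its cuts
    into small and large letters. *)
Definition mr_mu a b x : k :=
  ((st (take (size a) x) == a) && (st (drop (size a) x) == b))%:R
  * q ^+ cross (take (size a) x) (drop (size a) x).

Definition mr_de a b x : k :=
  ((small (size a) x == a :> seq nat) && (large (size a) x == b :> seq nat))%:R.

Lemma sperm_uniq a : uniq a. Proof. exact: perm_word_uniq (valP a). Qed.

Lemma sperm_mem a (i : nat) : (i \in sword a) = (0 < i <= size a)%N.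
Proof. exact: perm_word_mem (valP a). Qed.

Lemma size_st (u : seq nat) : size (st u) = size u.
Proof. exact: size_st_word. Qed.

Lemma mr_mu_size a b x : st (take (size a) x) = a -> st (drop (size a) x) = b ->
  size x = (size a + size b)%N.
Proof.
move=> Ea Eb; rewrite -{1}(cat_take_drop (size a) x) size_cat.
by rewrite -(size_st (take _ x)) -(size_st (drop _ x)) Ea Eb.
Qed.

Lemma mr_mu_deg a b x : sdeg x != (sdeg a + sdeg b)%N -> mr_mu a b x = 0.
Proof.
move=> sx; rewrite /mr_mu; case: andP => [[/eqP Ea /eqP Eb]|]; last by rewrite mul0r.
by rewrite /sdeg (mr_mu_size Ea Eb) eqxx in sx.
Qed.

Lemma mr_de_deg a b x : sdeg x != (sdeg a + sdeg b)%N -> mr_de a b x = 0.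
Proof.
move=> sx; rewrite /mr_de; case: andP => // -[/eqP Ea /eqP Eb].
by rewrite /sdeg -(size_small_large (size a) x) Ea Eb eqxx in sx.
Qed.

Lemma mr_mu_onel a x : mr_mu sone a x = (a == x)%:R.
Proof.
rewrite /mr_mu /= take0 drop0 /cross big_nil mulr1 st_id (eq_sym x).
by rewrite (_ : st [::] == sone).
Qed.

Lemma mr_mu_oner a x : mr_mu a sone x = (a == x)%:R.
Proof.
case: (eqVneq a x) => [->|ax].
  rewrite /mr_mu take_size drop_size st_id eqxx (_ : st [::] == sone) // mul1r.
  by rewrite /cross big1.
have [sx|] := eqVneq (sdeg x) (sdeg a + sdeg sone)%N; last exact: mr_mu_deg.
rewrite /mr_mu take_oversize ?st_id; last by move: sx; rewrite /sdeg addn0 => ->.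
by rewrite eq_sym (negbTE ax) mul0r.
Qed.

Lemma mr_de_onel a x : mr_de sone a x = (a == x)%:R.
Proof.
rewrite /mr_de /= /small /large.
have x0 i : i \in sword x -> (0 < i)%N by rewrite sperm_mem => /andP[].
rewrite (eq_in_filter (a2 := pred0)) ?filter_pred0; last first.
  by move=> i /x0; rewrite /= ltnNge => /negbTE.
rewrite (eq_in_filter (a2 := predT)) ?filter_predT //.
by rewrite (eq_map subn0) map_id /= (inj_eq val_inj) eq_sym.
Qed.

Lemma mr_de_oner a x : mr_de a sone x = (a == x)%:R.
Proof.
have smallx : small (size x) x = x.
  by apply/all_filterP/allP => i; rewrite sperm_mem => /andP[].
case: (eqVneq a x) => [->|ax].
  rewrite /mr_de smallx eqxx -size_eq0 -(eqn_add2l (size (small (size x) x))).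
  by rewrite size_small_large smallx addn0 eqxx.
have [sx|] := eqVneq (sdeg x) (sdeg a + sdeg sone)%N; last exact: mr_de_deg.
rewrite /mr_de; move: sx; rewrite /sdeg addn0 => <-; rewrite smallx.
by rewrite (inj_eq val_inj) eq_sym (negbTE ax).
Qed.

(** Each side has at most one nonzero term: on the left, [y] is the
    standardization of the prefix of [x] of length |a| + |b|, and on the right that
    of the suffix following the first |a| letters. *)
Lemma mr_mu_assoc n a b c x : (sdeg x <= n)%N ->
  \sum_(y <- sperms n) mr_mu a b y * mr_mu y c x
  = \sum_(y <- sperms n) mr_mu b c y * mr_mu a y x.
Proof.
move=> xn; have Ux := sperm_uniq x.
pose y0 := st (take (size a + size b) x); pose y1 := st (drop (size a) x).
have y0n : y0 \in sperms n.
  rewrite (mem_upto sperm_index) /sdeg size_st; apply: leq_trans xn.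
  by rewrite size_take_min geq_minr.
have y1n : y1 \in sperms n.
  rewrite (mem_upto sperm_index) /sdeg size_st; apply: leq_trans xn.
  by rewrite size_drop leq_subr.
transitivity (mr_mu a b y0 * mr_mu y0 c x).
  rewrite (eq_bigr (fun y => (y0 == y)%:R * (mr_mu a b y * mr_mu y c x))).
    by rewrite (sum_deltal _ _ (upto_uniq sperm_index n)) y0n.
  move=> y _; case: (eqVneq y0 y) => [<-|y0y]; first by rewrite mul1r.
  have [sy|/mr_mu_deg ->] := eqVneq (sdeg y) (sdeg a + sdeg b)%N; last by rewrite !mul0r.
  rewrite /(mr_mu y c x) [size y]sy -/y0 (negbTE y0y) /= !mul0r mulr0.
  by [].
transitivity (mr_mu b c y1 * mr_mu a y1 x); last first.
  rewrite [RHS](eq_bigr (fun y => (y1 == y)%:R * (mr_mu b c y * mr_mu a y x))).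
    by rewrite (sum_deltal _ _ (upto_uniq sperm_index n)) y1n.
  move=> y _; case: (eqVneq y1 y) => [<-|y1y]; first by rewrite mul1r.
  by rewrite /(mr_mu a y x) -/y1 (negbTE y1y) andbF !mul0r mulr0.
have sy0 : sdeg y0 = (sdeg a + sdeg b)%N \/ mr_mu a b y0 = 0.
  by case: (eqVneq (sdeg y0) (sdeg a + sdeg b)%N); [left|right; apply: mr_mu_deg].
have sy1 : sdeg y1 = (sdeg b + sdeg c)%N \/ mr_mu b c y1 = 0.
  by case: (eqVneq (sdeg y1) (sdeg b + sdeg c)%N); [left|right; apply: mr_mu_deg].
have [sx|sx] := eqVneq (sdeg x) (sdeg a + sdeg b + sdeg c)%N; last first.
  transitivity (0 : k); last case: sy1 => [sy|->]; first case: sy0 => [sy|->].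
  - by rewrite (mr_mu_deg (a := y0)) ?mulr0 // sy.
  - by rewrite mul0r.
  - by rewrite (mr_mu_deg (b := y1)) ?mulr0 // sy addnA.
  - by rewrite mul0r.
pose u := take (size a) x; pose v := take (size b) (drop (size a) x).
pose w := drop (size a + size b) x.
have su : size u = size a by rewrite size_take_min; apply/minn_idPl; move: sx; rewrite /sdeg; lia.
have sv : size v = size b.
  by rewrite size_take_min size_drop; apply/minn_idPl; move: sx; rewrite /sdeg; lia.
have Euv : take (size a + size b) x = u ++ v by rewrite takeD.
have Evw : drop (size a) x = v ++ w.
  by rewrite -[LHS](cat_take_drop (size b)) drop_drop addnC.
have Uuv : uniq (u ++ v) by rewrite -Euv take_uniq.
have Uvw : uniq (v ++ w) by rewrite -Evw drop_uniq.
have sy0E : size y0 = (size a + size b)%N by rewrite size_st Euv size_cat su sv.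
rewrite /mr_mu sy0E -/y0 -/y1 !eqxx -/u -/w andbT.
rewrite !st_take ?st_drop ?cross_st ?take_uniq ?drop_uniq // Euv Evw.
rewrite -!su -!sv !take_size_cat // !drop_size_cat //.
rewrite cross_catl cross_catr !exprD; case: (st u == a); case: (st v == b); case: (st w == c).
all: by rewrite /= ?mulr1n ?mulr0n; ring.
Qed.

Lemma mr_de_assoc n a b c x : (sdeg x <= n)%N ->
  \sum_(y <- sperms n) mr_de a b y * mr_de y c x
  = \sum_(y <- sperms n) mr_de b c y * mr_de a y x.
Proof.
move=> xn.
have [sx|sx] := eqVneq (sdeg x) (sdeg a + sdeg b + sdeg c)%N; last first.
  rewrite !big1 // => y _.
    have [sy|/mr_de_deg ->] := eqVneq (sdeg y) (sdeg b + sdeg c)%N; last by rewrite mul0r.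
    by rewrite (mr_de_deg (b := y)) ?mulr0 // sy addnA.
  have [sy|/mr_de_deg ->] := eqVneq (sdeg y) (sdeg a + sdeg b)%N; last by rewrite mul0r.
  by rewrite (mr_de_deg (a := y)) ?mulr0 // sy.
have ab_x : (size a + size b <= size x)%N by move: sx; rewrite /sdeg => ->; apply: leq_addr.
have a_x : (size a <= size x)%N := leq_trans (leq_addr _ _) ab_x.
pose y0 := SPerm (small_perm_word (valP x) ab_x).
pose y1 := SPerm (large_perm_word (valP x) a_x).
have sy0 : size y0 = (size a + size b)%N by rewrite /= size_small //; apply: (valP x).
have sy1 : size y1 = (size b + size c)%N.
  by rewrite /= size_large //; [move: sx; rewrite /sdeg; lia|apply: (valP x)].
have y0n : y0 \in sperms n.
  by rewrite (mem_upto sperm_index) /sdeg sy0; apply: leq_trans xn.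
have y1n : y1 \in sperms n.
  rewrite (mem_upto sperm_index) /sdeg sy1; apply: leq_trans xn.
  by move: sx; rewrite /sdeg; lia.
transitivity (mr_de a b y0 * mr_de y0 c x).
  rewrite (eq_bigr (fun y => (y0 == y)%:R * (mr_de a b y * mr_de y c x))).
    by rewrite (sum_deltal _ _ (upto_uniq sperm_index n)) y0n.
  move=> y _; case: (eqVneq y0 y) => [<-|y0y]; first by rewrite mul1r.
  have [sy|/mr_de_deg ->] := eqVneq (sdeg y) (sdeg a + sdeg b)%N; last by rewrite !mul0r.
  rewrite /(mr_de y c x) [size y]sy -[small _ _]/(val y0).
  by rewrite (inj_eq val_inj) (negbTE y0y) mul0r mulr0.
transitivity (mr_de b c y1 * mr_de a y1 x); last first.
  rewrite [RHS](eq_bigr (fun y => (y1 == y)%:R * (mr_de b c y * mr_de a y x))).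
    by rewrite (sum_deltal _ _ (upto_uniq sperm_index n)) y1n.
  move=> y _; case: (eqVneq y1 y) => [<-|y1y]; first by rewrite mul1r.
  rewrite /(mr_de a y x) -[large _ _]/(val y1).
  by rewrite (inj_eq val_inj) (negbTE y1y) andbF mul0r mulr0.
rewrite /mr_de sy0 /y0 /y1 /= !eqxx andbT -!natrM !mulnb.
have small_small : small (size a) (small (size a + size b) x) = small (size a) x.
  by rewrite /small -filter_predI; apply: eq_filter => i /=; lia.
have large_small : large (size a) (small (size a + size b) x) =
    small (size b) (large (size a) x).
  rewrite /large /small filter_map -!filter_predI; congr map.
  by apply: eq_filter => i /=; lia.
have large_large : large (size b) (large (size a) x) = large (size a + size b) x.
  rewrite /large filter_map -map_comp -filter_predI.
  rewrite (@eq_filter _ _ (fun i => (size a + size b < i)%N)); last by move=> i /=; lia.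
  by apply: eq_map => i /=; lia.
by rewrite small_small large_small large_large; congr (_%:R); do 3!case: (_ == _).
Qed.

End Constants.

(** ** Compatibility of the product with the coproduct *)

Section Compatibility.
Implicit Types a b c d : sperm.

(** No inversion is formed by a small letter followed by a large one. *)
Lemma cross_split i (u v : seq nat) : cross u v =
  (size (large i u) * size (small i v) + cross (small i u) (small i v)
   + cross (large i u) (large i v))%N.
Proof.
elim: u => [|x u IH]; first by rewrite /cross !big_nil.
rewrite -cat1s cross_catl IH small_cat large_cat size_cat !cross_catl mulnDl.
suff -> : cross [:: x] v = (size (large i [:: x]) * size (small i v)
    + cross (small i [:: x]) (small i v) + cross (large i [:: x]) (large i v))%N by lia.
rewrite /cross /small /large /= big_seq1; case: leqP => xi /=.
  rewrite big_seq1 big_nil mul0n addn0 add0n count_filter.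
  by apply: eq_count => y /=; lia.
rewrite big_seq1 big_nil mul1n addn0 count_map count_filter size_filter.
rewrite -count_predUI (@eq_count _ (predI _ _) pred0).
  by rewrite count_pred0 addn0; apply: eq_count => y /=; lia.
by move=> y /=; lia.
Qed.

(** The terms of the product of [a] and [b] whose coproduct contains
    [c ⊗ d] are sorted by the numbers [j] and [l] of letters coming from
    [c] in the parts coming from [a] and from [b]. *)
Section Split.
Variables (a b c d : sperm) (j l : nat).
Let i := size c.

Definition shuffle_split (x : sperm) : bool :=
  [&& st (take (size a) x) == a, st (drop (size a) x) == b,
      small i x == c :> seq nat, large i x == d :> seq nat,
      count (fun y => y <= i)%N (take (size a) x) == j
    & count (fun y => y <= i)%N (drop (size a) x) == l].

(** The four blocks of a permutation satisfying [shuffle_split], standardized: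
    each is seen once in [a] or [b] and once in [c] or [d]. *)
Definition matching_split : bool :=
  [&& st (take j c) == st (small j a), st (drop j c) == st (small l b),
      st (take (size a - j) d) == st (large j a)
    & st (drop (size a - j) d) == st (large l b)].

Section Given.
Variable x : sperm.
Hypothesis xP : shuffle_split x.
Let u := take (size a) x.
Let v := drop (size a) x.

Let Uu : uniq u. Proof. exact/take_uniq/sperm_uniq. Qed.
Let Uv : uniq v. Proof. exact/drop_uniq/sperm_uniq. Qed.
Let Eu : st u = a. Proof. by have /and5P[/eqP] := xP. Qed.
Let Ev : st v = b. Proof. by have /and5P[_ /eqP] := xP. Qed.
Let Euv : sword x = u ++ v. Proof. by rewrite cat_take_drop. Qed.
Let Ec : small i u ++ small i v = c.
Proof. by rewrite -small_cat -Euv; have /and5P[_ _ /eqP] := xP. Qed.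
Let Ed : large i u ++ large i v = d.
Proof. by rewrite -large_cat -Euv; have /and5P[_ _ _ /eqP] := xP. Qed.
Let Ej : count (fun y => y <= i)%N u = j.
Proof. by have /and5P[_ _ _ _ /andP[/eqP]] := xP. Qed.
Let El : count (fun y => y <= i)%N v = l.
Proof. by have /and5P[_ _ _ _ /andP[_ /eqP]] := xP. Qed.
Let sj : size (small i u) = j. Proof. by rewrite size_filter. Qed.
Let slu : size (large i u) = (size a - j)%N.
Proof. by rewrite -(addKn j (size _)) -{1}sj size_small_large -size_st Eu. Qed.

Lemma split_parts : [/\ take j c = small i u, drop j c = small i v,
  take (size a - j) d = large i u & drop (size a - j) d = large i v].
Proof.
split; first by rewrite -Ec -sj take_size_cat.
- by rewrite -Ec -sj drop_size_cat.
- by rewrite -Ed -slu take_size_cat.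
- by rewrite -Ed -slu drop_size_cat.
Qed.

Lemma split_matching : matching_split.
Proof.
have [E1 E2 E3 E4] := split_parts; rewrite /matching_split E1 E2 E3 E4.
rewrite -{1}Ej -{1}El -Eu -Ev !small_st // !st_id !eqxx /=.
by rewrite -Ej -El !large_st // !st_id !st_large // !eqxx.
Qed.

(** The product [(size a - j) * l] counts the inversions formed by the large
    letters of the first half and the small letters of the second: this is the
    twist in the product of the tensor square. *)
Lemma split_weight : cross u v = ((size a - j) * l + cross (take j c) (drop j c)
  + cross (take (size a - j) d) (drop (size a - j) d))%N.
Proof.
have [-> -> -> ->] := split_parts; rewrite (cross_split i) slu.
by rewrite size_filter El.
Qed.

Lemma split_mask :
  [seq (y <= i)%N | y <- x] = [seq (y <= j)%N | y <- a] ++ [seq (y <= l)%N | y <- b].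
Proof. by rewrite Euv map_cat -Eu -Ev -Ej -El !map_small_st. Qed.

End Given.

Lemma large_filter (w w' : seq nat) h : large h w = large h w' ->
  filter (predC (fun y => y <= h)%N) w = filter (predC (fun y => y <= h)%N) w'.
Proof.
have E (w1 : seq nat) : filter (predC (fun y => y <= h)%N) w1 = [seq y <- w1 | (h < y)%N].
  by apply: eq_filter => y /=; rewrite -ltnNge.
by rewrite !E -!addn_large => ->.
Qed.

(** The mask of the small letters of [x] is read off [a] and [b], and its subwords
    of small and of large letters off [c] and [d]. *)
Lemma split_inj (x y : sperm) : shuffle_split x -> shuffle_split y -> x = y.
Proof.
move=> xP yP; apply: val_inj; apply: (@fill_inj (fun z => z <= i)%N) => /=.
- by rewrite (split_mask xP) (split_mask yP).
- case/and5P: xP yP => _ _ /eqP Ex _ _ /and5P[_ _ /eqP Ey _ _].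
  by rewrite -[LHS]/(small i x) Ex -Ey.
- apply: large_filter; case/and5P: xP yP => _ _ _ /eqP -> _ /and5P[_ _ _ /eqP -> _].
  by [].
Qed.

Hypotheses (ja : (j <= size a)%N) (lb : (l <= size b)%N).

Lemma split_exists : matching_split -> exists x, shuffle_split x.
Proof.
move=> /and4P[/eqP c1 /eqP c2 /eqP d1 /eqP d2].
have pa : perm_word a := valP a; have pb : perm_word b := valP b.
have s1 : size (take j c) = j.
  by have := congr1 (fun y => size (sword y)) c1; rewrite !size_st size_small.
have s2 : size (drop j c) = l.
  by have := congr1 (fun y => size (sword y)) c2; rewrite !size_st size_small.
have s3 : size (take (size a - j) d) = (size a - j)%N.
  by have := congr1 (fun y => size (sword y)) d1; rewrite !size_st size_large.
have s4 : size (drop (size a - j) d) = (size b - l)%N.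
  by have := congr1 (fun y => size (sword y)) d2; rewrite !size_st size_large.
(* One half of the word: [w] is [a] or [b], and [s], [t] are the parts of
   [c], [d] whose letters go to the small and to the large letters of [w]. *)
have half (w : sperm) h (s t : seq nat) : (h <= size w)%N ->
    size s = h -> size t = (size w - h)%N -> uniq s -> uniq t -> {subset s <= sword c} ->
    {subset t <= sword d} -> st s = st (small h w) -> st t = st (large h w) ->
    let z := fill [seq (y <= h)%N | y <- w] s [seq (y + i)%N | y <- t] in
    [/\ perm_eq z (s ++ [seq (y + i)%N | y <- t]), small i z = s, large i z = t,
        count (fun y => y <= i)%N z = h & uniq z -> st z = w].
  move=> hw ss stt Us Ut sc td Es Et z.
  have pw : perm_word w := valP w.
  have Em : count id [seq (y <= h)%N | y <- w] = size s.
    by rewrite count_map ss -[RHS](size_small pw hw) size_filter.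
  have Em' : count negb [seq (y <= h)%N | y <- w] = size [seq (y + i)%N | y <- t].
    rewrite size_map stt -[RHS](size_large pw hw) size_map size_filter count_map.
    by apply: eq_count => y /=; rewrite -ltnNge.
  have sall : all (fun y => y <= i)%N s.
    by apply/allP => y /sc; rewrite sperm_mem => /andP[].
  have tall : all (predC (fun y => y <= i)%N) [seq (y + i)%N | y <- t].
    by apply/allP => _ /mapP[y /td + ->]; rewrite sperm_mem /=; lia.
  have [z1 z2 z3] := fill_spec Em Em' sall tall; rewrite -/z in z1 z2 z3.
  have lz : large i z = t.
    have -> : large i z = [seq (y - i)%N | y <- filter (predC (fun y => y <= i)%N) z].
      by congr map; apply: eq_filter => y /=; rewrite -ltnNge.
    by rewrite z3 -map_comp -[RHS]map_id; apply: eq_map => y /=; rewrite addnK.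
  have cz : count (fun y => y <= i)%N z = h by rewrite -size_filter z2.
  split=> // [|Uz]; first exact: fill_perm Em Em' sall tall.
  apply: val_inj; apply: (@fill_inj (fun y => y <= h)%N).
  - by rewrite -[in LHS]cz map_small_st.
  - rewrite -[LHS]/(small h (st z)) -{1}cz small_st // (z2 : small i z = s) Es.
    by rewrite /= st_word_id //; apply: small_perm_word.
  - apply: large_filter; rewrite -[in LHS]cz large_st // -st_large // lz Et.
    by rewrite /= st_word_id //; apply: large_perm_word.
have sub1 : {subset take j c <= sword c} by move=> y /mem_take.
have sub2 : {subset drop j c <= sword c} by move=> y /mem_drop.
have sub3 : {subset take (size a - j) d <= sword d} by move=> y /mem_take.
have sub4 : {subset drop (size a - j) d <= sword d} by move=> y /mem_drop.
have U1 := take_uniq j (sperm_uniq c); have U2 := drop_uniq j (sperm_uniq c).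
have U3 := take_uniq (size a - j) (sperm_uniq d).
have U4 := drop_uniq (size a - j) (sperm_uniq d).
have [pu su lu cu stu] := half a j _ _ ja s1 s3 U1 U3 sub1 sub3 c1 d1.
have [pv sv lv cv stv] := half b l _ _ lb s2 s4 U2 U4 sub2 sub4 c2 d2.
move: pu su lu cu stu pv sv lv cv stv; set u := fill _ _ _; set v := fill _ _ _.
move=> pu su lu cu stu pv sv lv cv stv.
have puv : perm_eq (u ++ v) (c ++ [seq (y + i)%N | y <- d]).
  rewrite -[sword c](cat_take_drop j) -[sword d](cat_take_drop (size a - j)) map_cat.
  by rewrite (perm_trans (perm_cat pu pv)) // -!catA perm_cat2l perm_catCA.
have pc : perm_eq c (iota 1 i) := valP c.
have pd : perm_eq d (iota 1 (size d)) := valP d.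
have pw : perm_word (u ++ v).
  apply: (@perm_iota_word _ (i + size d)%N); rewrite (perm_trans puv) // iotaD.
  rewrite perm_cat // (perm_trans (perm_map _ pd)) // addnC iotaDl.
  by rewrite (eq_map (addnC ^~ _)) perm_refl.
have := perm_word_uniq pw; rewrite cat_uniq => /and3P[Uu _ Uv].
have szu : size u = size a by rewrite -(size_st u) stu.
exists (SPerm pw); rewrite /shuffle_split /= take_size_cat // drop_size_cat //.
rewrite small_cat large_cat su sv lu lv !cat_take_drop cu cv !eqxx !andbT.
by rewrite stu // stv // !eqxx.
Qed.

End Split.

End Compatibility.

Section MRConstants.
Variables (k : comNzRingType) (q : k).
Implicit Types a b c d x : sperm.
Notation mu := (mr_mu q).
Notation de := (mr_de k).

(** Only the index [size a] contributes to the sum. *)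
Lemma size_split (F G : nat -> sperm) (W : nat -> k) m a b :
    (forall j, (j <= m)%N -> size (F j) = j) -> (size a <= m)%N ->
  ((F (size a) == a) && (G (size a) == b))%:R * W (size a)
  = \sum_(j < m.+1) (F j == a)%:R * ((G j == b)%:R * W j).
Proof.
move=> sF am; have aP : (size a < m.+1)%N by [].
rewrite (bigD1 (Ordinal aP)) //= big1 ?addr0 => [|j ja].
  by rewrite mulrA -natrM mulnb.
case: eqP => [Ea|]; rewrite ?mul0r //; case/eqP: ja; apply: val_inj => /=.
by rewrite -Ea sF // -ltnS.
Qed.

Lemma sum_split (V : lmodType k) (F G : nat -> sperm) (W : nat -> k) m n
    (c : sperm -> sperm -> k) (H : sperm -> sperm -> V) :
    (forall j, (j <= m)%N -> size (F j) = j) ->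
    (forall j, (j <= m)%N -> (size (G j) <= m)%N) ->
    (forall a b, c a b = ((F (size a) == a) && (G (size a) == b))%:R * W (size a)) ->
    (forall a b, (m < size a)%N -> c a b = 0) -> (m <= n)%N ->
  \sum_(a <- sperms n) \sum_(b <- sperms n) c a b *: H a b
  = \sum_(j < m.+1) W j *: H (F j) (G j).
Proof.
move=> sF sG cE c0 mn.
transitivity (\sum_(a <- sperms n) \sum_(b <- sperms n) \sum_(j < m.+1)
    (F j == a)%:R *: ((G j == b)%:R *: (W j *: H a b))).
  apply: eq_bigr => a _; apply: eq_bigr => b _; have [am|am] := leqP (size a) m.
    rewrite cE (size_split _ _ _ sF am) scaler_suml.
    by apply: eq_bigr => j _; rewrite !scalerA mulrA.
  rewrite c0 // scale0r big1 // => j _; case: eqP => [Ea|]; last by rewrite scale0r.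
  by have := sF j; rewrite Ea -ltnS ltn_ord => /(_ isT); have := ltn_ord j; lia.
transitivity (\sum_(j < m.+1) \sum_(a <- sperms n) \sum_(b <- sperms n)
    (F j == a)%:R *: ((G j == b)%:R *: (W j *: H a b))).
  rewrite [RHS]exchange_big; apply: eq_bigr => a _.
  by rewrite [RHS]exchange_big.
apply: eq_bigr => j _; under eq_bigr do rewrite -scaler_sumr.
have jm : (j <= m)%N by rewrite -ltnS.
rewrite (sumZ_deltal _ _ (upto_uniq sperm_index n)) (mem_upto sperm_index) /sdeg sF //.
rewrite (leq_trans jm mn) (sumZ_deltal _ _ (upto_uniq sperm_index n)).
by rewrite (mem_upto sperm_index) /sdeg (leq_trans (sG _ jm) mn).
Qed.

Lemma sum_mr_de (V : lmodType k) n a (H : sperm -> sperm -> V) : (size a <= n)%N ->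
  \sum_(a1 <- sperms n) \sum_(a2 <- sperms n) de a1 a2 a *: H a1 a2
  = \sum_(j < (size a).+1) H (st (small j a)) (st (large j a)).
Proof.
move=> an; have pa : perm_word a := valP a.
rewrite (@sum_split _ (fun j => st (small j a)) (fun j => st (large j a)) (fun=> 1) (size a)) //.
- by apply: eq_bigr => j _; rewrite scale1r.
- by move=> j ja; rewrite size_st size_small.
- by move=> j ja; rewrite size_st size_large // leq_subr.
- move=> a1 a2; rewrite mulr1; have [a1a|a1a] := leqP (size a1) (size a).
    rewrite /mr_de -!(inj_eq val_inj) /=.
    by rewrite (st_word_id (small_perm_word pa a1a)) (st_word_id (large_perm_word pa a1a)).
  rewrite mr_de_deg; last by rewrite /sdeg; lia.
  case: eqP => // Ea1; suff : (size a1 <= size a)%N by lia.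
  by rewrite -Ea1 size_st size_filter count_size.
by move=> a1 a2 a1a; rewrite mr_de_deg // /sdeg; lia.
Qed.

Lemma sum_mr_mu (V : lmodType k) n x (H : sperm -> sperm -> V) : (size x <= n)%N ->
  \sum_(a <- sperms n) \sum_(b <- sperms n) mu a b x *: H a b
  = \sum_(j < (size x).+1) q ^+ cross (take j x) (drop j x)
      *: H (st (take j x)) (st (drop j x)).
Proof.
move=> xn; apply: (@sum_split _ (fun j => st (take j x)) (fun j => st (drop j x))
  (fun j => q ^+ cross (take j x) (drop j x)) (size x)) => //.
- by move=> j jx; rewrite size_st size_takel.
- by move=> j jx; rewrite size_st size_drop leq_subr.
- by move=> a b ax; rewrite mr_mu_deg // /sdeg; lia.
Qed.

Lemma mr_mu_de_shuffle a b c d x :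
  mu a b x * de c d x =
  \sum_(j < (size a).+1) \sum_(l < (size b).+1)
    (shuffle_split a b c d j l x)%:R * q ^+ cross (take (size a) x) (drop (size a) x).
Proof.
rewrite /mr_mu /mr_de.
set A := st (take _ _) == a; set B := st (drop _ _) == b.
have [AB|nAB] := boolP (A && B); last first.
  rewrite mul0r mul0r big1 // => j _; rewrite big1 // => l _.
  by rewrite /shuffle_split -/A -/B andbA (negbTE nAB) mul0r.
have [/eqP Ea /eqP Eb] := andP AB.
have ja : (count (fun y => y <= size c)%N (take (size a) x) < (size a).+1)%N.
  by rewrite ltnS -{2}Ea size_st count_size.
have lb : (count (fun y => y <= size c)%N (drop (size a) x) < (size b).+1)%N.
  by rewrite ltnS -Eb size_st count_size.
rewrite (bigD1 (Ordinal ja)) //= [X in _ + X]big1 ?addr0; last first.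
  move=> j jP; rewrite big1 // => l _; rewrite /shuffle_split.
  case: (_ =P nat_of_ord j) => [Ej|]; last by rewrite !andbF mul0r.
  by case/eqP: jP; apply: val_inj; rewrite /= Ej.
rewrite (bigD1 (Ordinal lb)) //= big1 ?addr0; last first.
  move=> l lP; rewrite /shuffle_split.
  case: (_ =P nat_of_ord l) => [El|]; last by rewrite !andbF mul0r.
  by case/eqP: lP; apply: val_inj; rewrite /= El.
rewrite /shuffle_split -/A -/B !eqxx !andbT; case/andP: AB => -> -> /=.
by rewrite mul1r mulrC.
Qed.

Lemma sum_shuffle_split n a b c d (j : 'I_(size a).+1) (l : 'I_(size b).+1) :
    (size a + size b <= n)%N ->
  \sum_(x <- sperms n)
    (shuffle_split a b c d j l x)%:R * q ^+ cross (take (size a) x) (drop (size a) x)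
  = q ^+ ((size a - j) * l) * (mu (st (small j a)) (st (small l b)) c
                             * mu (st (large j a)) (st (large l b)) d).
Proof.
move=> abn; have ja : (j <= size a)%N by rewrite -ltnS.
have lb : (l <= size b)%N by rewrite -ltnS.
have -> : mu (st (small j a)) (st (small l b)) c
        * mu (st (large j a)) (st (large l b)) d
  = (matching_split a b c d j l)%:R * q ^+ (cross (take j c) (drop j c)
      + cross (take (size a - j) d) (drop (size a - j) d)).
  rewrite /mr_mu !size_st (size_small (valP a) ja) (size_large (valP a) ja).
  rewrite exprD mulrACA -natrM mulnb; congr (_%:R * _).
  by rewrite /matching_split !andbA.
have [ms|nms] := boolP (matching_split a b c d j l); last first.
  rewrite mul0r mulr0 big1 // => x _; case: (boolP (shuffle_split _ _ _ _ _ _ x)).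
    by move/split_matching; rewrite (negbTE nms).
  by rewrite mul0r.
have [x xP] := split_exists ja lb ms.
rewrite mul1r -exprD addnA -(split_weight xP).
rewrite (eq_bigr (fun y : sperm => (x == y)%:R
          * q ^+ cross (take (size a) y) (drop (size a) y))) => [|y _].
  rewrite (sum_deltal _ _ (upto_uniq sperm_index n)) (mem_upto sperm_index).
  case/and5P: xP => /eqP Ea /eqP Eb _ _ _.
  by rewrite /sdeg (mr_mu_size Ea Eb) abn.
congr (_%:R * _); case: (eqVneq x y) => [<-|xy]; first by rewrite xP.
by case: (boolP (shuffle_split _ _ _ _ _ _ _)) => // yP; case/eqP: xy; apply: split_inj xP yP.
Qed.

(** Both sides are sums over [j] and [l] of at most one term: on the left the
    permutation with these parameters, on the right its four blocks. *)
Lemma mr_compat n a b c d :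
    (sdeg a + sdeg b <= n)%N || (sdeg c + sdeg d <= n)%N ->
  \sum_(x <- sperms n) mu a b x * de c d x =
  \sum_(a1 <- sperms n) \sum_(a2 <- sperms n) \sum_(b1 <- sperms n) \sum_(b2 <- sperms n)
    q ^+ (sdeg a2 * sdeg b1) *
    (de a1 a2 a * de b1 b2 b * (mu a1 b1 c * mu a2 b2 d)).
Proof.
move=> abcd; have [sz|sz] := eqVneq (sdeg a + sdeg b)%N (sdeg c + sdeg d)%N; last first.
  rewrite big1 => [|x _]; last first.
    have [sx|/mr_mu_deg ->] := eqVneq (sdeg x) (sdeg a + sdeg b)%N; last by rewrite mul0r.
    by rewrite (@mr_de_deg k c) ?mulr0 // sx.
  apply/esym/big1 => a1 _; apply: big1 => a2 _; apply: big1 => b1 _; apply: big1 => b2 _.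
  have [sa|/mr_de_deg ->] := eqVneq (sdeg a) (sdeg a1 + sdeg a2)%N; last by rewrite !mul0r mulr0.
  have [sb|/mr_de_deg ->] := eqVneq (sdeg b) (sdeg b1 + sdeg b2)%N; last by rewrite mulr0 mul0r mulr0.
  have [sc|/mr_mu_deg ->] := eqVneq (sdeg c) (sdeg a1 + sdeg b1)%N; last by rewrite mul0r !mulr0.
  rewrite (@mr_mu_deg k q a2) ?mulr0 //; apply: contra sz => /eqP ->.
  by rewrite sa sb sc addnACA.
have {abcd} abn : (sdeg a + sdeg b <= n)%N by move: abcd; rewrite sz orbb.
have an : (size a <= n)%N := leq_trans (leq_addr _ _) abn.
have bn : (size b <= n)%N := leq_trans (leq_addl _ _) abn.
transitivity (\sum_(j < (size a).+1) \sum_(l < (size b).+1)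
    q ^+ ((size a - j) * l) * (mu (st (small j a)) (st (small l b)) c
                             * mu (st (large j a)) (st (large l b)) d)).
  under eq_bigr do rewrite mr_mu_de_shuffle.
  rewrite exchange_big; apply: eq_bigr => j _.
  by rewrite exchange_big; apply: eq_bigr => l _; rewrite sum_shuffle_split.
transitivity (\sum_(j < (size a).+1) \sum_(b1 <- sperms n) \sum_(b2 <- sperms n)
   de b1 b2 b * (q ^+ (sdeg (st (large j a)) * sdeg b1) *
     (mu (st (small j a)) b1 c * mu (st (large j a)) b2 d))).
  apply: eq_bigr => j _; rewrite (@sum_mr_de k^o) //; apply: eq_bigr => l _.
  have ja : (j <= size a)%N by rewrite -ltnS.
  have lb : (l <= size b)%N by rewrite -ltnS.
  by rewrite /sdeg !size_st (size_small (valP b) lb) (size_large (valP a) ja).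
rewrite -(@sum_mr_de k^o n a (fun a1 a2 => \sum_(b1 <- sperms n) \sum_(b2 <- sperms n)
   de b1 b2 b * (q ^+ (sdeg a2 * sdeg b1) * (mu a1 b1 c * mu a2 b2 d)))) //.
apply: eq_bigr => a1 _; apply: eq_bigr => a2 _; rewrite scaler_sumr.
apply: eq_bigr => b1 _; rewrite scaler_sumr; apply: eq_bigr => b2 _.
by rewrite /GRing.scale /=; ring.
Qed.

Lemma mr_constants : qhopf_constants q sdeg sperms sone mu de.
Proof.
split.
- exact: mr_mu_deg.
- exact: mr_de_deg.
- exact: mr_mu_onel.
- exact: mr_mu_oner.
- exact: mr_de_onel.
- exact: mr_de_oner.
- by move=> n a b c x; apply: mr_mu_assoc.
- by move=> n a b c x; apply: mr_de_assoc.
- exact: mr_compat.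
Qed.

End MRConstants.

(** * Knuth classes of permutations *)

Section KnuthClasses.
Implicit Types a b x y : sperm.

Definition knuth_repr x : sperm := choose (fun y => knuth x y) x.

Lemma knuth_reprP x : knuth x (knuth_repr x).
Proof. exact: (@chooseP _ (fun y => knuth x y) x (eqxx _)). Qed.

Lemma knuth_repr_eq x y : (knuth_repr x == knuth_repr y) = knuth x y.
Proof.
apply/eqP/idP => [xy|/eqP xy].
  by rewrite /knuth (eqP (knuth_reprP x)) xy eq_sym; apply: knuth_reprP.
transitivity (choose (fun z : sperm => knuth y z) x).
  by apply: eq_choose => z; rewrite /knuth xy.
by apply: choose_id; rewrite /knuth ?xy ?eqxx.
Qed.

Lemma knuth_repr_idem x : knuth_repr (knuth_repr x) == knuth_repr x.
Proof. by rewrite knuth_repr_eq /knuth eq_sym; apply: knuth_reprP. Qed.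

(** A class is encoded by its chosen element; the classes correspond to the
    standard tableaux. *)
Definition kclass : choiceType := {x : sperm | knuth_repr x == x}.

Definition kcl x : kclass := exist _ (knuth_repr x) (knuth_repr_idem x).

Lemma kclK : cancel (@sval sperm _ : kclass -> sperm) kcl.
Proof. by move=> X; apply: val_inj; apply/eqP: (valP X). Qed.

Lemma kcl_eq x y : (kcl x == kcl y) = knuth x y.
Proof. by rewrite -(inj_eq val_inj) knuth_repr_eq. Qed.

Lemma knuth_size x y : knuth x y -> size x = size y.
Proof. by move=> /knuthP /plactic_perm /perm_size. Qed.

Definition kdeg (X : kclass) : nat := sdeg (sval X).

Lemma kdeg_kcl x : kdeg (kcl x) = sdeg x.
Proof. exact/esym/knuth_size/knuth_reprP. Qed.

Definition kclasses n : seq kclass := pmap insub (sperms n).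

Definition kone : kclass := kcl sone.

Lemma kclass_index : graded_index kdeg kclasses kone.
Proof.
split=> [n|n X|X].
- exact: (@pmap_sub_uniq _ _ kclass _ (upto_uniq sperm_index n)).
- by rewrite (@mem_pmap_sub _ _ kclass) (mem_upto sperm_index).
rewrite /kdeg (index_deg0 sperm_index); apply/eqP/eqP => [X1|->].
  by rewrite -[X]kclK X1.
by apply/eqP; rewrite -(index_deg0 sperm_index) -/(kdeg _) kdeg_kcl.
Qed.

Notation kfiber := (fiber sperms kdeg kcl).

Lemma mem_kfiber x X : (x \in kfiber X) = (kcl x == X).
Proof. exact: (mem_fiber sperm_index kdeg_kcl). Qed.

Lemma kfiber_uniq X : uniq (kfiber X).
Proof. exact: (fiber_uniq kdeg sperm_index kcl X). Qed.

(** Congruent words have the same letters, hence are standardized by the same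
    increasing map. *)
Lemma plactic_st (u v : seq nat) : uniq u -> plactic u v -> plactic (st u) (st v).
Proof.
move=> Uu uv; have puv := plactic_perm uv.
rewrite /= !st_wordE -?(perm_uniq puv) //.
rewrite (@eq_map _ _ (rank v) (rank u)); last first.
  by move=> i; rewrite /rank; congr _.+1; apply/esym/permP.
by apply: plactic_map uv; apply: rank_mono.
Qed.

Lemma knuth_small j x y : knuth x y -> kcl (st (small j x)) = kcl (st (small j y)).
Proof.
move=> /knuthP xy; apply/eqP; rewrite kcl_eq; apply/knuthP; apply: plactic_st.
  exact/filter_uniq/sperm_uniq.
by apply: plactic_filter xy => i1 i2 i3; lia.
Qed.

Lemma knuth_large j x y : knuth x y -> kcl (st (large j x)) = kcl (st (large j y)).
Proof.
move=> /knuthP xy; apply/eqP; rewrite kcl_eq; apply/knuthP.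
rewrite !st_large ?sperm_uniq //; apply: plactic_st.
  exact/filter_uniq/sperm_uniq.
by apply: plactic_filter xy => i1 i2 i3; lia.
Qed.

Section Lumpable.
Variables (k : comNzRingType) (q : k).

(** The restrictions of a word to its small and to its large letters are
    compatible with the plactic congruence, since both sets of letters are
    convex: hence Knuth classes span a coideal. *)
Lemma knuth_lump_de x x' A B : kcl x = kcl x' ->
  \sum_(a <- kfiber A) \sum_(b <- kfiber B) mr_de k a b x
  = \sum_(a <- kfiber A) \sum_(b <- kfiber B) mr_de k a b x'.
Proof.
have sumE y : \sum_(a <- kfiber A) \sum_(b <- kfiber B) mr_de k a b y
    = \sum_(j < (size y).+1) (kcl (st (small j y)) == A)%:R * (kcl (st (large j y)) == B)%:R.
  pose n := maxn (size y) (maxn (kdeg A) (kdeg B)).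
  have fibE (F : sperm -> k) X : (kdeg X <= n)%N ->
      \sum_(a <- kfiber X) F a = \sum_(a <- sperms n) (kcl a == X)%:R * F a.
    move=> Xn; rewrite [RHS](eq_bigr (fun a => if kcl a == X then F a else 0)).
      rewrite -big_mkcond -[RHS]big_filter; apply/perm_big/uniq_perm.
      + exact: kfiber_uniq.
      + exact/filter_uniq/(upto_uniq sperm_index).
      move=> a; rewrite mem_kfiber mem_filter (mem_upto sperm_index).
      by apply/esym/andb_idr => /eqP aX; rewrite -kdeg_kcl aX.
    by move=> a _; case: eqP; rewrite ?mul1r ?mul0r.
  rewrite fibE; last by rewrite /n !leq_max leqnn orbT.
  transitivity (\sum_(a <- sperms n) \sum_(b <- sperms n)
      mr_de k a b y *: ((kcl a == A)%:R * (kcl b == B)%:R : k^o)).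
    apply: eq_bigr => a _; rewrite fibE; last by rewrite /n !leq_max leqnn !orbT.
    rewrite mulr_sumr; apply: eq_bigr => b _.
    by rewrite /GRing.scale /=; ring.
  by rewrite (@sum_mr_de k k^o) // /n leq_max leqnn.
move=> /eqP; rewrite kcl_eq => xx'; rewrite !sumE (knuth_size xx').
by apply: eq_bigr => j _; rewrite (knuth_small _ xx') (knuth_large _ xx').
Qed.

(** The default [x] of [insubd] is never reached when
    [size x = size a + size b]. *)
Definition restandardize a b x : sperm :=
  insubd x (relabel a (take (size a) x) ++ relabel b (drop (size a) x)).

Section Restandardize.
Variables a b x : sperm.
Hypothesis sx : size x = (size a + size b)%N.

Let su : size (take (size a) x) = size a.
Proof. by rewrite size_takel // sx leq_addr. Qed.
Let sv : size (drop (size a) x) = size b.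
Proof. by rewrite size_drop sx addKn. Qed.

Lemma restandardizeE : sword (restandardize a b x)
  = relabel a (take (size a) x) ++ relabel b (drop (size a) x).
Proof.
rewrite -[LHS]/(val _) insubdK //; apply: (@perm_iota_word _ (size x)).
have px : perm_eq x (iota 1 (size x)) := valP x.
rewrite -(permPr px) -{3}(cat_take_drop (size a) x).
exact: perm_cat (relabel_perm su) (relabel_perm sv).
Qed.

Lemma restandardize_take : take (size a) (restandardize a b x) = relabel a (take (size a) x).
Proof. by rewrite restandardizeE take_size_cat // size_map. Qed.

Lemma restandardize_drop : drop (size a) (restandardize a b x) = relabel b (drop (size a) x).
Proof. by rewrite restandardizeE drop_size_cat // size_map. Qed.

Lemma take_restandardize : perm_eq (take (size a) (restandardize a b x)) (take (size a) x).
Proof. by rewrite restandardize_take; apply: relabel_perm. Qed.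

Lemma drop_restandardize : perm_eq (drop (size a) (restandardize a b x)) (drop (size a) x).
Proof. by rewrite restandardize_drop; apply: relabel_perm. Qed.

Lemma st_take_restandardize : st (take (size a) (restandardize a b x)) = a.
Proof. by rewrite restandardize_take st_relabel // take_uniq ?sperm_uniq. Qed.

Lemma st_drop_restandardize : st (drop (size a) (restandardize a b x)) = b.
Proof. by rewrite restandardize_drop st_relabel // drop_uniq ?sperm_uniq. Qed.

End Restandardize.

Lemma relabel_eq_perm a (u v : seq nat) : perm_eq u v -> relabel a u = relabel a v.
Proof.
move=> uv; rewrite /relabel.
by have /(perm_sortP leq_total leq_trans anti_leq) -> := uv.
Qed.

Lemma relabel_plactic a a' (u : seq nat) : uniq u -> size u = size a -> knuth a a' ->
  plactic (relabel a u) (relabel a' u).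
Proof.
by move=> Uu ua /knuthP aa'; apply: plactic_map aa'; apply: relabel_mono.
Qed.

(** A term of the product of [a] and [b] becomes a term of the product of [a']
    and [b'] when its two parts are restandardized; its Knuth class does not change,
    because the plactic equivalence is a congruence. *)
Lemma knuth_lump_mu a b a' b' X : kcl a = kcl a' -> kcl b = kcl b' ->
  \sum_(x <- kfiber X) mr_mu q a b x = \sum_(x <- kfiber X) mr_mu q a' b' x.
Proof.
move=> /eqP; rewrite kcl_eq => aa' /eqP; rewrite kcl_eq => bb'.
pose valid a b x := (st (take (size a) x) == a) && (st (drop (size a) x) == b).
have sumE c d : \sum_(x <- kfiber X) mr_mu q c d x
    = \sum_(x <- [seq x <- kfiber X | valid c d x])
        q ^+ cross (take (size c) x) (drop (size c) x).
  rewrite [RHS]big_filter [RHS]big_mkcond; apply: eq_bigr => x _.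
  by rewrite /mr_mu -/(valid c d x); case: ifP; rewrite ?mul1r ?mul0r.
have key (c d c' d' : sperm) : knuth c c' -> knuth d d' -> forall x,
    x \in [seq x <- kfiber X | valid c d x] ->
    [/\ restandardize c' d' x \in [seq x <- kfiber X | valid c' d' x],
        restandardize c d (restandardize c' d' x) = x &
        cross (take (size c) x) (drop (size c) x)
        = cross (take (size c') (restandardize c' d' x)) (drop (size c') (restandardize c' d' x))].
  move=> cc' dd' x; rewrite mem_filter mem_kfiber => /andP[/andP[/eqP Ec /eqP Ed] /eqP xX].
  have sx := mr_mu_size Ec Ed; have scc := knuth_size cc'; have sdd := knuth_size dd'.
  have sx' : size x = (size c' + size d')%N by rewrite -scc -sdd.
  have p1 := take_restandardize sx'; have p2 := drop_restandardize sx'.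
  have Uu : uniq (take (size c) x) := take_uniq _ (sperm_uniq x).
  have Uv : uniq (drop (size c) x) := drop_uniq _ (sperm_uniq x).
  have su : size (take (size c) x) = size c by rewrite size_takel // sx leq_addr.
  have sv : size (drop (size c) x) = size d by rewrite size_drop sx addKn.
  have rc : relabel c (take (size c) x) = take (size c) x.
    apply: st_inj; rewrite ?st_relabel ?relabel_perm //.
    by rewrite (perm_uniq (relabel_perm su)).
  have rd : relabel d (drop (size c) x) = drop (size c) x.
    apply: st_inj; rewrite ?st_relabel ?relabel_perm //.
    by rewrite (perm_uniq (relabel_perm sv)).
  split.
  - rewrite mem_filter mem_kfiber /valid st_take_restandardize // st_drop_restandardize //.
    rewrite !eqxx /= -xX kcl_eq; apply/knuthP; rewrite restandardizeE //.
    rewrite -[X in plactic _ X](cat_take_drop (size c)) -scc; apply: plactic_cat.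
      by rewrite -[X in plactic _ X]rc; apply: plactic_sym; apply: relabel_plactic.
    by rewrite -[X in plactic _ X]rd; apply: plactic_sym; apply: relabel_plactic.
  - apply: val_inj; rewrite /= restandardizeE; last first.
      by rewrite restandardizeE // size_cat /relabel !size_map scc sdd.
    rewrite scc (relabel_eq_perm _ p1) (relabel_eq_perm _ p2) -scc rc rd.
    exact: cat_take_drop.
  - by rewrite -scc in p1 p2 *; rewrite (cross_perm p1 p2).
rewrite !sumE; apply: (@reindex_seq _ _ _ _ _ (restandardize a' b') (restandardize a b)).
- exact/filter_uniq/kfiber_uniq.
- exact/filter_uniq/kfiber_uniq.
- by move=> x /(key _ _ _ _ aa' bb')[-> -> ->].
have a'a : knuth a' a by rewrite /knuth eq_sym.
have b'b : knuth b' b by rewrite /knuth eq_sym.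
by move=> x /(key _ _ _ _ a'a b'b)[-> -> _].
Qed.

End Lumpable.

End KnuthClasses.

(** * The two Malvenuto-Reutenauer algebras in rescaled bases *)

Lemma invrM_cancel (R : comUnitRingType) (a b c : R) :
    a \is a GRing.unit -> b \is a GRing.unit -> c \is a GRing.unit ->
  (a * b * c)^-1 * c = a^-1 * b^-1.
Proof.
move=> aU bU cU; rewrite invrM ?unitrM ?aU // invrM //.
by rewrite mulrAC mulVr // mul1r mulrC.
Qed.

Section Rescaled.
Variables (k : comUnitRingType).

Lemma malg_basis (K : choiceType) :
  is_basis (fun w : K => << w >> : {malg k[K]}) id.
Proof.
split=> // x; rewrite /linext {3}[x]monalgE; apply: eq_bigr => w _.
by apply/malgP => v; rewrite mcoeffZ !mcoeffU mulrnAr mulr1.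
Qed.

Lemma scaled_basis (K : choiceType) (f : K -> k) :
    (forall w, f w \is a GRing.unit) ->
  is_basis (fun w : K => f w *: << w >> : {malg k[K]})
    (linext (fun w => (f w)^-1 *: << w >>)).
Proof.
move=> fU; split=> [|w|x]; first exact: linext_linear.
  by rewrite linearZ /= linextU scalerA mulrV // scale1r.
move: x; apply: (basis_ext (malg_basis K)) => [||w].
- by apply: (lin_comp (f := linext _)); apply: linext_linear.
- exact: id_linear.
by rewrite linextU linearZ /= linextU scalerA mulVr // scale1r.
Qed.

Variables (q : k) (hq : q \is a GRing.unit).
Implicit Types a b c x y : sperm.

Definition weight x : k := q ^+ ninv x.

Lemma weight_unit x : weight x \is a GRing.unit.
Proof. exact: unitrX. Qed.

(** In the basis [tilde] of MR and the dual basis [hat] of MR', the structure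
    constants are [mr_mu] and [mr_de], in opposite roles; moreover [Jq] is spanned
    by the differences of the elements [tilde w] of a Knuth class. *)
Definition tilde x : kS k := (weight x)^-1 *: << x >>.
Definition hat x : kS k := weight x *: << x >>.

Lemma tilde_basis : is_basis tilde (linext hat).
Proof.
have -> : hat = fun x => ((weight x)^-1)^-1 *: << x >>.
  by apply/funext => x; rewrite invrK.
by apply: scaled_basis => x; rewrite unitrV weight_unit.
Qed.

Lemma weight_one : weight sone = 1.
Proof. by rewrite /weight ninvE. Qed.

Lemma weight_cat a b x : st (take (size a) x) = a -> st (drop (size a) x) = b ->
  weight x = weight a * weight b * q ^+ cross (take (size a) x) (drop (size a) x).
Proof.
move=> Ea Eb; rewrite /weight -{1}(cat_take_drop (size a) x) ninv_cat !exprD.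
rewrite -(ninv_st (take_uniq (size a) (sperm_uniq x))).
by rewrite -(ninv_st (drop_uniq (size a) (sperm_uniq x))) Ea Eb.
Qed.

Lemma weight_restrict j x : (j <= size x)%N ->
  weight x = weight (st (small j x)) * weight (st (large j x)) * q ^+ invi j x.
Proof.
move=> jx; rewrite /weight (ninv_filter j) !exprD.
rewrite (ninv_st (filter_uniq _ (sperm_uniq x))).
by rewrite st_large ?sperm_uniq // (ninv_st (filter_uniq _ (sperm_uniq x))).
Qed.

Lemma basE x : bas k x = << x >>.
Proof. by rewrite /bas valK. Qed.

Lemma mcoeff_bas (u : seq nat) x : (bas k u)@_x = (u == x :> seq nat)%:R.
Proof.
rewrite /bas; case: insubP => [y _ <-|nu]; first by rewrite mcoeffU (inj_eq val_inj).
rewrite mcoeff0; case: eqP => // ux; case/negP: nu; rewrite ux; exact: (valP x).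
Qed.

Lemma mcoeff_linext_bas (g : {malg k[seq nat]}) x : (linext (@bas k) g)@_x = g@_(sword x).
Proof.
move: g; apply: (basis_ext (malg_basis _) (V := k^o)) => [c u v|c u v|u] /=.
- by rewrite linearP /= mcoeffD mcoeffZ.
- by rewrite mcoeffD mcoeffZ.
by rewrite linextU mcoeff_bas mcoeffU; case: eqP.
Qed.

Lemma mcoeff_sperms n (c : sperm -> k) x :
  (\sum_(y <- sperms n) c y *: << y >> : kS k)@_x = if x \in sperms n then c x else 0.
Proof.
rewrite raddf_sum /= (eq_bigr (fun y => (x == y)%:R * c y)).
  by rewrite (sum_deltal _ _ (upto_uniq sperm_index n)).
by move=> y _; rewrite mcoeffZ mcoeffU (eq_sym x) mulrC.
Qed.

(** ** The product of MR *)

Lemma letters_inj N : injective (@letters N).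
Proof. by apply: inj_map => i j [/val_inj]. Qed.

Lemma letters_exist N (w : seq nat) : {in w, forall i, 0 < i <= N}%N ->
  exists t : seq 'I_N, letters t = w.
Proof.
elim: w => [|y w IH] yP; first by exists [::].
have [|t <-] := IH; first by move=> z zw; apply: yP; rewrite inE zw orbT.
have /andP[y0 yN] := yP y (mem_head _ _).
have yN' : (y.-1 < N)%N by rewrite prednK.
by exists (Ordinal yN' :: t); rewrite /= prednK.
Qed.

Lemma letters_exist_tuple N (w : seq nat) n : {in w, forall i, 0 < i <= N}%N ->
  size w = n -> exists t : n.-tuple 'I_N, letters t = w.
Proof.
move=> /letters_exist[t tw] wn; have tn : size t == n by rewrite -wn -tw size_map.
by exists (Tuple tn).
Qed.

(** The letters of two words covering the alphabet [1, ..., |a| + |b|] form a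
    permutation, and conversely a permutation is cut into two such words. *)
Lemma mr_mulE n a b : (size a + size b <= n)%N -> mr_mul k a b =
  \sum_(x <- sperms n)
    ((st (take (size a) x) == a) && (st (drop (size a) x) == b))%:R *: << x >>.
Proof.
move=> abn; apply/malgP => x; rewrite mcoeff_sperms.
have -> : (if x \in sperms n then ((st (take (size a) x) == a) &&
    (st (drop (size a) x) == b))%:R else 0 : k) =
    ((st (take (size a) x) == a) && (st (drop (size a) x) == b))%:R.
  case: ifP => // /negbT; rewrite (mem_upto sperm_index) => xn.
  case: andP => // -[/eqP Ea /eqP Eb]; case/negP: xn.
  by rewrite /sdeg (mr_mu_size Ea Eb).
rewrite /mr_mul raddf_sum /=; under eq_bigr do rewrite raddf_sum /=.
have [sx|sx] := eqVneq (size x) (size a + size b)%N; last first.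
  rewrite big1 => [|u _]; last first.
    rewrite big1 // => v _; rewrite mcoeff_bas; case: eqP => // uv.
    by case/eqP: sx; rewrite -uv size_cat !size_map !size_tuple.
  by case: andP => // -[/eqP Ea /eqP Eb]; rewrite (mr_mu_size Ea Eb) eqxx in sx.
have lett : {in sword x, forall i, 0 < i <= size a + size b}%N.
  by move=> y; rewrite sperm_mem sx.
have lu : {in take (size a) x, forall i, 0 < i <= size a + size b}%N by move=> i /mem_take /lett.
have lv : {in drop (size a) x, forall i, 0 < i <= size a + size b}%N by move=> i /mem_drop /lett.
have su : size (take (size a) x) = size a by rewrite size_takel // sx leq_addr.
have sv : size (drop (size a) x) = size b by rewrite size_drop sx addKn.
have [u0 Eu0] := letters_exist_tuple lu su; have [v0 Ev0] := letters_exist_tuple lv sv.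
have catE (u : (size a).-tuple 'I_(size a + size b)) (v : (size b).-tuple 'I_(size a + size b)) :
    (letters u ++ letters v == x) = (u == u0) && (v == v0).
  rewrite -{1}(cat_take_drop (size a) x) -Eu0 -Ev0 eqseq_cat ?size_map ?size_tuple //.
  by rewrite !(inj_eq (@letters_inj _)) -!val_eqE.
rewrite (bigD1 u0) //= [X in _ + X]big1 ?addr0 => [|u uu0]; last first.
  by rewrite big1 // => v _; rewrite mcoeff_bas catE (negbTE uu0).
rewrite big_mkcond (bigD1 v0) //= big1 ?addr0 => [|v vv0]; last first.
  by rewrite mcoeff_bas catE (negbTE vv0) andbF if_same.
rewrite mcoeff_bas catE !eqxx Eu0 Ev0.
have -> : [forall i, (i \in u0) || (i \in v0)].
  apply/forallP => i; rewrite -mem_cat -(mem_map (f := fun i : 'I__ => (nat_of_ord i).+1)).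
    by rewrite map_cat -/(letters _) -/(letters _) Eu0 Ev0 cat_take_drop sperm_mem sx /=.
  by move=> i1 i2 [/val_inj].
by rewrite andbT; case: (_ && _).
Qed.

Lemma MR_presents : presents sdeg sperms sone tilde (mr_mu q) (mr_de k) (MR q).
Proof.
split=> [|n a b abn|||n x xn||a].
- exact: bilext_bilinear.
- rewrite /= (bil_scale _ _ _ _ (bilext_bilinear _)) bilextE (mr_mulE abn).
  rewrite scaler_sumr; apply: eq_bigr => x _; rewrite /mr_mu /tilde !scalerA.
  case: andP => [[/eqP Ea /eqP Eb]|_]; last by rewrite mulr0 !mul0r.
  congr (_ *: _); rewrite mulr1 mul1r (weight_cat Ea Eb) [RHS]mulrC.
  by rewrite invrM_cancel ?weight_unit ?unitrX.
- by rewrite /= (basE sone : bas k [::] = _) /tilde weight_one invr1 scale1r.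
- exact: linext_linear.
- rewrite (@sum_mr_de k _ n x (fun a b => tilde a ⊗ tilde b) xn).
  rewrite /= linearZ /= linextU /mr_comul big_mkord scaler_sumr.
  apply: eq_bigr => j _; have jx : (j <= size x)%N by rewrite -ltnS.
  have Es : bas k [seq y <- sword x | (y <= j)%N] = << st (small j x) >>.
    by rewrite -basE /= (st_word_id (small_perm_word (valP x) jx)).
  rewrite scalerA Es -st_large ?sperm_uniq // /tilde.
  rewrite (bil_scale _ _ _ _ (tens_bilinear _ _)).
  have -> : (weight x)^-1 * q ^+ invi j x
      = (weight (st (small j x)))^-1 * (weight (st (large j x)))^-1.
    by rewrite (weight_restrict jx) invrM_cancel ?weight_unit ?unitrX.
  by [].
- exact: linext_linear.
- rewrite /= /kS_counit linearZ /= linextU -(index_deg0 sperm_index).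
  case: eqP => [a0|]; last by rewrite scaler0.
  have -> : a = sone by apply/eqP; rewrite -(index_deg0 sperm_index) /sdeg a0.
  by rewrite weight_one invr1 scale1r.
Qed.

(** ** The product of MR' *)

Lemma mcoeff_prep (i : nat) (g : {malg k[seq nat]}) (w : seq nat) :
  (prep i g)@_w = if w is j :: w' then (i == j)%:R * g@_w' else 0.
Proof.
move: g; apply: (basis_ext (malg_basis _) (V := k^o)) => [c u v|c u v|u] /=.
- by rewrite /prep linearP /= mcoeffD mcoeffZ.
- case: w => [|j w]; first by rewrite scaler0 addr0.
  by rewrite mcoeffD mcoeffZ /GRing.scale /=; ring.
rewrite /prep linextU mcoeffU; case: w => [|j w] //.
by rewrite mcoeffU eqseq_cons -natrM mulnb.
Qed.

(** The exponent of [q] counts the pairs formed by a letter of [v] preceding a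
    letter of [u]: each step of the recursion that takes a letter of [v] first
    makes it precede all the remaining letters of [u]. *)
Lemma mcoeff_qshuffle (p : pred nat) (u v w : seq nat) :
    all p u -> all (predC p) v ->
  (qshuffle q u v)@_w = ((filter p w == u) && (filter (predC p) w == v))%:R
    * q ^+ count_pairs (fun i j => ~~ p i && p j) w.
Proof.
have pairs0 (w1 : seq nat) : all (predC p) w1 -> count_pairs (fun i j => ~~ p i && p j) w1 = 0%N.
  elim: w1 => //= i w1 IH /andP[_ /[dup] w1p /IH ->]; rewrite addn0.
  apply/eqP; rewrite -leqn0 leqNgt -has_count; apply/negP => /hasP[j jw /andP[_ pj]].
  by have := allP w1p j jw; rewrite /= pj.
have pairs0' (w1 : seq nat) : all p w1 -> count_pairs (fun i j => ~~ p i && p j) w1 = 0%N.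
  elim: w1 => //= i w1 IH /andP[pi /IH ->]; rewrite pi addn0.
  by rewrite (@eq_count _ _ pred0) ?count_pred0.
elim: w u v => [|h w IH] u v pu pv.
  case: u pu => [|a u] pu; first by case: v pv => [|b v] pv /=; rewrite mcoeffU ?mulr1 ?mul0r.
  case: v pv => [|b v] pv /=; first by rewrite mcoeffU mul0r.
  by rewrite mcoeffD mcoeffZ !mcoeff_prep mulr0 addr0 mul0r.
case: u pu => [|a u] pu.
  have -> : qshuffle q [::] v = << v >> by case: (v).
  rewrite mcoeffU; case: (eqVneq v (h :: w)) => [vE|vw].
    rewrite vE in pv *; rewrite (all_filterP pv) eqxx andbT pairs0 // mulr1.
    have /eqP -> // : filter p (h :: w) == [::].
    by rewrite -[_ == _]negbK -has_filter -all_predC.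
  case: andP => [[/eqP E0 /eqP Ev]|_]; last by rewrite mul0r.
  case/eqP: vw; rewrite -Ev; apply/all_filterP; rewrite all_predC.
  by rewrite has_filter E0.
case: v pv => [|b v] pv.
  rewrite [qshuffle _ _ _]/= mcoeffU; case: (eqVneq (a :: u) (h :: w)) => [uE|uw].
    rewrite uE in pu *; rewrite (all_filterP pu) eqxx pairs0' // mulr1.
    have /eqP -> // : filter (predC p) (h :: w) == [::].
    rewrite -[_ == _]negbK -has_filter -all_predC.
    by rewrite (eq_all (a2 := p)) ?pu // => i /=; rewrite negbK.
  case: andP => [[/eqP Eu /eqP E0]|_]; last by rewrite mul0r.
  case/eqP: uw; rewrite -Eu; apply/all_filterP.
  have : ~~ has (predC p) (h :: w) by rewrite has_filter E0.
  by rewrite -all_predC (eq_all (a2 := p)) // => i /=; rewrite negbK.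
have /andP[pa pu'] := pu; have /andP[pb pv'] := pv.
rewrite [qshuffle _ _ _]/= -/(qshuffle q (a :: u) v) mcoeffD mcoeffZ !mcoeff_prep.
rewrite (IH u (b :: v) pu' pv) (IH (a :: u) v pu pv') /=.
case: (boolP (p h)) => ph /=.
  have -> : (b == h) = false by apply: contraNF pb => /eqP ->.
  rewrite (@eq_count _ (fun=> false) pred0) // count_pred0 add0n mul0r mulr0 addr0.
  by rewrite eqseq_cons (eq_sym h) mulrA -natrM mulnb andbA.
have -> : (a == h) = false by apply: contraNF ph => /eqP <-.
rewrite mul0r add0r.
rewrite eqseq_cons (eq_sym h).
case: (eqVneq (filter p w) (a :: u)) => [Eu|_]; last by rewrite /= !mul0r !mulr0.
have -> : count p w = (size u).+1 by rewrite -size_filter Eu.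
by rewrite exprD; case: (b == h); rewrite /= ?mul0r ?mulr0 ?mul1r //; ring.
Qed.

Lemma mr'_mulE n a b : (size a + size b <= n)%N -> mr'_mul q a b =
  \sum_(x <- sperms n) (mr_de k a b x * q ^+ invi (size a) x) *: << x >>.
Proof.
move=> abn; apply/malgP => x; rewrite mcoeff_sperms /mr'_mul mcoeff_linext_bas.
have -> : (if x \in sperms n then mr_de k a b x * q ^+ invi (size a) x else 0)
    = mr_de k a b x * q ^+ invi (size a) x.
  case: ifP => // /negbT; rewrite (mem_upto sperm_index) => xn.
  rewrite mr_de_deg ?mul0r //; apply: contra xn => /eqP ->; exact: abn.
rewrite (@mcoeff_qshuffle (fun i => i <= size a)%N); last 2 first.
- by apply/allP => i; rewrite sperm_mem => /andP[].
- by apply/allP => _ /mapP[i + ->]; rewrite sperm_mem /=; lia.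
congr (_ * q ^+ _); last first.
  rewrite inviE; elim: (sword x) => //= i w ->; congr addn.
  by apply: eq_count => j /=; rewrite -ltnNge andbC.
rewrite /mr_de; congr (_ && _)%:R.
have -> : filter (predC (fun i => i <= size a)%N) x = [seq i <- sword x | (size a < i)%N].
  by apply: eq_filter => i /=; rewrite -ltnNge.
by rewrite -addn_large (inj_eq (inj_map (@addIn _))).
Qed.

Lemma MR'_presents : presents sdeg sperms sone hat (mr_de k) (mr_mu q) (MR' q).
Proof.
split=> [|n a b abn|||n x xn||a].
- exact: bilext_bilinear.
- rewrite /= (bil_scale _ _ _ _ (bilext_bilinear _)) bilextE (mr'_mulE abn).
  rewrite scaler_sumr; apply: eq_bigr => x _; rewrite /hat !scalerA.
  congr (_ *: _); rewrite /mr_de; case: andP => [[/eqP Ea /eqP Eb]|_]; last first.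
    by rewrite !mul0r mulr0.
  have ax : (size a <= size x)%N by rewrite -Ea size_filter count_size.
  rewrite (weight_restrict ax) Ea Eb !st_id.
  by rewrite /=; ring.
- by rewrite /= (basE sone : bas k [::] = _) /hat weight_one scale1r.
- exact: linext_linear.
- rewrite (@sum_mr_mu k q _ n x (fun a b => hat a ⊗ hat b) xn).
  rewrite /= linearZ /= linextU /mr'_comul big_mkord scaler_sumr.
  apply: eq_bigr => j _; have jx : (j <= size x)%N by rewrite -ltnS.
  rewrite /hat (bil_scale _ _ _ _ (tens_bilinear _ _)) scalerA.
  have -> : weight x = q ^+ cross (take j x) (drop j x)
      * (weight (st (take j x)) * weight (st (drop j x))).
    rewrite /weight -{1}(cat_take_drop j x) ninv_cat !exprD.
    by rewrite !ninv_st ?take_uniq ?drop_uniq ?sperm_uniq // mulrC.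
  by [].
- exact: linext_linear.
- rewrite /= /kS_counit linearZ /= linextU -(index_deg0 sperm_index).
  case: eqP => [a0|]; last by rewrite scaler0.
  have -> : a = sone by apply/eqP; rewrite -(index_deg0 sperm_index) /sdeg a0.
  by rewrite weight_one scale1r.
Qed.

End Rescaled.

(** * The quotient by Jq and its orthogonal complement *)

Section PoirierReutenauer.
Variables (k : comUnitRingType) (q : k) (hq : q \is a GRing.unit).
Implicit Types w : sperm.
Notation wt := (weight q).
Notation J := (Jq q).
Notation kfiber := (fiber sperms kdeg kcl).

Let wtU w : wt w \is a GRing.unit. Proof. exact: weight_unit. Qed.

(** The integer power of [q] in the generators is a quotient of weights. *)
Lemma Jq_gen (x : kS k) :
  (exists w w' : sperm, knuth w w' /\
     x = << w' >> - q ^ ((ninv w')%:Z - (ninv w)%:Z) *: << w >>) <->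
  (exists w w' : sperm, knuth w w' /\ x = << w' >> - (wt w' / wt w) *: << w >>).
Proof.
have E w w' : q ^ ((ninv w')%:Z - (ninv w)%:Z) = wt w' / wt w.
  by rewrite exprzDr // -exprnP -exprnN.
by split=> -[w [w' [ww' ->]]]; exists w, w'; rewrite E.
Qed.

Lemma mem_Jq w w' : knuth w w' -> << w' >> - (wt w' / wt w) *: << w >> \in J.
Proof. by move=> ww'; apply/mem_span/Jq_gen; exists w, w'. Qed.

Lemma Jq_ind (V : lmodType k) (f : kS k -> V) (g : kS k) : linear f ->
    (forall w w', knuth w w' -> f << w' >> = (wt w' / wt w) *: f << w >>) ->
  g \in J -> f g = 0.
Proof.
move=> fl fE /asboolP[s [sP ->]]; rewrite lin_sum // big_seq big1 // => p /sP.
move=> /Jq_gen[w [w' [ww' ->]]].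
by rewrite addrC -scaleNr fl (fE _ _ ww') scaleNr addNr scaler0.
Qed.

(** ** The basis of the quotient *)

Definition pr_elt (X : kclass) : quotm J := qpi J (tilde q (sval X)).

(** The linear map sending [tilde w] to the class of [w].  It vanishes on [Jq], and
    gives the coordinates on the quotient. *)
Definition class_coords : kS k -> {malg k[kclass]} := linext (fun w => wt w *: << kcl w >>).

Lemma class_coords_linear : linear class_coords.
Proof. exact: linext_linear. Qed.

Lemma class_coordsU w : class_coords << w >> = wt w *: << kcl w >>.
Proof. exact: linextU. Qed.

Lemma class_coords_Jq g : g \in J -> class_coords g = 0.
Proof.
apply: Jq_ind class_coords_linear _ => w w' ww'; rewrite !class_coordsU scalerA.
have -> : kcl w = kcl w' by apply/eqP; rewrite kcl_eq.
by rewrite divrK.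
Qed.

Definition pr_coords (z : quotm J) : {malg k[kclass]} := class_coords (qrepr z).

Lemma pr_coords_qpi g : pr_coords (qpi J g) = class_coords g.
Proof.
apply/eqP; rewrite -subr_eq0 -[class_coords]/(lin_pack class_coords_linear : _ -> _).
rewrite /pr_coords -[class_coords]/(lin_pack class_coords_linear : _ -> _) -linearB.
by apply/eqP/class_coords_Jq/qpi_eq; rewrite qreprK.
Qed.

(** The generators of [Jq] are, up to units, the differences of the elements
    [tilde w] of a Knuth class. *)
Lemma qpi_tilde w : qpi J (tilde q w) = pr_elt (kcl w).
Proof.
apply/qpi_eq; have kw : knuth (sval (kcl w)) w.
  by rewrite /knuth eq_sym; apply: knuth_reprP.
have := rpredZ (wt w)^-1 (mem_Jq kw).
by rewrite scalerBr scalerA mulrA mulVr // mul1r.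
Qed.

Lemma pr_basis : is_basis pr_elt pr_coords.
Proof.
split=> [a z z'|X|z].
- rewrite -[z]qreprK -[z']qreprK -linearP !pr_coords_qpi.
  exact: class_coords_linear.
- rewrite /pr_elt pr_coords_qpi /tilde.
  rewrite -[class_coords]/(lin_pack class_coords_linear : _ -> _) linearZ /=.
  by rewrite class_coordsU scalerA mulVr // scale1r kclK.
rewrite -[z]qreprK pr_coords_qpi; move: (qrepr z).
apply: (basis_ext (malg_basis k _)).
- by apply: (lin_comp (f := linext _)); [apply: linext_linear|apply: class_coords_linear].
- exact: qpi_linear.
move=> w; rewrite class_coordsU linearZ /= linextU -qpi_tilde -linearZ /tilde /=.
by rewrite scalerA mulrV // scale1r.
Qed.

Definition muC := lumped_mu sperms kdeg kcl (@sval _ _) (mr_mu q).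
Definition deC := lumped_de sperms kdeg kcl (@sval _ _) (mr_de k).

Lemma class_constants : qhopf_constants q kdeg kclasses kone muC deC.
Proof.
apply: (lumped_constants sperm_index kclass_index kclK kdeg_kcl (mr_constants q)).
- by move=> *; apply: knuth_lump_mu.
- by move=> *; apply: knuth_lump_de.
Qed.

Definition PRq : hopf_data (quotm J) :=
  constant_hopf kdeg kclasses kone pr_elt muC deC pr_coords.

Lemma PRq_morphism : hopf_morphism (MR q) PRq (qpi J).
Proof.
apply: (lumped_quotient sperm_index kclass_index kclK kdeg_kcl _ _ (tilde_basis hq)
  (MR_presents hq) _ (@qpi_linear _ _ _) qpi_tilde).
- by move=> *; apply: knuth_lump_mu.
- by move=> *; apply: knuth_lump_de.
exact (constant_hopf_presents kclass_index class_constants pr_basis).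
Qed.

Lemma kS_degP n (x : kS k) : kS_deg n x <-> forall w, size w != n -> x@_w = 0.
Proof.
split=> [xn w wn|xn w]; first by apply: mcoeff_outdom; apply: contra wn => /xn ->.
by rewrite -mcoeff_neq0; apply: contraNeq => /xn ->.
Qed.

Lemma class_coords_coef (x : kS k) X :
    (forall w, kcl w = X -> x@_w = 0) -> (class_coords x)@_X = 0.
Proof.
move=> xX; rewrite /class_coords /linext raddf_sum /= big1 // => w _.
rewrite !mcoeffZ mcoeffU; case: (eqVneq (kcl w) X) => [/xX ->|_]; first by rewrite mul0r.
by rewrite !mulr0.
Qed.

Lemma PRq_deg n z : hdeg PRq n z <-> exists2 x, hdeg (MR q) n x & qpi J x = z.
Proof.
split=> [zn|[x /kS_degP xn <-] X Xn]; last first.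
  rewrite pr_coords_qpi; apply: class_coords_coef => w wX; apply: xn.
  by rewrite -[size w]kdeg_kcl wX.
exists (\sum_(X <- kclasses n | kdeg X == n) (pr_coords z)@_X *: tilde q (sval X)).
  apply/kS_degP => w wn; rewrite raddf_sum /= big1 // => X /eqP Xn.
  rewrite !mcoeffZ mcoeffU; case: eqP => [Xw|_]; last by rewrite !mulr0.
  by case/eqP: wn; rewrite -Xw.
rewrite lin_sum; last exact: qpi_linear.
by rewrite [RHS](hdeg_basis_sum kclass_index pr_basis zn).
Qed.

Lemma PRq_quotient : is_quotient_hopf (MR q) PRq.
Proof. by split; [exact: PRq_morphism | exact: PRq_deg]. Qed.

(** ** The basis of the orthogonal complement *)

Lemma kS_pair_bilinear : bilinear_for *:%R *:%R (@kS_pair k).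
Proof. exact: bilext_bilinear. Qed.

Lemma kS_pairU (x : kS k) w : kS_pair x << w >> = x@_w.
Proof.
move: x; apply: (basis_ext (malg_basis k _) (V := k^o)).
- exact: kS_pair_bilinear.1.
- by move=> c u v; rewrite mcoeffD mcoeffZ.
by move=> v; rewrite /kS_pair bilextE mcoeffU.
Qed.

Definition class_sum (X : kclass) : kS k := \sum_(w <- kfiber X) hat q w.

Lemma class_sum_coef X w : (class_sum X)@_w = (kcl w == X)%:R * wt w.
Proof.
rewrite raddf_sum /= (eq_bigr (fun v => (w == v)%:R * wt v)); last first.
  by move=> v _; rewrite mcoeffZ mcoeffU (eq_sym v) mulrC.
rewrite (sum_deltal _ _ (kfiber_uniq X)) mem_kfiber.
by case: eqP; rewrite ?mul1r ?mul0r.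
Qed.

Lemma class_sum_orth X : class_sum X \in orth J.
Proof.
apply/asboolP => g; apply: Jq_ind; first exact: kS_pair_bilinear.2.
move=> w w' ww'; rewrite !kS_pairU !class_sum_coef.
have -> : kcl w' = kcl w by apply/esym/eqP; rewrite kcl_eq.
by rewrite /GRing.scale /= mulrCA -mulrA mulVr // mulr1.
Qed.

Lemma orth_coef (x : kS k) w w' : x \in orth J -> knuth w w' ->
  x@_w' = wt w' / wt w * x@_w.
Proof.
move=> /asboolP xJ ww'; have := xJ _ (mem_Jq ww'); have [_ pr] := kS_pair_bilinear.
rewrite addrC -scaleNr pr !kS_pairU => xw.
have {xw} : - (wt w' / wt w) * x@_w + x@_w' = 0 := xw.
by rewrite mulNr addrC => /subr0_eq.
Qed.

Definition pr'_elt (X : kclass) : subm (orth J) := Subm (class_sum_orth X).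

(** An element orthogonal to [Jq] has proportional coefficients along a Knuth
    class, so its coordinate is read off at the representative of the class; the
    factor [(sval (kcl w) == w)%:R] selects the representatives. *)
Definition pr'_coords (x : subm (orth J)) : {malg k[kclass]} :=
  linext (fun w => (sval (kcl w) == w)%:R *: ((wt w)^-1 *: << kcl w >>)) (val x).

Lemma val_linear : linear (val : subm (orth J) -> kS k).
Proof. by move=> a x y; rewrite linearP. Qed.

Lemma pr'_coords_linear : linear pr'_coords.
Proof. by apply: (lin_comp (f := linext _)); [apply: linext_linear|apply: val_linear]. Qed.

Lemma pr'_coords_coef x X :
  (pr'_coords x)@_X = (wt (sval X))^-1 * (val x)@_(sval X).
Proof.
rewrite /pr'_coords; move: (val x) => {x}.
apply: (basis_ext (malg_basis k _) (V := k^o)).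
- by move=> c u v; rewrite linearP mcoeffD mcoeffZ.
- by move=> c u v; rewrite mcoeffD mcoeffZ /GRing.scale /=; ring.
move=> w; rewrite linextU !mcoeffZ !mcoeffU.
case: (eqVneq (kcl w) X) => [<-|wX]; last first.
  rewrite !mulr0; case: eqP => [wE|_]; last by rewrite mulr0.
  by case/eqP: wX; rewrite wE kclK.
rewrite mulr1 (eq_sym w); case: eqP => [->|_]; last by rewrite mul0r mulr0.
by rewrite mul1r mulr1.
Qed.

Lemma linext_class_sum (z : {malg k[kclass]}) w :
  (val (linext pr'_elt z))@_w = z@_(kcl w) * wt w.
Proof.
move: z; apply: (basis_ext (malg_basis k _) (V := k^o)).
- by move=> c u v; rewrite !linearP mcoeffD mcoeffZ.
- by move=> c u v; rewrite mcoeffD mcoeffZ mulrDl -mulrA.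
by move=> X; rewrite linextU class_sum_coef mcoeffU eq_sym.
Qed.

Lemma pr'_basis : is_basis pr'_elt pr'_coords.
Proof.
split=> [|X|x]; first exact: pr'_coords_linear.
  apply/malgP => Y; rewrite pr'_coords_coef class_sum_coef kclK mcoeffU.
  by rewrite mulrC -mulrA mulrV // mulr1 eq_sym.
apply: val_inj; apply/malgP => w; rewrite linext_class_sum pr'_coords_coef.
have kw : knuth (sval (kcl w)) w by rewrite /knuth eq_sym; apply: knuth_reprP.
by rewrite (orth_coef (valP x) kw) mulrC mulrA.
Qed.

Definition PRq' : hopf_data (subm (orth J)) :=
  constant_hopf kdeg kclasses kone pr'_elt deC muC pr'_coords.

Lemma PRq'_sub : is_sub_hopf (MR' q) PRq'.
Proof.
split=> [|n x].
  apply: (lumped_sub sperm_index kclass_index kclK kdeg_kcl _ _ pr'_basis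
    (MR'_presents hq) _ val_linear _).
  - by move=> *; apply: knuth_lump_mu.
  - by move=> *; apply: knuth_lump_de.
  - exact (constant_hopf_presents kclass_index (qhopf_constants_dual class_constants) pr'_basis).
  - by [].
split=> [xn|/kS_degP xn X Xn]; last by rewrite pr'_coords_coef xn ?mulr0.
apply/kS_degP => w wn; rewrite -(coK pr'_basis x) linext_class_sum xn ?mul0r //.
by rewrite kdeg_kcl.
Qed.

(** ** The pairing *)

(** Any representative gives the same value, by orthogonality to [Jq]. *)
Definition pr_pair (x : subm (orth J)) (z : quotm J) : k^o := kS_pair (val x) (qrepr z).

Lemma pr_pair_qpi x y : pr_pair x (qpi J y) = kS_pair (val x) y.
Proof.
have : qrepr (qpi J y) - y \in J by apply/qpi_eq; rewrite qreprK.
have /asboolP/[apply] := valP x; have [_ pr] := kS_pair_bilinear.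
rewrite addrC -scaleN1r pr => xy.
have {xy} : - 1 * kS_pair (val x) y + kS_pair (val x) (qrepr (qpi J y)) = 0 := xy.
by rewrite mulN1r addrC => /subr0_eq.
Qed.

Lemma pr_pair_bilinear : bilinear_for *:%R *:%R pr_pair.
Proof.
have [pl pr] := kS_pair_bilinear; split=> [z|x] a u v.
  by rewrite /pr_pair val_linear pl.
by rewrite -[u]qreprK -[v]qreprK -linearP !pr_pair_qpi pr.
Qed.

Lemma pr_pair_basis X Y : pr_pair (pr'_elt X) (pr_elt Y) = (X == Y)%:R.
Proof.
rewrite pr_pair_qpi /tilde; have [_ pr] := kS_pair_bilinear.
rewrite -[kS_pair _]/(lin_pack (pr _) : _ -> _) linearZ /= kS_pairU class_sum_coef kclK.
by rewrite /GRing.scale /= mulrC -mulrA mulrV // mulr1 eq_sym.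
Qed.

End PoirierReutenauer.

Theorem theorem4p2 (k : comUnitRingType) (q : k) (hq : q \is a GRing.unit) :
  exists (PR : hopf_data (quotm (Jq q)))
         (PR' : hopf_data (subm (orth (Jq q))))
         (b : subm (orth (Jq q)) -> quotm (Jq q) -> k^o),
    [/\ is_quotient_hopf (MR q) PR /\ is_sub_hopf (MR' q) PR',
        is_graded_qHopf q PR,
        is_graded_qHopf q PR',
        (forall x y, b x (qpi (Jq q) y) = kS_pair (val x) y)
      & graded_dual PR' PR b].
Proof.
have cst := class_constants q; have cst' := qhopf_constants_dual cst.
exists (PRq q), (PRq' hq), (@pr_pair _ q); split.
- by split; [exact: PRq_quotient | exact: PRq'_sub].
- exact: (constant_hopf_qHopf kclass_index cst (pr_basis hq)).
- exact: (constant_hopf_qHopf kclass_index cst' (pr'_basis hq)).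
- exact: pr_pair_qpi.
- exact: (constant_hopf_dual kclass_index cst (pr'_basis hq) (pr_basis hq)
    (pr_pair_bilinear q) (pr_pair_basis hq)).
Qed.
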